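(* Let $X\in\mathbb{R}^d$ be a random vector with mean $\theta_0$ and covariance matrix $\Sigma_0$, and assume (A1): $\Sigma_0$ is a finite covariance matrix of full rank $d$. Let $X_1,\dots,X_n$ ($n>d$) be independent copies of $X$, $\Theta_n$ the interior of their convex hull, $\tilde\theta$ the sample mean and $l(\theta)$ the empirical log-likelihood ratio for the mean. Let $h_n^C:\Theta_n\to\mathbb{R}^d$, $h_n^C(\theta)=\tilde\theta+\bigl(1+\frac{l(\theta)}{2n}\bigr)(\theta-\tilde\theta)$, be the composite similarity mapping (a bijection onto $\mathbb{R}^d$) with inverse $h_n^{-C}$, and define the extended empirical log-likelihood ratio $l^*(\theta)=l\bigl(h_n^{-C}(\theta)\bigr)$ for $\theta\in\mathbb{R}^d$. Then $$l^*(\theta_0)\xrightarrow{\ \mathcal D\ }\chi^2_d\qquad\text{as }n\to\infty.$$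
   Context: For $\theta\in\mathbb{R}^d$, the empirical likelihood ratio is $R(\theta)=\sup\{\prod_{i=1}^n nw_i : \sum_{i=1}^n w_i(X_i-\theta)=0,\ w_i\ge 0,\ \sum_{i=1}^n w_i=1\}$, and $l(\theta)=-2\log R(\theta)$; $l$ is finite exactly on $\Theta_n$. Standing convention: whenever (A1) is assumed, the convex hull of $X_1,\dots,X_n$ is understood to be nondegenerate (this holds with probability one). *)

(* Defs.v *)
From HB Require Import structures.
From mathcomp Require Import all_boot all_order all_algebra.
From mathcomp Require Import all_classical all_reals all_analysis.
Set Implicit Arguments. Unset Strict Implicit. Unset Printing Implicit Defensive.
Import Order.TTheory GRing.Theory Num.Theory.
Import numFieldNormedType.Exports.
Local Open Scope classical_set_scope.
Local Open Scope ring_scope.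

Section EL.
Variables (R : realType) (n d : nat).
Implicit Types (x : 'I_n -> 'rV[R]_d) (th : 'rV[R]_d).

Definition EL_ratio x th : R :=
  sup [set r : R | exists w : 'I_n -> R,
        [/\ (forall i, 0 <= w i), \sum_i w i = 1,
            \sum_i w i *: (x i - th) = 0 &
            r = \prod_i (n%:R * w i)]].

Definition ell x th : R := - 2 * ln (EL_ratio x th).

Definition conv_hull x : set 'rV[R]_d :=
  [set th | exists w : 'I_n -> R,
     [/\ (forall i, 0 <= w i), \sum_i w i = 1 & th = \sum_i w i *: x i]].

Definition Theta x : set 'rV[R]_d := interior (conv_hull x).

Definition sample_mean x : 'rV[R]_d := n%:R^-1 *: \sum_i x i.

Definition hC x th : 'rV[R]_d :=
  sample_mean x + (1 + ell x th / (2 * n%:R)) *: (th - sample_mean x).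

Definition hC_inv x th : 'rV[R]_d :=
  xget 0 [set eta | Theta x eta /\ hC x eta = th].

Definition ell_star x th : R := ell x (hC_inv x th).
End EL.

Section Chi2.
Variables (R : realType) (k : nat).
Definition chi2_kernel (t : R) : R :=
  (t `^ (k%:R / 2 - 1)) * expR (- t / 2).
Definition chi2_cdf (x : R) : R :=
  let I1 : set R := `[0, x]%classic in
  let I2 : set R := `[0, +oo[%classic in
  fine (\int[lebesgue_measure]_(t in I1) (chi2_kernel t)%:E)%E /
  fine (\int[lebesgue_measure]_(t in I2) (chi2_kernel t)%:E)%E.
End Chi2.

Section Prob.
Context {dsp : measure_display} {T : measurableType dsp} {R : realType}
        (P : probability T R) {d : nat}.

Definition box_event (Y : T -> 'rV[R]_d) (B : 'I_d -> set R) : set T :=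
  [set w | forall k, B k (Y w ord0 k)].

(** mutual independence of the sequence of random vectors (Xs i)_i:
    product rule for every initial segment and all Borel boxes (boxes form a
    pi-system generating the Borel sets of R^d; omitted vectors are handled by
    taking B i = setT). *)
Definition mutually_independent (Xs : nat -> T -> 'rV[R]_d) : Prop :=
  forall (m : nat) (B : 'I_m -> 'I_d -> set R),
    (forall i k, measurable (B i k)) ->
    P [set w | forall i : 'I_m, box_event (Xs i) (B i) w] =
    (\prod_(i < m) P (box_event (Xs i) (B i)))%E.

Definition same_law (Y X : T -> 'rV[R]_d) : Prop :=
  forall B : 'I_d -> set R, (forall k, measurable (B k)) ->
    P (box_event Y B) = P (box_event X B).
End Prob.

(* Main.v *)
(** Put [Z = X - theta0], [S_n = sum (X_i - theta0)], [M = Sigma0^-1] and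
    [V_n = S_n M S_n^T / n].

    Central limit theorem for [V_n].  Put [L_n(a) = E exp(-a S_n M S_n^T)].
    Expanding to second order in the last summand and averaging over it shows
    that [L_(n+1)(a)] is close to [(1 + 2a)^(-d/2) L_n(a / (1 + 2a))], the same
    step for a Gaussian summand; the errors add up to [o(1)] for [a = lambda / n].
    Hence [E exp(-lambda V_n)] tends to [(1 + 2 lambda)^(-d/2)], the Laplace
    transform of chi2_d, and approximating indicators of half-lines by
    polynomials in [exp(-t)] turns this into convergence of distribution functions.

    Reduction of [l*] to [V_n].  Along the ray [m + s (theta0 - m)] issued from
    the sample mean [m] the ratio [R] is continuous and decreasing, and
    [h_n^C(eta) = theta0] forces [eta] onto that ray with [s = (1 + l/2n)^-1].
    Therefore [l*(theta0) <= x] holds exactly when [R >= exp(-x/2)] at the point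
    of parameter [s = (1 + x/2n)^-1], which is [1 + o(1)].

    Size of [R].  Explicit weights, linear in [X_i], bound [R] from below, and
    weak duality (AM-GM) at the first-order multiplier bounds it from above; both
    give [-2 log R = (1 + o(1)) V_n] as soon as the sample covariance is close
    to [Sigma0] and [max |X_i|^2 = o(n)], which fails with probability [o(1)]. *)

Require Import Defs.
From HB Require Import structures.
From mathcomp Require Import all_boot all_order all_algebra.
From mathcomp Require Import all_classical all_reals all_analysis.
From mathcomp Require Import measurable_realfun.
From mathcomp Require Import ring lra.
Set Implicit Arguments. Unset Strict Implicit. Unset Printing Implicit Defensive.
Import Order.TTheory GRing.Theory Num.Theory.
Import numFieldNormedType.Exports.
Local Open Scope classical_set_scope.
Local Open Scope ring_scope.

(** * Expectation and independence *)

(** Only second moments are available, and this shapes the proof. A third-order Taylor remainder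
    need not be integrable, so it is replaced by [h * min(1, sqrt h)], with [h] quadratic in the
    summand: integrable, and negligible by dominated convergence. The test function [exp(-a Q(s))]
    fits this setting: [Q(s) exp(-a Q(s))] is bounded, and its Gaussian average is again of this
    form with parameter [a / (1 + 2a)], so the Gaussian law enters only through that formula. On the
    likelihood side the optimal multiplier is never solved for: a feasible point and a dual point
    already agree to first order. The remaining obstacle is that [hC_inv] is a choice of preimage,
    with default value 0 on degenerate samples, so nothing is known of its measurability. Expressing
    [ell_star <= x] through [EL_ratio] at an explicit point removes the choice. *)

Section Expectation.
Context {dsp : measure_display} {T : measurableType dsp} {R : realType}
        (P : probability T R).
Implicit Types f g : T -> R.

Definition L1 f := P.-integrable setT (EFin \o f).
Definition mean f : R := Rintegral P setT f.

Lemma L1_measurable f : L1 f -> measurable_fun setT f.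
Proof. by move=> /measurable_int/measurable_EFinP. Qed.

Lemma L1_cst r : L1 (fun=> r).
Proof. exact: finite_measure_integrable_cst. Qed.

Lemma L1D f g : L1 f -> L1 g -> L1 (fun w => f w + g w).
Proof. by move=> Lf Lg; apply: (integrableD _ Lf Lg). Qed.

Lemma L1Z r f : L1 f -> L1 (fun w => r * f w).
Proof. by move=> Lf; apply: (integrableZl _ r Lf). Qed.

Lemma L1N f : L1 f -> L1 (fun w => - f w).
Proof. by move=> Lf; apply: (integrableN Lf). Qed.

Lemma L1B f g : L1 f -> L1 g -> L1 (fun w => f w - g w).
Proof. by move=> Lf Lg; apply: (L1D Lf (L1N Lg)). Qed.

Lemma L1_sum (I : Type) (s : seq I) (p : pred I) (F : I -> T -> R) :
  (forall i, p i -> L1 (F i)) -> L1 (fun w => \sum_(i <- s | p i) F i w).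
Proof.
move=> LF; elim: s => [|i s IH].
  rewrite (_ : (fun w => _) = fun=> 0); first exact: L1_cst.
  by apply/funext => w; rewrite big_nil.
case pi : (p i); last first.
  rewrite (_ : (fun w => _) = fun w => \sum_(i <- s | p i) F i w)//.
  by apply/funext => w; rewrite big_cons pi.
rewrite (_ : (fun w => _) = fun w => F i w + \sum_(i <- s | p i) F i w).
  by apply: L1D => //; exact: LF.
by apply/funext => w; rewrite big_cons pi.
Qed.

Lemma L1_le g f : measurable_fun setT f -> L1 g ->
  (forall w, `|f w| <= g w) -> L1 f.
Proof.
move=> mf Lg fg; apply: (le_integrable _ _ _ Lg) => //.
  exact/measurable_EFinP.
by move=> w _ /=; rewrite lee_fin (le_trans (fg w))// ler_norm.
Qed.

Lemma L1_norm f : L1 f -> L1 (fun w => `|f w|).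
Proof.
move=> Lf; have := integrable_abse Lf.
by apply: eq_integrable => // w _.
Qed.

Lemma L1_bounded r f : measurable_fun setT f -> (forall w, `|f w| <= r) -> L1 f.
Proof. by move=> mf; apply: L1_le => //; exact: L1_cst. Qed.

Lemma mean_cst r : mean (fun=> r) = r.
Proof. by rewrite /mean Rintegral_cst// [X in fine X](probability_setT P) mulr1. Qed.

Lemma meanD f g : L1 f -> L1 g -> mean (fun w => f w + g w) = mean f + mean g.
Proof. by move=> Lf Lg; exact: RintegralD. Qed.

Lemma meanZ r f : L1 f -> mean (fun w => r * f w) = r * mean f.
Proof. by move=> Lf; exact: RintegralZl. Qed.

Lemma meanN f : L1 f -> mean (fun w => - f w) = - mean f.
Proof.
move=> Lf; rewrite -[RHS]mulN1r -meanZ//.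
by congr mean; apply/funext => w; rewrite mulN1r.
Qed.

Lemma meanB f g : L1 f -> L1 g -> mean (fun w => f w - g w) = mean f - mean g.
Proof. by move=> Lf Lg; exact: RintegralB. Qed.

Lemma mean_sum (I : Type) (s : seq I) (p : pred I) (F : I -> T -> R) :
  (forall i, p i -> L1 (F i)) ->
  mean (fun w => \sum_(i <- s | p i) F i w) = \sum_(i <- s | p i) mean (F i).
Proof.
move=> LF; elim: s => [|i s IH].
  rewrite big_nil -[RHS](mean_cst 0).
  by congr mean; apply/funext => w; rewrite big_nil.
rewrite big_cons; case: ifPn => pi; last first.
  by rewrite -IH; congr mean; apply/funext => w; rewrite big_cons (negbTE pi).
rewrite -IH -meanD; [|exact: LF|exact: L1_sum].
by congr mean; apply/funext => w; rewrite big_cons pi.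
Qed.

Lemma mean_ge0 f : (forall w, 0 <= f w) -> 0 <= mean f.
Proof. by move=> f0; apply: Rintegral_ge0. Qed.

Lemma mean_le f g : L1 f -> L1 g -> (forall w, f w <= g w) -> mean f <= mean g.
Proof.
move=> Lf Lg fg; rewrite -subr_ge0 -meanB//.
by apply: mean_ge0 => w; rewrite subr_ge0.
Qed.

Lemma ler_norm_mean f : L1 f -> `|mean f| <= mean (fun w => `|f w|).
Proof.
move=> Lf; rewrite ler_norml -meanN; last exact: L1_norm.
by rewrite !mean_le//; try exact: L1_norm; try exact/L1N/L1_norm;
  move=> w; have := lexx `|f w|; rewrite ler_norml => /andP[].
Qed.

Definition Pr (A : set T) : R := fine (P A).

Lemma PrE A : measurable A -> P A = (Pr A)%:E.
Proof. by move=> mA; rewrite /Pr fineK// fin_num_measure. Qed.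

Lemma Pr_ge0 A : 0 <= Pr A.
Proof. by rewrite /Pr fine_ge0. Qed.

Lemma Pr_le A B : measurable A -> measurable B -> A `<=` B -> Pr A <= Pr B.
Proof.
by move=> mA mB AB; rewrite -lee_fin -!PrE// le_measure// inE.
Qed.

Lemma PrU A B : measurable A -> measurable B -> Pr (A `|` B) <= Pr A + Pr B.
Proof.
move=> mA mB; rewrite -lee_fin EFinD -!PrE//; last exact: measurableU.
exact: measureU2.
Qed.

Lemma mean_indic A : measurable A -> mean \1_A = Pr A.
Proof.
move=> mA; rewrite /mean /Rintegral integral_indic// setIT.
by rewrite /Pr.
Qed.

Lemma L1_indic A : measurable A -> L1 \1_A.
Proof.
move=> mA; apply: (@L1_bounded 1); first exact: measurable_indic.
by move=> w; rewrite indicE; case: (_ \in _); rewrite ?normr1 ?normr0.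
Qed.

Lemma Pr_le_mean A f : measurable A -> L1 f -> (forall w, 0 <= f w) ->
  (forall w, A w -> 1 <= f w) -> Pr A <= mean f.
Proof.
move=> mA Lf f0 f1; rewrite -mean_indic//; apply: mean_le => //.
  exact: L1_indic.
move=> w; rewrite indicE; case: (boolP (w \in A)) => [/set_mem/f1//|_].
exact: f0.
Qed.

End Expectation.

(** * Product rule for generated sigma-algebras and for means *)

Section Independence.
Context {dsp : measure_display} {T : measurableType dsp} {R : realType}
        (P : probability T R).
Implicit Types G : set (set T).

Lemma g_sigma_sub G : G `<=` measurable -> <<s G >> `<=` measurable.
Proof. by move=> GM; apply: smallest_sub => //; exact: sigma_algebra_measurable. Qed.

(** Dynkin's argument: for fixed [B] the sets [A] obeying the product rule are stable under
    complement, because [P] is finite, and under countable disjoint union. *)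
Lemma indep_g_sigma1 G B : setI_closed G -> G `<=` measurable -> measurable B ->
  (forall A, G A -> P (A `&` B) = (P A * P B)%E) ->
  forall A, <<s G >> A -> P (A `&` B) = (P A * P B)%E.
Proof.
move=> IG GM mB PG; have sGM := g_sigma_sub GM.
apply: (@dynkin_induction _ (g_sigma_algebraType G) G
  (fun A => P (A `&` B) = (P A * P B)%E)) => //.
- by rewrite setTI probability_setT mul1e.
- move=> S /sGM mS PS; have mSB := measurableI _ _ mS mB.
  rewrite setIC -setDE measureD// ?(setIC B) ?PS; last first.
    by rewrite ltey_eq fin_num_measure.
  rewrite probability_setC// muleBl ?fin_num_measure ?mul1e//.
  by congr (_ - _)%E.
- move=> F mF tF PF.
  have mF' n : @measurable _ T (F n) by apply: sGM; exact: mF.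
  have mFB n : @measurable _ T (F n `&` B) by apply: (@measurableI _ T).
  have tFB : trivIset setT (fun n => F n `&` B) by exact: trivIset_setIr.
  have := @measure_bigcup _ _ _ P setT _ (fun n _ => mFB n) tFB.
  rewrite -setI_bigcupl => ->.
  have := @measure_bigcup _ _ _ P setT _ (fun n _ => mF' n) tF.
  move=> ->; rewrite muleC (PrE P mB) -nneseriesZl//.
  by apply: eq_eseriesr => n _; rewrite -PrE// muleC; exact: PF.
Qed.

(** One generator is extended at a time: [G1] against a fixed member of [G2], then [G2] against a
    fixed set of the sigma-algebra of [G1]. *)
Lemma indep_g_sigma (G1 G2 : set (set T)) :
  setI_closed G1 -> setI_closed G2 ->
  G1 `<=` measurable -> G2 `<=` measurable ->
  (forall A B, G1 A -> G2 B -> P (A `&` B) = (P A * P B)%E) ->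
  forall A B, <<s G1 >> A -> <<s G2 >> B -> P (A `&` B) = (P A * P B)%E.
Proof.
move=> I1 I2 M1 M2 G12 A B sA sB.
rewrite setIC muleC; apply: (indep_g_sigma1 I2 M2) sB; first exact: g_sigma_sub sA.
move=> {}B GB; rewrite setIC muleC.
apply: (indep_g_sigma1 I1 M1 _ _) sA; first exact: M2.
by move=> {}A GA; exact: G12.
Qed.

(** The carrier of [g_sigma_algebraType G] is still [T]; only its measurable sets shrink to those
    generated by [G]. *)
Definition sigma_measurable G (f : T -> R) :=
  measurable_fun (setT : set (g_sigma_algebraType G)) f.

Lemma sigma_measurableW G (f : T -> R) : G `<=` measurable -> sigma_measurable G f ->
  measurable_fun (setT : set T) f.
Proof. by move=> GM mf _ B mB; apply: (g_sigma_sub GM); exact: mf. Qed.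

(** Independence makes the law of the pair the product of its marginals, after which Fubini factors
    the integral of the product. *)
Lemma indep_mean G1 G2 (f h : T -> R) :
  G1 `<=` measurable -> G2 `<=` measurable ->
  (forall A B, <<s G1 >> A -> <<s G2 >> B -> P (A `&` B) = (P A * P B)%E) ->
  sigma_measurable G1 f -> sigma_measurable G2 h ->
  L1 P f -> L1 P h ->
  L1 P (fun w => f w * h w) /\ mean P (fun w => f w * h w) = mean P f * mean P h.
Proof.
move=> M1 M2 G12 sf sh Lf Lh.
have mf := sigma_measurableW M1 sf; have mh := sigma_measurableW M2 sh.
pose X : {RV P >-> R} := HB.pack f (isMeasurableFun.Build _ _ _ _ _ mf).
pose Y : {RV P >-> R} := HB.pack h (isMeasurableFun.Build _ _ _ _ _ mh).
have mphi : measurable_fun setT (fun w => (f w, h w)).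
  by apply/measurable_fun_pairP; split.
pose Z : {RV P >-> (R * R)%type} := HB.pack (fun w => (f w, h w))
  (isMeasurableFun.Build _ _ _ _ _ mphi).
pose mu := distribution P X; pose nu := distribution P Y.
pose F (z : R * R) := (z.1 * z.2)%:E : \bar R.
have mF : measurable_fun setT F.
  by apply/measurable_EFinP; apply: measurable_funM.
have muX : mu.-integrable setT (EFin \o (@id R)).
  by apply: integrable_pushforward => //; exact/measurable_EFinP.
have nuY : nu.-integrable setT (EFin \o (@id R)).
  by apply: integrable_pushforward => //; exact/measurable_EFinP.
(* On rectangles this is the product rule; uniqueness of the product measure does the rest. *)
have E A : measurable A -> (mu \x nu)%E A = distribution P Z A.
  apply: product_measure_unique => {}A B mA mB.
  rewrite /mu /nu /= /pushforward.
  rewrite -G12; first exact: erefl.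
    by have := sf measurableT _ mA; rewrite setTI.
  by have := sh measurableT _ mB; rewrite setTI.
(* Tonelli for the absolute value: the iterated integral factors into two finite ones. *)
have iF : (mu \x nu)%E.-integrable setT F.
  apply/integrable12ltyP => //.
  have -> : (\int[mu]_x \int[nu]_y `|F (x, y)|
      = \int[mu]_x ((\int[nu]_y `|y%:E|) * `|x%:E|))%E.
    apply: eq_integral => x _; rewrite muleC -ge0_integralZl//.
      by apply: eq_integral => y _; rewrite -abseM.
    by apply: measurableT_comp.
  rewrite ge0_integralZl//; last 2 first.
    by apply: measurableT_comp.
    exact: integral_ge0.
  move/integrableP: muX => [_ muX]; move/integrableP: nuY => [_ nuY].
  by rewrite lte_mul_pinfty// ?integral_ge0// ge0_fin_numE// integral_ge0.
have iZ : (distribution P Z).-integrable setT F.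
  move/integrableP: iF => [_ iF]; apply/integrableP; split => //.
  by rewrite (eq_measure_integral (mu \x nu)%E) => // A mA _; exact/esym/E.
have LZ : L1 P (fun w => f w * h w).
  move/integrableP: iZ => [_ iZ]; apply/integrableP; split => //.
    by apply/measurable_EFinP; exact: measurable_funM.
  by move: iZ; rewrite ge0_integral_distribution//; exact: measurableT_comp.
split=> //; apply: EFin_inj; rewrite EFinM /mean /Rintegral.
rewrite !fineK; [|exact: integrable_fin_num..].
have -> : (\int[P]_w (f w * h w)%:E = \int[distribution P Z]_z F z)%E.
  by rewrite integral_distribution.
rewrite (eq_measure_integral (mu \x nu)%E); last by move=> A mA _; exact/esym/E.
rewrite -integral12_prod_meas1//.
have fE : (\int[P]_w (f w)%:E = \int[mu]_x x%:E)%E.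
  by rewrite integral_distribution.
have hE : (\int[P]_w (h w)%:E = \int[nu]_x x%:E)%E.
  by rewrite integral_distribution.
rewrite fE hE muleC.
have nufin : (\int[nu]_x x%:E)%E \is a fin_num by exact: integrable_fin_num nuY.
rewrite -(fineK nufin) -integralZl//.
apply: eq_integral => x _; rewrite (fineK nufin) muleC -integralZl//.
Qed.

End Independence.

(** * Laws of random vectors, and independence of past and present *)

Section RandomVectors.
Context {dsp : measure_display} {T : measurableType dsp} {R : realType}
        (P : probability T R) {d : nat}.
Implicit Types (X Y : T -> 'rV[R]_d) (Xs : nat -> T -> 'rV[R]_d).

(** [same_law] and [mutually_independent] speak of boxes only, so the Borel sigma-algebra of R^d is
    taken as the one generated by this pi-system. *)
Definition boxes : set (set 'rV[R]_d) :=
  [set A | exists2 B : 'I_d -> set R, (forall k, measurable (B k)) &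
           A = [set v : 'rV[R]_d | forall k, B k (v ord0 k)]].

Definition borel_fun (h : 'rV[R]_d -> R) :=
  measurable_fun (setT : set (g_sigma_algebraType boxes)) h.

Lemma borel_coord k : borel_fun (fun v => v ord0 k).
Proof.
move=> _ A mA; rewrite setTI; apply: sub_sigma_algebra.
exists (fun j => if j == k then A else setT).
  by move=> j; case: ifP.
apply/seteqP; split => v /=.
  by move=> Av j; case: eqP => [->|].
by move=> /(_ k); rewrite eqxx.
Qed.

Lemma boxes_setI : setI_closed boxes.
Proof.
move=> _ _ [B mB ->] [C mC ->]; exists (fun k => B k `&` C k).
  by move=> k; exact: measurableI.
apply/seteqP; split => v /=; first by move=> [vB vC] k; split; [exact: vB|exact: vC].
by move=> vBC; split=> k; have [] := vBC k.
Qed.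

Lemma box_eventE X (B : 'I_d -> set R) :
  box_event X B = \bigcap_(k in setT) ((fun w => X w ord0 k) @^-1` B k).
Proof.
by apply/seteqP; split => w /= XB k; [move=> _|]; exact: XB.
Qed.

Lemma measurable_box_event X (B : 'I_d -> set R) :
  (forall k, measurable_fun setT (fun w => X w ord0 k)) ->
  (forall k, measurable (B k)) -> measurable (box_event X B).
Proof.
move=> mX mB; rewrite box_eventE; apply: fin_bigcap_measurable => // k _.
by have := mX k measurableT _ (mB k); rewrite setTI.
Qed.

Lemma measurable_vec (G : set (set T)) X :
  (forall B, (forall k, measurable (B k)) -> <<s G >> (box_event X B)) ->
  measurable_fun (setT : set (g_sigma_algebraType G))
    (X : _ -> g_sigma_algebraType boxes).
Proof.
move=> GX; apply: (@measurability _ _ (g_sigma_algebraType G) (g_sigma_algebraType boxes)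
  setT X boxes) => // _ [A [B mB ->] <-].
by rewrite setTI; exact: GX.
Qed.

(** The two image laws agree on the pi-system of boxes, hence coincide; both means are integrals
    against that common law. *)
Lemma same_law_mean X Y (h : 'rV[R]_d -> R) :
  (forall k, measurable_fun setT (fun w => X w ord0 k)) ->
  (forall k, measurable_fun setT (fun w => Y w ord0 k)) ->
  same_law P Y X -> borel_fun h -> L1 P (h \o X) ->
  L1 P (h \o Y) /\ mean P (h \o Y) = mean P (h \o X).
Proof.
move=> mX mY YX mh LX.
have mXv : measurable_fun setT (X : _ -> g_sigma_algebraType boxes).
  apply: (@measurability _ _ T (g_sigma_algebraType boxes) setT X boxes) => // _ [A [B mB ->] <-].
  by rewrite setTI; exact: measurable_box_event.
have mYv : measurable_fun setT (Y : _ -> g_sigma_algebraType boxes).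
  apply: (@measurability _ _ T (g_sigma_algebraType boxes) setT Y boxes) => // _ [A [B mB ->] <-].
  by rewrite setTI; exact: measurable_box_event.
pose X' : {RV P >-> g_sigma_algebraType boxes} :=
  HB.pack X (isMeasurableFun.Build _ _ _ _ _ mXv).
pose Y' : {RV P >-> g_sigma_algebraType boxes} :=
  HB.pack Y (isMeasurableFun.Build _ _ _ _ _ mYv).
have E (A : set (g_sigma_algebraType boxes)) : measurable A ->
    distribution P Y' A = distribution P X' A.
  apply: (@measure_unique _ R (g_sigma_algebraType boxes) boxes (fun=> setT) _ _ _ _
    (distribution P Y') (distribution P X')) => //.
  - exact: boxes_setI.
  - move=> _; exists (fun=> setT) => //; apply/seteqP; split => //.
  - by rewrite bigcup_const//; exists 0%N.
  - by move=> _ [B mB ->]; exact: YX.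
  - move=> _; apply: (@le_lt_trans _ _ 1%E); last exact: ltry.
    exact: (probability_le1 (distribution P Y')) measurableT.
have mhE : measurable_fun setT (EFin \o h : g_sigma_algebraType boxes -> _).
  exact/measurable_EFinP.
have iX : (distribution P X').-integrable setT (EFin \o h).
  exact: integrable_pushforward.
have iY : (distribution P Y').-integrable setT (EFin \o h).
  move/integrableP: iX => [mEh iX]; apply/integrableP; split=> //.
  rewrite (eq_measure_integral (distribution P X')) => // A mA _; exact: E.
have LY : L1 P (h \o Y).
  move/integrableP: iY => [_ iY]; apply/integrableP; split.
    exact: (measurableT_comp mhE mYv).
  by move: iY; rewrite ge0_integral_distribution//; exact: measurableT_comp.
split => //; rewrite /mean /Rintegral; congr fine.
transitivity (\int[distribution P Y']_z (h z)%:E)%E.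
  by rewrite integral_distribution.
transitivity (\int[distribution P X']_z (h z)%:E)%E.
  by apply: eq_measure_integral => A mA _; exact: E.
by rewrite integral_distribution.
Qed.

Variable Xs : nat -> T -> 'rV[R]_d.
Hypothesis mXs : forall i k, measurable_fun setT (fun w => Xs i w ord0 k).
Hypothesis indXs : mutually_independent P Xs.

Definition past m : set (set T) :=
  [set A | exists2 B : 'I_m -> 'I_d -> set R, (forall i k, measurable (B i k)) &
     A = [set w | forall i : 'I_m, box_event (Xs i) (B i) w]].

Definition present m : set (set T) :=
  [set A | exists2 B : 'I_d -> set R, (forall k, measurable (B k)) &
     A = box_event (Xs m) B].

Lemma past_measurable m : past m `<=` measurable.
Proof.
move=> _ [B mB ->].
rewrite [X in measurable X](_ : _ = \bigcap_(i in [set: 'I_m]) box_event (Xs i) (B i)).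
  by apply: fin_bigcap_measurable => // i _; exact: measurable_box_event.
by apply/seteqP; split => w /= XB k; [move=> _|]; exact: XB.
Qed.

Lemma present_measurable m : present m `<=` measurable.
Proof. by move=> _ [B mB ->]; exact: measurable_box_event. Qed.

Lemma past_setI m : setI_closed (past m).
Proof.
move=> _ _ [B mB ->] [C mC ->]; exists (fun i k => B i k `&` C i k).
  by move=> i k; exact: measurableI.
apply/seteqP; split => v /=.
  by move=> [vB vC] i k; split; [exact: vB|exact: vC].
by move=> vBC; split=> i k; have [] := vBC i k.
Qed.

Lemma present_setI m : setI_closed (present m).
Proof.
move=> _ _ [B mB ->] [C mC ->]; exists (fun k => B k `&` C k).
  by move=> k; exact: measurableI.
apply/seteqP; split => v /=; first by move=> [vB vC] k; split; [exact: vB|exact: vC].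
by move=> vBC; split=> k; have [] := vBC k.
Qed.

(** A past box and a present box form one box event of [m.+1] vectors; comparing the product rules
    for [m.+1] and for [m] settles the generators. *)
Lemma past_present_indep m A B : <<s past m >> A -> <<s present m >> B ->
  P (A `&` B) = (P A * P B)%E.
Proof.
apply: indep_g_sigma.
- exact: past_setI.
- exact: present_setI.
- exact: past_measurable.
- exact: present_measurable.
move=> {}A {}B [C mC ->] [D mD ->].
pose F (i : 'I_m.+1) := oapp C D (unlift ord_max i).
have FC (i : 'I_m) : F (widen_ord (leqnSn m) i) = C i.
  rewrite /F (_ : widen_ord _ i = lift ord_max i) ?liftK//.
  by apply: val_inj; rewrite /= /bump leqNgt ltn_ord.
have FD : F ord_max = D by rewrite /F unlift_none.
have mF i k : measurable (F i k) by rewrite /F; case: (unlift ord_max i) => [j|]; [exact: mC|exact: mD].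
rewrite [X in P X](_ : _ = [set w | forall i : 'I_m.+1, box_event (Xs i) (F i) w]).
  rewrite indXs// big_ord_recr/= FD; congr (_ * _)%E.
  rewrite indXs//; apply: eq_bigr => i _.
  by rewrite FC.
apply/seteqP; split => w /=.
  move=> [wC wD] i; case: (unliftP ord_max i) => [j ->|->].
    rewrite /F liftK /= (_ : bump m j = j); first exact: wC.
    by rewrite /bump leqNgt ltn_ord.
  by rewrite FD.
move=> wF; split=> [i|]; last by have := wF ord_max; rewrite FD.
by have := wF (widen_ord (leqnSn m) i); rewrite FC.
Qed.

Lemma present_borel m h : borel_fun h -> sigma_measurable (present m) (h \o Xs m).
Proof.
move=> mh; have mX : measurable_fun (setT : set (g_sigma_algebraType (present m)))
    (Xs m : _ -> g_sigma_algebraType boxes).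
  by apply: measurable_vec => B mB; apply: sub_sigma_algebra; exists B.
exact: (measurableT_comp mh mX).
Qed.

Lemma past_borel m i h : (i < m)%N -> borel_fun h ->
  sigma_measurable (past m) (h \o Xs i).
Proof.
move=> im mh; have mX : measurable_fun (setT : set (g_sigma_algebraType (past m)))
    (Xs i : _ -> g_sigma_algebraType boxes).
  apply: measurable_vec => B mB; apply: sub_sigma_algebra.
  (* Only the [i]-th vector is constrained; the other boxes are the whole space. *)
  exists (fun j => if j == Ordinal im then B else fun=> setT).
    by move=> j l; case: ifP.
  apply/seteqP; split => w /=.
    by move=> Bw j l; case: eqP => // ->; exact: Bw.
  by move=> /(_ (Ordinal im)); rewrite eqxx.
exact: (measurableT_comp mh mX).
Qed.

Lemma mean_past_present m (f : T -> R) h :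
  sigma_measurable (past m) f -> borel_fun h -> L1 P f -> L1 P (h \o Xs m) ->
  L1 P (fun w => f w * h (Xs m w)) /\
  mean P (fun w => f w * h (Xs m w)) = mean P f * mean P (h \o Xs m).
Proof.
move=> sf bh; apply: (indep_mean (G1 := past m) (G2 := present m)) => //.
- exact: past_measurable.
- exact: present_measurable.
- exact: past_present_indep.
- exact: present_borel.
Qed.

End RandomVectors.

Section LimitLemmas.
Context {dsp : measure_display} {T : measurableType dsp} {R : realType}
        (P : probability T R).

Lemma measurable_set_le (f : T -> R) a : measurable_fun setT f ->
  measurable [set w | f w <= a].
Proof.
move=> mf; have := mf measurableT _ (measurable_itv `]-oo, a]).
by rewrite setTI; congr measurable; apply/seteqP; split => w /=; rewrite in_itv.
Qed.

Lemma measurable_set_lt (f : T -> R) a : measurable_fun setT f ->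
  measurable [set w | f w < a].
Proof.
move=> mf; have := mf measurableT _ (measurable_itv `]-oo, a[).
by rewrite setTI; congr measurable; apply/seteqP; split => w /=; rewrite in_itv.
Qed.

Lemma measurable_set_ge (f : T -> R) a : measurable_fun setT f ->
  measurable [set w | a <= f w].
Proof.
move=> mf; have := mf measurableT _ (measurable_itv `[a, +oo[).
by rewrite setTI; congr measurable; apply/seteqP; split => w /=;
  rewrite in_itv/= andbT.
Qed.

Lemma measurable_set_gt (f : T -> R) a : measurable_fun setT f ->
  measurable [set w | a < f w].
Proof.
move=> mf; have := mf measurableT _ (measurable_itv `]a, +oo[).
by rewrite setTI; congr measurable; apply/seteqP; split => w /=;
  rewrite in_itv/= andbT.
Qed.

Lemma mean_cvg0 (F : nat -> T -> R) g :
  (forall n, measurable_fun setT (F n)) -> L1 P g ->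
  (forall n w, `|F n w| <= g w) -> (forall w, F n w @[n --> \oo] --> 0) ->
  mean P (F n) @[n --> \oo] --> 0.
Proof.
move=> mF Lg Fg F0.
have [] := @dominated_convergence _ _ _ P setT measurableT
  (fun n => EFin \o F n) (fun=> 0%E) (EFin \o g).
- by move=> n; exact/measurable_EFinP.
- exact: measurable_cst.
- by apply: aeW => w _; apply: cvg_EFin; [exact: nearW|exact: F0].
- exact: Lg.
- by apply: aeW => w n _ /=; rewrite lee_fin.
move=> _ _; rewrite integral0 => /fine_cvg.
by apply: cvg_trans; apply: near_eq_cvg; apply: nearW.
Qed.

Lemma mean_cvg0_le (F : nat -> T -> R) g :
  (forall n, measurable_fun setT (F n)) -> L1 P g ->
  (forall n w, `|F n w| <= g w) -> (forall w, F n w @[n --> \oo] --> 0) ->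
  forall e : R, 0 < e -> \forall n \near \oo, mean P (F n) <= e.
Proof.
move=> mF Lg Fg F0 e e0; have /cvgrPdist_le/(_ _ e0) := mean_cvg0 mF Lg Fg F0.
apply: filterS => n; rewrite sub0r normrN; exact: le_trans (ler_norm _).
Qed.

Lemma Pr_markov f a : L1 P f -> (forall w, 0 <= f w) -> 0 < a ->
  Pr P [set w | a <= f w] <= mean P f / a.
Proof.
move=> Lf f0 a0; rewrite mulrC -meanZ//; apply: Pr_le_mean.
- exact: measurable_set_ge (L1_measurable Lf).
- exact: L1Z.
- by move=> w; rewrite mulr_ge0// invr_ge0 ltW.
- by move=> w /= aw; rewrite ler_pdivlMl// mulr1.
Qed.

End LimitLemmas.

(** * Weak law in mean, and negligibility of the maximum *)

Section LawOfLargeNumbers.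
Context {dsp : measure_display} {T : measurableType dsp} {R : realType}
        (P : probability T R) {d : nat}.
Variables (X : T -> 'rV[R]_d) (Xs : nat -> T -> 'rV[R]_d).
Hypothesis mX : forall k, measurable_fun setT (fun w => X w ord0 k).
Hypothesis mXs : forall i k, measurable_fun setT (fun w => Xs i w ord0 k).
Hypothesis indXs : mutually_independent P Xs.
Hypothesis lawXs : forall i, same_law P (Xs i) X.
Implicit Types h : 'rV[R]_d -> R.

Lemma L1_law h i : borel_fun h -> L1 P (h \o X) -> L1 P (h \o Xs i).
Proof. by move=> bh Lh; have [] := same_law_mean mX (mXs i) (lawXs i) bh Lh. Qed.

Lemma mean_law h i : borel_fun h -> L1 P (h \o X) ->
  mean P (h \o Xs i) = mean P (h \o X).
Proof. by move=> bh Lh; have [] := same_law_mean mX (mXs i) (lawXs i) bh Lh. Qed.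

Lemma borel_comp (Y : T -> 'rV[R]_d) h : (forall k, measurable_fun setT (fun w => Y w ord0 k)) ->
  borel_fun h -> measurable_fun (setT : set T) (h \o Y).
Proof.
move=> mY bh.
have mYv : measurable_fun setT (Y : _ -> g_sigma_algebraType (@boxes R d)).
  apply: (@measurability _ _ T (g_sigma_algebraType boxes) setT Y boxes)
    => // _ [A [B mB ->] <-].
  by rewrite setTI; exact: measurable_box_event.
exact: (measurableT_comp bh mYv).
Qed.

(** Cross terms vanish because the last summand is centred and independent of the past, so the
    second moment grows only linearly. *)
Lemma mean_sum_sqr_le h K n : borel_fun h -> (forall v, `|h v| <= K) ->
  mean P (h \o X) = 0 ->
  mean P (fun w => (\sum_(i < n) h (Xs i w)) ^+ 2) <= n%:R * K ^+ 2.
Proof.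
move=> bh hK h0.
have K0 : 0 <= K by exact: le_trans (hK 0).
have LhX : L1 P (h \o X) by exact: (L1_bounded _ (borel_comp mX bh) (fun w => hK (X w))).
pose S m w := \sum_(i < m) h (Xs i w).
have SK m w : `|S m w| <= m%:R * K.
  apply: le_trans (ler_norm_sum _ _ _) _.
  by rewrite mulr_natl -[X in _ *+ X](card_ord m) -sumr_const ler_sum.
have mS m : sigma_measurable (past Xs m) (S m).
  by apply: measurable_sum => i; apply: past_borel.
have mS' m : measurable_fun setT (S m).
  exact: (sigma_measurableW (past_measurable mXs (m:=m)) (mS m)).
have LS m : L1 P (S m) by exact: L1_bounded (SK m).
have LS2 m : L1 P (fun w => S m w ^+ 2).
  apply: (@L1_bounded _ _ _ P ((m%:R * K) ^+ 2)); first exact: measurable_funX.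
  by move=> w; rewrite normrX lerXn2r// ?nnegrE ?mulr_ge0.
elim: n => [|n IH].
  rewrite mul0r (_ : (fun w => _) = fun=> 0) ?mean_cst//.
  by apply/funext => w; rewrite big_ord0 expr0n.
have Lh2 : L1 P (fun w => h (Xs n w) ^+ 2).
  apply: (@L1_bounded _ _ _ P (K ^+ 2)).
    by apply: measurable_funX; exact: borel_comp.
  by move=> w; rewrite normrX lerXn2r// nnegrE.
have [LSh ESh] := mean_past_present mXs indXs (mS n) bh (LS n) (L1_law n bh LhX).
rewrite mean_law// h0 mulr0 in ESh.
rewrite (_ : (fun w => _) = fun w => (S n w ^+ 2 + 2 * (S n w * h (Xs n w)))
    + h (Xs n w) ^+ 2).
  have L2 := L1Z 2 LSh; have L3 := L1D (LS2 n) L2.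
  rewrite (meanD L3 Lh2) (meanD (LS2 n) L2) (meanZ 2 LSh) ESh mulr0 addr0.
  rewrite -natr1 mulrDl mul1r lerD//.
  rewrite -[leRHS](mean_cst P); apply: mean_le => //; first exact: L1_cst.
  by move=> w; rewrite -[leLHS]ger0_norm ?sqr_ge0// normrX lerXn2r// nnegrE.
by apply/funext => w; rewrite big_ord_recr/= -/(S n w); ring.
Qed.

(** The law is applied to products of two coordinates, which need not have a variance. Truncation at
    level [M] leaves a bounded centred part with second moment of order [n], and a tail of small
    mean. *)
Theorem weak_law h : borel_fun h -> L1 P (h \o X) -> forall e : R, 0 < e ->
  \forall n \near \oo,
    mean P (fun w => `|n%:R^-1 * \sum_(i < n) h (Xs i w) - mean P (h \o X)|) <= e.
Proof.
move=> bh Lh e e0.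
pose hM (M : nat) v := if `|h v| <= M%:R then h v else 0.
have hME M v : hM M v = h v * \1_[set u | `|h u| <= M%:R] v.
  rewrite indicE /hM; case: ifPn => hv; first by rewrite mem_set//= mulr1.
  by rewrite memNset/= ?mulr0//; exact/negP.
have bhM M : borel_fun (hM M).
  rewrite /borel_fun (_ : hM M = fun v => h v * \1_[set u | `|h u| <= M%:R] v).
    apply: measurable_funM => //; apply: measurable_indic.
    apply: (@measurable_set_le _ (g_sigma_algebraType boxes)).
    by apply: (measurableT_comp _ bh).
  exact/funext.
have hMK M v : `|hM M v| <= M%:R by rewrite /hM; case: ifP; rewrite // normr0.
have LhM M : L1 P (hM M \o X).
  by exact: (L1_bounded _ (borel_comp mX (bhM M)) (fun w => hMK M (X w))).
pose tM M v : R := `|h v - hM M v|.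
have btM M : borel_fun (tM M).
  by exact: (measurableT_comp (@normr_measurable R setT) (measurable_funB bh (bhM M))).
have tMh M v : tM M v <= `|h v|.
  by rewrite /tM /hM; case: ifP; rewrite ?subrr ?normr0// subr0.
have tM0 v : tM M v @[M --> \oo] --> 0.
  apply: cvg_near_cst; near=> M; rewrite /tM /hM ifT ?subrr ?normr0//.
  by near: M; exact: nbhs_infty_ger.
have LtM M : L1 P (tM M \o X).
  by exact: (L1_norm (L1B Lh (LhM M))).
have e40 : 0 < e / 4 by lra.
have : \forall M \near \oo, mean P (tM M \o X) <= e / 4.
  apply: (@mean_cvg0_le _ _ _ _ _ (fun w => `|h (X w)|)) => //.
  - by move=> M; exact: borel_comp.
  - exact: L1_norm.
  - move=> M w; rewrite ger0_norm; [exact: tMh|exact: normr_ge0].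
  - by move=> w; exact: tM0.
move=> [M _ /(_ M (leqnn M)) tMe].
pose mM := mean P (hM M \o X); pose K := M%:R + `|mM|.
pose g v := hM M v - mM.
have bg : borel_fun g by exact: (measurable_funB (bhM M) (@measurable_cst _ _ _ _ setT mM)).
have gK v : `|g v| <= K.
  by rewrite /g (le_trans (ler_normB _ _))// lerD.
have Lg : L1 P (g \o X) by exact: L1B (LhM M) (L1_cst _ _).
have g0 : mean P (g \o X) = 0.
  by rewrite (meanB (LhM M) (L1_cst P mM)) mean_cst subrr.
near=> n.
have n0 : 0 < n%:R :> R by rewrite ltr0n; near: n; exact: nbhs_infty_gt.
pose S w := \sum_(i < n) g (Xs i w).
have mS : measurable_fun setT S.
  by apply: measurable_sum => i; exact: borel_comp.
have LS : L1 P S by apply: L1_sum => i _; exact: L1_law.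
have LS2 : L1 P (fun w => S w ^+ 2).
  apply: (@L1_bounded _ _ _ P ((n%:R * K) ^+ 2)); first exact: measurable_funX.
  move=> w; rewrite normrX lerXn2r// ?nnegrE.
    by rewrite mulr_ge0// addr_ge0.
  apply: le_trans (ler_norm_sum _ _ _) _.
  by rewrite mulr_natl -[X in _ *+ X](card_ord n) -sumr_const ler_sum.
have ES2 : mean P (fun w => S w ^+ 2) <= n%:R * K ^+ 2 by exact: mean_sum_sqr_le.
pose U w := \sum_(i < n) tM M (Xs i w).
have LU : L1 P U by apply: L1_sum => i _; exact: L1_law.
have EU : mean P U <= n%:R * (e / 4).
  rewrite /U mean_sum => [|i _]; last exact: L1_law.
  rewrite mulr_natl -[X in _ *+ X](card_ord n) -sumr_const ler_sum// => i _.
  by rewrite (mean_law i (btM M)).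
have mMe : `|mM - mean P (h \o X)| <= e / 4.
  rewrite -(meanB (LhM M) Lh).
  apply: le_trans (ler_norm_mean (L1B (LhM M) Lh)) _.
  rewrite (_ : (fun w => _) = tM M \o X)//.
  by apply/funext => w; rewrite /= distrC.
(* AM-GM: [`|s| <= e / 4 + s ^+ 2 / e]. *)
pose B w := e / 4 + e^-1 * (n%:R^-1 ^+ 2 * S w ^+ 2) + n%:R^-1 * U w + e / 4.
have LB : L1 P B.
  apply: L1D; last exact: L1_cst.
  by do ?[apply: L1D|apply: L1Z]; rewrite //; exact: L1_cst.
apply: (@le_trans _ _ (mean P B)).
  apply: mean_le => //.
    apply/L1_norm/L1B; last exact: L1_cst.
    by apply/L1Z/L1_sum => i _; exact: L1_law.
  move=> w; rewrite /B.
  have -> : n%:R^-1 * \sum_(i < n) h (Xs i w) - mean P (h \o X) =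
      n%:R^-1 * S w + n%:R^-1 * (\sum_(i < n) (h (Xs i w) - hM M (Xs i w)))
      + (mM - mean P (h \o X)).
    rewrite /S /g !sumrB sumr_const card_ord -mulr_natl.
    by field; exact: lt0r_neq0.
  apply: le_trans (ler_normD _ _) _; apply: lerD => //.
  apply: le_trans (ler_normD _ _) _; apply: lerD.
    rewrite -exprMn; set s := _ * S w.
    have : 0 <= (`|s| - e / 2) ^+ 2 by exact: sqr_ge0.
    rewrite sqrrB real_normK ?num_real// => /(ler_wpM2l (ltW (etrans (invr_gt0 e) e0))).
    rewrite mulr0 => ss; rewrite -subr_ge0; apply: le_trans ss _.
    by rewrite le_eqVlt; apply/orP; left; apply/eqP; field; exact: lt0r_neq0.
  rewrite normrM ger0_norm ?invr_ge0// ler_wpM2l ?invr_ge0//.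
  exact: ler_norm_sum.
have L1a := L1_cst P (e / 4); have L1b := L1Z e^-1 (L1Z (n%:R^-1 ^+ 2) LS2).
have L1c := L1Z n%:R^-1 LU.
rewrite /B (meanD (L1D (L1D L1a L1b) L1c) L1a) (meanD (L1D L1a L1b) L1c).
rewrite (meanD L1a L1b) (meanZ _ (L1Z _ LS2)) (meanZ _ LS2) (meanZ _ LU) mean_cst.
(* Makes the variance term, of size [K ^+ 2 / (e n)], at most [e / 4]; the AM-GM constant, the tail
   and the bias account for the other three quarters. *)
have nK : K ^+ 2 <= n%:R * (e ^+ 2 / 4).
  rewrite -ler_pdivrMr; last by rewrite divr_gt0// exprn_gt0.
  by near: n; exact: nbhs_infty_ger.
have s1 : n%:R^-1 * mean P U <= e / 4 by rewrite ler_pdivrMl.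
have s2 : e^-1 * (n%:R^-1 ^+ 2 * mean P (fun w => S w ^+ 2)) <= e / 4.
  rewrite ler_pdivrMl// exprVn ler_pdivrMl ?exprn_gt0//.
  apply: le_trans ES2 _; rewrite -subr_ge0.
  apply: le_trans (_ : 0 <= n%:R * (n%:R * (e ^+ 2 / 4) - K ^+ 2)) _.
    by rewrite mulr_ge0 ?subr_ge0.
  by rewrite le_eqVlt; apply/orP; left; apply/eqP; field.
lra.
Unshelve. all: by end_near.
Qed.

(* [q (Xs i w) / (e n)] is at least 1 as soon as it is counted, so the sum of
   the truncated values dominates the indicator of the event. *)
Lemma max_negligible q : borel_fun q -> (forall v, 0 <= q v) ->
  L1 P (q \o X) -> forall e : R, 0 < e -> forall delta : R, 0 < delta ->
  \forall n \near \oo,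
    Pr P [set w | exists i : 'I_n, e * n%:R < q (Xs i w)] <= delta.
Proof.
move=> bq q0 Lq e e0 delta delta0.
pose F (n : nat) v : R := if e * n%:R < q v then q v else 0.
have FE n v : F n v = q v * \1_[set u | e * n%:R < q u] v.
  rewrite indicE /F; case: ifPn => hv; first by rewrite mem_set//= mulr1.
  by rewrite memNset/= ?mulr0//; exact/negP.
have bF n : borel_fun (F n).
  rewrite /borel_fun (_ : F n = fun v => q v * \1_[set u | e * n%:R < q u] v).
    apply: measurable_funM => //; apply: measurable_indic.
    exact: (@measurable_set_gt _ (g_sigma_algebraType boxes)).
  exact/funext.
have F0 n v : 0 <= F n v by rewrite /F; case: ifP.
have Fq n v : F n v <= q v by rewrite /F; case: ifP.
have LF n : L1 P (F n \o X).
  by apply: (L1_le (borel_comp mX (bF n)) Lq) => w; rewrite /= ger0_norm.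
have F_cvg v : F n v @[n --> \oo] --> 0.
  apply: cvg_near_cst; near=> n; rewrite /F ifF//; apply/negbTE; rewrite -leNgt.
  by rewrite -ler_pdivrMl//; near: n; exact: nbhs_infty_ger.
have small : \forall n \near \oo, mean P (F n \o X) <= e * delta.
  apply: (@mean_cvg0_le _ _ _ _ _ (q \o X)) => //.
  - by move=> n; exact: borel_comp.
  - by move=> n w; rewrite ger0_norm; [exact: Fq|exact: F0].
  - by move=> w; exact: F_cvg.
  - exact: mulr_gt0.
near=> n.
have n0 : 0 < n%:R :> R by rewrite ltr0n; near: n; exact: nbhs_infty_gt.
have mA (i : 'I_n) : measurable [set w | e * n%:R < q (Xs i w)].
  by apply: measurable_set_gt; exact: borel_comp.
rewrite (_ : [set w | _] = \bigcup_(i in [set: 'I_n]) [set w | e * n%:R < q (Xs i w)]);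
  last first.
  by apply/seteqP; split => w /= [i]; [move=> qi; exists i|move=> _ qi; exists i].
have LS : L1 P (fun w => \sum_(i < n) F n (Xs i w)).
  by apply: L1_sum => i _; exact: L1_law.
apply: (@le_trans _ _ (mean P (fun w => (e * n%:R)^-1 * \sum_(i < n) F n (Xs i w)))).
  apply: Pr_le_mean.
  - exact: fin_bigcup_measurable.
  - exact: L1Z.
  - by move=> w; rewrite mulr_ge0 ?invr_ge0 ?mulr_ge0 ?sumr_ge0 1?ltW.
  - move=> w [i _ /= qi]; rewrite ler_pdivlMl ?mulr_gt0// mulr1 (bigD1 i)//=.
    rewrite {1}/F qi (le_trans (ltW qi))// lerDl sumr_ge0//.
rewrite meanZ// mean_sum => [|i _]; last exact: L1_law.
under eq_bigr do rewrite (mean_law _ (bF n))//.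
rewrite sumr_const card_ord ler_pdivrMl ?mulr_gt0//.
rewrite [leRHS](_ : _ = n%:R * (e * delta)); last by ring.
by rewrite -[leLHS]mulr_natl; apply: ler_wpM2l => //; near: n.
Unshelve. all: by end_near.
Qed.

End LawOfLargeNumbers.

(** * Laplace transform of the quadratic form *)

Section ExponentialBounds.
Variable R : realType.
Implicit Types y q h b a A : R.

(** Both bounds come from [1 + y <= exp y], applied at [y] and at [- y]. *)
Lemma expR_sub_bound1 y : 0 <= expR y - 1 - y <= y ^+ 2 * expR `|y|.
Proof.
have e1 : 1 + y <= expR y := expR_ge1Dx y.
have e2 : expR y - 1 <= y * expR y.
  have := expR_ge1Dx (- y); rewrite expRN => /(ler_wpM2r (expR_ge0 y)).
  by rewrite mulVf ?gt_eqF ?expR_gt0//; lra.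
apply/andP; split; first lra.
have [y0|y0] := leP 0 y.
  apply: (@le_trans _ _ (y * (expR y - 1))); first lra.
  by rewrite expr2 -mulrA ger0_norm// ler_wpM2l.
have yge1 : 1 <= expR (- y) by rewrite -expR0 ler_expR; lra.
apply: (@le_trans _ _ (y ^+ 2)); first by have := ler_wnM2l (ltW y0) e1; nra.
by rewrite ltr0_norm// ler_peMr ?sqr_ge0.
Qed.

(** The remainder vanishes at 0 and its derivative is the remainder of order one, so the mean value
    theorem gains one factor [|y|]. *)
Lemma expR_sub_bound2 y :
  `|expR y - 1 - y - y ^+ 2 / 2| <= `|y| ^+ 3 * expR `|y|.
Proof.
pose g (x : R) : R := expR x - 1 - x - x ^+ 2 / 2.
have gE : g = expR - cst 1 - id - 2^-1 *: (id ^+ 2).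
  apply/funext => x; rewrite /g.
  by rewrite !fctE /GRing.scale /= [X in _ = _ - X]mulrC.
have dg (x : R) : is_derive x 1 g (expR x - 1 - x).
  rewrite gE; apply: is_derive_eq.
  by rewrite /GRing.scale /=; field.
have g0 : g 0 = 0 by rewrite /g expR0 expr0n /= mul0r !subr0 subrr.
have bnd x : `|x| <= `|y| -> `|expR x - 1 - x| <= `|y| ^+ 2 * expR `|y|.
  move=> xy; have /andP[e0 e1] := expR_sub_bound1 x.
  rewrite ger0_norm//; apply: le_trans e1 _.
  by rewrite -(real_normK (num_real x)) ler_pM ?exprn_ge0 ?expR_ge0
    ?ler_expR ?lerXn2r ?nnegrE.
have cg : continuous g.
  move=> x; apply: differentiable_continuous; apply/derivable1_diffP.
  by have [] := dg x.
have [y0|y0] := leP 0 y.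
  have [c] := MVT_segment y0 (fun x _ => dg x) (@continuous_subspaceT _ _ _ g cg).
  rewrite in_itv/= => /andP[c0 cy].
  rewrite g0 !subr0 -/(g y) => ->; rewrite normrM [leLHS]mulrC.
  rewrite exprS -mulrA ler_wpM2l// bnd//.
  by rewrite !ger0_norm.
have [c] := MVT_segment (ltW y0) (fun x _ => dg x) (@continuous_subspaceT _ _ _ g cg).
rewrite in_itv/= => /andP[c0 cy].
rewrite g0 !sub0r => /eqP; rewrite eqr_oppLR -mulrN opprK -/(g y) => /eqP ->.
rewrite normrM [leLHS]mulrC.
rewrite exprS -mulrA ler_wpM2l// bnd//.
by rewrite !ler0_norm ?lerN2// ltW.
Qed.

(* Completing the square: [4 A + 2 - A ^+ 2 <= 6]. *)
Lemma gauss_cube_bound A : 0 <= A ->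
  expR (- A ^+ 2) * ((2 * A + 1) ^+ 3 * expR (2 * A + 1)) <= 6 * expR 6.
Proof.
move=> A0; have A1 : 0 <= 2 * A + 1 by lra.
have c3 : (2 * A + 1) ^+ 3 <= 6 * expR (2 * A + 1).
  have := expR_ge1Dxn 2 A1; rewrite (_ : 3`!%:R = 6)//.
  by set z := _ ^+ 3; lra.
apply: (@le_trans _ _ (expR (- A ^+ 2) * (6 * expR (2 * A + 1) * expR (2 * A + 1)))).
  by rewrite ler_wpM2l ?expR_ge0// ler_wpM2r ?expR_ge0.
have -> : expR (- A ^+ 2) * (6 * expR (2 * A + 1) * expR (2 * A + 1)) =
    6 * (expR (- A ^+ 2) * expR (2 * A + 1) * expR (2 * A + 1)) by ring.
rewrite ler_wpM2l// -!expRD ler_expR.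
by have := sqr_ge0 (A - 2); rewrite sqrrB; lra.
Qed.

Lemma gauss_poly_bound q : 0 <= q -> expR (- q) * (1 + q) <= 1.
Proof.
move=> q0; rewrite expRN mulrC ler_pdivrMr ?expR_gt0// mul1r.
exact: expR_ge1Dx.
Qed.

(** Used with [q = a Q(s)], [h = a Q(z)] and [b] the cross term of [s + z], the condition on [b]
    being Cauchy-Schwarz. For [h <= 1] the error is of third order in [sqrt h]; for [h > 1] both
    terms are bounded crudely by a multiple of [h]. The factor [exp(-q)] absorbs every power of
    [q]. *)
Lemma gauss_second_order : exists2 C : R, 0 < C & forall q h b,
  0 <= q -> 0 <= h -> b ^+ 2 <= q * h ->
  `|expR (- (q + 2 * b + h)) - expR (- q) * (1 - 2 * b - h + 2 * b ^+ 2)| <=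
  C * (h * Num.min 1 (Num.sqrt h)).
Proof.
exists (6 * expR 6 + 4) => [|q h b q0 h0 bqh].
  by have := expR_gt0 (6 : R); lra.
have E6 : 0 <= 6 * expR 6 :> R by rewrite mulr_ge0// expR_ge0.
pose A := Num.sqrt q; pose e := Num.sqrt h.
have A0 : 0 <= A by exact: sqrtr_ge0.
have e0 : 0 <= e by exact: sqrtr_ge0.
have qA : q = A ^+ 2 by rewrite sqr_sqrtr.
have he : h = e ^+ 2 by rewrite sqr_sqrtr.
have bA : `|b| <= A * e.
  rewrite -(@ler_pXn2r _ 2)// ?nnegrE ?mulr_ge0// real_normK ?num_real//.
  by rewrite exprMn -qA -he.
have pA : expR (- q) * (1 + A ^+ 2) <= 1 by rewrite -qA gauss_poly_bound.
have Eq0 : 0 < expR (- q) by exact: expR_gt0.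
have [h1|h1] := leP h 1.
  have e1 : e <= 1 by rewrite -(@ler_pXn2r _ 2)// ?nnegrE// -he expr1n.
  rewrite -/e (min_idPr e1).
  pose y := - (2 * b + h).
  have yb : `|y| <= e * (2 * A + 1).
    rewrite normrN (le_trans (ler_normD _ _))// normrM ger0_norm//.
    rewrite (ger0_norm h0) he; nra.
  have y2 : `|y| <= 2 * A + 1 by apply: le_trans yb _; nra.
  (* Half of [y ^+ 2] is [2 * b ^+ 2] plus the terms [2 * b * h + h ^+ 2 / 2], which are of higher
     order. *)
  have -> : expR (- (q + 2 * b + h)) - expR (- q) * (1 - 2 * b - h + 2 * b ^+ 2)
     = expR (- q) * ((expR y - 1 - y - y ^+ 2 / 2) + (2 * b * h + h ^+ 2 / 2)).
    rewrite (_ : - (q + 2 * b + h) = - q + y) ?expRD; last by rewrite /y; ring.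
    by rewrite /y; field.
  rewrite normrM (gtr0_norm Eq0).
  apply: (@le_trans _ _ (expR (- q) * (e ^+ 3 * ((2 * A + 1) ^+ 3 * expR (2 * A + 1)))
     + expR (- q) * (e ^+ 3 * (2 * (1 + A ^+ 2))))).
    rewrite -mulrDr ler_wpM2l// ?expR_ge0// (le_trans (ler_normD _ _))// lerD//.
      apply: le_trans (expR_sub_bound2 y) _; rewrite mulrA -exprMn.
      by rewrite ler_pM ?exprn_ge0 ?expR_ge0 ?ler_expR// lerXn2r// nnegrE
        ?mulr_ge0//; lra.
    apply: le_trans (ler_normD _ _) _.
    have -> : `|2 * b * h| = 2 * `|b| * h.
      by rewrite normrM (ger0_norm h0) normrM (ger0_norm (ler0n _ 2)).
    rewrite [X in _ + X]ger0_norm; last by rewrite divr_ge0// sqr_ge0.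
    have -> : e ^+ 3 * (2 * (1 + A ^+ 2)) = e * h * (2 * (1 + A ^+ 2)).
      by rewrite he; ring.
    have hle : h <= e by rewrite he; nra.
    have h2 : h ^+ 2 <= e * h by rewrite expr2 ler_wpM2r.
    have bh : `|b| * h <= A * e * h by rewrite ler_wpM2r.
    have eh : 0 <= e * h by rewrite mulr_ge0.
    have := mulr_ge0 eh (sqr_ge0 (A - 1)); rewrite sqrrB.
    nra.
  have t1 : expR (- q) * (e ^+ 3 * ((2 * A + 1) ^+ 3 * expR (2 * A + 1)))
      <= e ^+ 3 * (6 * expR 6).
    by rewrite mulrCA ler_wpM2l ?exprn_ge0// qA gauss_cube_bound.
  have t2 : expR (- q) * (e ^+ 3 * (2 * (1 + A ^+ 2))) <= e ^+ 3 * 4.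
    rewrite mulrCA ler_wpM2l ?exprn_ge0//; lra.
  apply: le_trans (lerD t1 t2) _; rewrite -mulrDr mulrC he.
  by rewrite (_ : e ^+ 2 * e = e ^+ 3)//; ring.
have e1 : 1 <= e by rewrite -(@ler_pXn2r _ 2)// ?nnegrE// -he expr1n ltW.
rewrite -/e (min_idPl e1) mulr1.
(* The exponent is nonpositive since [q + 2 b + h >= (A - e) ^+ 2]. *)
have u1 : 0 <= expR (- (q + 2 * b + h)) <= 1.
  rewrite expR_ge0 expR_le1 oppr_le0 qA he.
  by have := sqr_ge0 (A - e); move: bA; rewrite ler_norml => /andP[? ?]; nra.
apply: le_trans (ler_normB _ _) _; rewrite normrM (gtr0_norm Eq0).
have u2 : expR (- q) * `|1 - 2 * b - h + 2 * b ^+ 2| <= expR (- q) * (h * (3 * (1 + A ^+ 2))).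
  rewrite ler_wpM2l ?expR_ge0//.
  apply: (@le_trans _ _ (1 + 2 * `|b| + h + 2 * (q * h))).
    have := sqr_ge0 b; have := ler_norm b; have := ler_norm (- b); rewrite normrN ler_norml.
    by move=> ? ? ?; apply/andP; split; lra.
  have ehh : e <= h by rewrite he; nra.
  rewrite qA; have : A * e <= A * h by rewrite ler_wpM2l.
  have := mulr_ge0 h0 (sqr_ge0 (A - 1)); rewrite sqrrB; nra.
have u3 : expR (- q) * (h * (3 * (1 + A ^+ 2))) <= 3 * h.
  have -> : expR (- q) * (h * (3 * (1 + A ^+ 2))) = 3 * h * (expR (- q) * (1 + A ^+ 2)).
    by ring.
  by rewrite -[leRHS]mulr1 ler_wpM2l ?mulr_ge0.
rewrite (ger0_norm (expR_ge0 _)).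
have E6h := mulr_ge0 E6 h0; case/andP: u1 => _ u1; lra.
Qed.

Lemma ln1D_bounds a : 0 <= a -> a - a ^+ 2 <= ln (1 + a) <= a.
Proof.
move=> a0; rewrite le_ln1Dx ?andbT; last by lra.
have a1 : 0 < 1 + a by lra.
have : ln ((1 + a)^-1) <= (1 + a)^-1 - 1.
  have := @le_ln1Dx _ ((1 + a)^-1 - 1).
  rewrite (_ : 1 + ((1 + a)^-1 - 1) = (1 + a)^-1); last by ring.
  by apply; rewrite ltrBrDl subrr invr_gt0.
rewrite lnV ?posrE// => e1.
have : (1 + a)^-1 <= 1 - a + a ^+ 2.
  rewrite -[leLHS]mul1r ler_pdivrMr//; have := exprn_ge0 3 a0; rewrite !exprS expr0; nra.
lra.
Qed.

(** With [q = a |s|^2] the first term is the mean of [exp(-a |s + g|^2)] for a standard Gaussian [g]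
    in dimension [k]. Its expansion in [a] has the same main term as the mean of the expansion in
    [gauss_second_order], where [h] averages to [a k] and [b ^+ 2] to [a q]. *)
Lemma heat_second_order (k : nat) : exists2 C : R, 0 < C & forall q a,
  0 <= q -> 0 < a <= 1 ->
  `|(1 + 2 * a) `^ (- (k%:R / 2)) * expR (- (q / (1 + 2 * a)))
    - expR (- q) * (1 - a * k%:R + 2 * a * q)| <= C * a ^+ 2.
Proof.
pose D : R := k%:R.
have D0 : 0 <= D by exact: ler0n.
exists (72 * (expR D * expR (D / 6)) + (2 * D + 4)) => [|q a q0 /andP[a0 a1]].
  by rewrite ltr_wpDl ?mulr_ge0 ?expR_ge0//; lra.
have a20 : 0 < 1 + 2 * a by lra.
pose t := (1 + 2 * a)^-1; have t0 : 0 < t by rewrite invr_gt0.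
have tE : t + 2 * a * t = 1 by rewrite /t; field; exact: lt0r_neq0.
pose l := ln (1 + 2 * a).
have /andP[l1 l2] : 2 * a - (2 * a) ^+ 2 <= l <= 2 * a by apply: ln1D_bounds; lra.
have l0 : 0 <= l by rewrite ln_ge0//; lra.
pose y := - (D / 2 * l) + q * (2 * a * t).
have -> : (1 + 2 * a) `^ (- (k%:R / 2)) * expR (- (q / (1 + 2 * a))) = expR (- q) * expR y.
  rewrite /powR gt_eqF// -!expRD -/l -/D -/t; congr expR.
  rewrite /y; have -> : 2 * a * t = 1 - t by lra.
  by ring.
rewrite -mulrBr normrM gtr0_norm ?expR_gt0//.
(* The growth of [exp y] is thus at most [exp(2 q / 3)] up to a constant, which leaves [exp(-q / 3)]
   to absorb the quadratic factor. *)
have at1 : 2 * a * t <= 2 / 3.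
  have -> : 2 * a * t = 2 * a / (1 + 2 * a) by [].
  rewrite ler_pdivrMr//; lra.
have t1 : t <= 1 by have := mulr_ge0 (ltW a0) (ltW t0); lra.
have yb : `|y| <= a * (D + 2 * q).
  rewrite ler_norml; apply/andP; split.
    have := mulr_ge0 D0 (ltW a0); have : D * l <= D * (2 * a) by rewrite ler_wpM2l.
    by have := mulr_ge0 q0 (mulr_ge0 (ltW a0) (ltW t0)); have := mulr_ge0 q0 (ltW a0); rewrite /y; nra.
  have : q * (2 * a * t) <= q * (2 * a).
    by rewrite ler_wpM2l// ler_piMr//; lra.
  by have := mulr_ge0 D0 l0; have := mulr_ge0 D0 (ltW a0); rewrite /y; lra.
have yb2 : `|y| <= D + q * (2 / 3).
  rewrite ler_norml; apply/andP; split.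
    have : D * l <= D * 2 by rewrite ler_wpM2l//; lra.
    by have := mulr_ge0 q0 (mulr_ge0 (ltW a0) (ltW t0)); rewrite /y; nra.
  have : q * (2 * a * t) <= q * (2 / 3) by rewrite ler_wpM2l.
  by have := mulr_ge0 D0 l0; rewrite /y; lra.
have -> : expR y - (1 - a * k%:R + 2 * a * q) =
  (expR y - 1 - y) + ((D * a - D / 2 * l) - 2 * a * q * (1 - t)).
  by rewrite /y -/D; ring.
apply: (@le_trans _ _ (expR (- q) * ((a * (D + 2 * q)) ^+ 2 * expR (D + q * (2 / 3)))
   + expR (- q) * (a ^+ 2 * (2 * D + 4 * q)))).
  rewrite -mulrDr ler_wpM2l ?expR_ge0// (le_trans (ler_normD _ _))// lerD//.
    have /andP[z0 z1] := expR_sub_bound1 y; rewrite ger0_norm//.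
    apply: le_trans z1 _; rewrite -(real_normK (num_real y)).
    by rewrite ler_pM ?exprn_ge0 ?expR_ge0 ?ler_expR// lerXn2r// nnegrE
       mulr_ge0//; lra.
  have e1 : 0 <= D * a - D / 2 * l <= 2 * D * a ^+ 2.
    have : D * l <= D * (2 * a) by rewrite ler_wpM2l.
    have : D * (2 * a - (2 * a) ^+ 2) <= D * l by rewrite ler_wpM2l.
    by move=> ? ?; apply/andP; split; nra.
  have e2 : 0 <= 2 * a * q * (1 - t) <= 4 * q * a ^+ 2.
    have -> : 1 - t = 2 * a * t by lra.
    have aq : 0 <= a ^+ 2 * q by rewrite mulr_ge0 ?sqr_ge0.
    have -> : 2 * a * q * (2 * a * t) = 4 * (a ^+ 2 * q) * t by ring.
    by apply/andP; split; [rewrite !mulr_ge0// ltW|nra].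
  case/andP: e1 => ? ?; case/andP: e2 => ? ?.
  by rewrite ler_norml; apply/andP; split; nra.
rewrite [leRHS]mulrDl lerD//.
  (* Here [(D + 2 q)^2 = 36 z^2] with [z = D / 6 + q / 3], and [z^2 <= 2 exp z]; the [q]-part of
     [exp z] is exactly the spare [exp(q / 3)]. *)
  have c2 : (D + 2 * q) ^+ 2 <= 72 * expR (D / 6 + q / 3).
    have z0 : 0 <= D / 6 + q / 3 by lra.
    have := expR_ge1Dxn 1 z0; rewrite (_ : 2`!%:R = 2)// => z.
    have : (D / 6 + q / 3) ^+ 2 <= 2 * expR (D / 6 + q / 3) by lra.
    have -> : (D / 6 + q / 3) ^+ 2 = (D + 2 * q) ^+ 2 / 36 by field.
    lra.
  rewrite exprMn.
  apply: (@le_trans _ _ (expR (- q) * (a ^+ 2 * (72 * expR (D / 6 + q / 3)) * expR (D + q * (2 / 3))))).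
    by rewrite ler_wpM2l ?expR_ge0// ler_wpM2r ?expR_ge0// ler_wpM2l// sqr_ge0.
  have -> : expR (D / 6 + q / 3) = expR (D / 6) * expR (q / 3) by rewrite expRD.
  have -> : expR (D + q * (2 / 3)) = expR D * expR (q * (2 / 3)) by rewrite expRD.
  have e1 : expR (- q) * expR (q / 3) * expR (q * (2 / 3)) = 1.
    by rewrite -!expRD (_ : _ + _ = 0) ?expR0//; field.
  have -> : expR (- q) * (a ^+ 2 * (72 * (expR (D / 6) * expR (q / 3))) * (expR D * expR (q * (2 / 3))))
    = 72 * (expR D * expR (D / 6)) * a ^+ 2 * (expR (- q) * expR (q / 3) * expR (q * (2 / 3))).
    by ring.
  by rewrite e1 mulr1.
rewrite mulrCA mulrC ler_wpM2r ?sqr_ge0//.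
have := gauss_poly_bound q0; have : expR (- q) <= 1 by rewrite expR_le1 oppr_le0.
have := expR_gt0 (- q); have := mulr_ge0 (expR_ge0 (- q)) q0.
nra.
Qed.

End ExponentialBounds.

Section QuadraticForms.
Context {R : realType} {d : nat}.
Implicit Types (M : 'M[R]_d) (u v : 'rV[R]_d).

Definition qf M u v : R := (u *m M *m v^T) ord0 ord0.

Lemma qfDl M u1 u2 v : qf M (u1 + u2) v = qf M u1 v + qf M u2 v.
Proof. by rewrite /qf !mulmxDl mxE. Qed.

Lemma qfDr M u v1 v2 : qf M u (v1 + v2) = qf M u v1 + qf M u v2.
Proof. by rewrite /qf linearD /= mulmxDr mxE. Qed.

Lemma qfZl M a u v : qf M (a *: u) v = a * qf M u v.
Proof. by rewrite /qf -!scalemxAl mxE. Qed.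

Lemma qfZr M a u v : qf M u (a *: v) = a * qf M u v.
Proof. by rewrite /qf linearZ /= -scalemxAr mxE. Qed.

Lemma qfNl M u v : qf M (- u) v = - qf M u v.
Proof. by rewrite -scaleN1r qfZl mulN1r. Qed.

Lemma qfNr M u v : qf M u (- v) = - qf M u v.
Proof. by rewrite -scaleN1r qfZr mulN1r. Qed.

Lemma qfC M u v : M^T = M -> qf M u v = qf M v u.
Proof.
move=> symM; rewrite /qf.
have -> : v *m M *m u^T = (u *m M *m v^T)^T by rewrite !trmx_mul trmxK symM mulmxA.
by rewrite [RHS]mxE.
Qed.

Lemma qfE M u v : qf M u v = \sum_k (u *m M) ord0 k * v ord0 k.
Proof. by rewrite /qf mxE; apply: eq_bigr => k _; rewrite [v^T _ _]mxE. Qed.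

Lemma qfEE M u v : qf M u v = \sum_k (\sum_l u ord0 l * M l k) * v ord0 k.
Proof. by rewrite qfE; apply: eq_bigr => k _; rewrite mxE. Qed.

Lemma qf_delta M u k : qf M u (delta_mx ord0 k) = (u *m M) ord0 k.
Proof.
rewrite qfE (bigD1 k)//= big1 => [|j jk].
  by rewrite [delta_mx _ _ _ _]mxE !eqxx mulr1 addr0.
by rewrite [delta_mx _ _ _ _]mxE (negbTE jk) andbF mulr0.
Qed.

Lemma qf_CauchySchwarz M u v : M^T = M -> (forall w, 0 <= qf M w w) ->
  qf M u v ^+ 2 <= qf M u u * qf M v v.
Proof.
move=> symM psd.
have E s t : qf M (s *: u + t *: v) (s *: u + t *: v) =
    s ^+ 2 * qf M u u + 2 * s * t * qf M u v + t ^+ 2 * qf M v v.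
  rewrite !(qfDl, qfDr, qfZl, qfZr) (qfC v u symM); ring.
set b := qf M u v; have u0 := psd u; have v0 := psd v.
have [vv|vv] := eqVneq (qf M v v) 0; last first.
  have := psd (qf M v v *: u + (- b) *: v); rewrite E -/b.
  rewrite (_ : _ + _ = qf M v v * (qf M u u * qf M v v - b ^+ 2)); last by ring.
  by rewrite pmulr_rge0 ?subr_ge0// lt_neqAle eq_sym vv v0.
rewrite vv mulr0; have [->|b0] := eqVneq b 0; first by rewrite expr0n.
have b2 : 0 < b ^+ 2 by rewrite exprn_even_gt0.
(* If [v] were isotropic with [b] nonzero, the form would take the value -1 at this combination. *)
have := psd (1 *: u + (- (qf M u u + 1) / (2 * b)) *: v).
rewrite E -/b vv mulr0 addr0 expr1n mul1r mulr1.
by rewrite (_ : _ + _ = - 1) ?ler0N1//; field.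
Qed.

End QuadraticForms.

Lemma measurable_qf {dsp : measure_display} {T : measurableType dsp} {R : realType}
    {d : nat} (M : 'M[R]_d) (U V : T -> 'rV[R]_d) :
  (forall k, measurable_fun setT (fun w => U w ord0 k)) ->
  (forall k, measurable_fun setT (fun w => V w ord0 k)) ->
  measurable_fun setT (fun w => qf M (U w) (V w)).
Proof.
move=> mU mV.
rewrite (_ : (fun w => _) = fun w =>
    \sum_k (\sum_l U w ord0 l * M l k) * V w ord0 k); last first.
  by apply/funext => w; rewrite qfEE.
apply: measurable_sum => k; apply: measurable_funM => //.
by apply: measurable_sum => l; apply: measurable_funM.
Qed.

(** * Recursion for the Laplace transform of the quadratic form *)

Section HeatFlow.
Context {dsp : measure_display} {T : measurableType dsp} {R : realType}
        (P : probability T R) {d : nat}.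
Variables (X : T -> 'rV[R]_d) (Xs : nat -> T -> 'rV[R]_d).
Hypothesis mX : forall k, measurable_fun setT (fun w => X w ord0 k).
Hypothesis mXs : forall i k, measurable_fun setT (fun w => Xs i w ord0 k).
Hypothesis indXs : mutually_independent P Xs.
Hypothesis lawXs : forall i, same_law P (Xs i) X.
Variables (theta0 : 'rV[R]_d) (Sigma M : 'M[R]_d).
Let z (k : 'I_d) (v : 'rV[R]_d) : R := (v - theta0) ord0 k.
Hypothesis LZ : forall k, L1 P (z k \o X).
Hypothesis LZZ : forall k l, L1 P (fun w => z k (X w) * z l (X w)).
Hypothesis EZ : forall k, mean P (z k \o X) = 0.
Hypothesis EZZ : forall k l, mean P (fun w => z k (X w) * z l (X w)) = Sigma k l.
Hypothesis symM : M^T = M.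
Hypothesis psdM : forall u, 0 <= qf M u u.
Hypothesis MS : M *m Sigma = 1%:M.

Let Q u := qf M u u.
Let S n w : 'rV[R]_d := \sum_(i < n) (Xs i w - theta0).
(** Mean Taylor remainder contributed by one summand. That [n * rho (lambda / n)] tends to 0 plays
    the part of Lindeberg's condition. *)
Let rho (a : R) : R :=
  mean P (fun w => a * Q (X w - theta0) * Num.min 1 (Num.sqrt (a * Q (X w - theta0)))).
Let L n (a : R) : R := mean P (fun w => expR (- (a * Q (S n w)))).

Let Q0 u : 0 <= Q u. Proof. exact: psdM. Qed.

Lemma borel_centered k : borel_fun (z k).
Proof.
rewrite /borel_fun (_ : z k = fun v => v ord0 k - theta0 ord0 k); last first.
  by apply/funext => v; rewrite /z !mxE.
exact: (measurable_funB (borel_coord k) (@measurable_cst _ _ _ _ setT (theta0 ord0 k))).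
Qed.

Lemma borel_centeredM k l : borel_fun (fun v => z k v * z l v).
Proof. by apply: measurable_funM; exact: borel_centered. Qed.

Lemma borel_Q : borel_fun (fun v => Q (v - theta0)).
Proof. by apply: measurable_qf => k; exact: borel_centered. Qed.

Lemma QzE v : Q (v - theta0) = \sum_k \sum_l M l k * (z l v * z k v).
Proof.
rewrite /Q qfEE; apply: eq_bigr => k _; rewrite mulr_suml.
by apply: eq_bigr => l _; rewrite /z; ring.
Qed.

Lemma L1_Q : L1 P (fun w => Q (X w - theta0)).
Proof.
rewrite (_ : (fun w => _) = fun w => \sum_k \sum_l M l k * (z l (X w) * z k (X w))).
  by apply: L1_sum => k _; apply: L1_sum => l _; apply: L1Z.
by apply/funext => w; exact: QzE.
Qed.

Lemma symS : Sigma^T = Sigma.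
Proof.
apply/matrixP => k l; rewrite mxE -!EZZ; congr mean.
by apply/funext => w; rewrite mulrC.
Qed.

(** The mean is the trace of [M *m Sigma = 1]; this is where the number of degrees of freedom comes
    from. *)
Lemma mean_Q : mean P (fun w => Q (X w - theta0)) = d%:R.
Proof.
rewrite (_ : (fun w => _) = fun w => \sum_k \sum_l M l k * (z l (X w) * z k (X w))).
  rewrite mean_sum => [|k _]; last by apply: L1_sum => l _; apply: L1Z.
  transitivity (\tr (M *m Sigma)).
    apply: eq_bigr => k _; rewrite mean_sum => [|l _]; last exact: L1Z.
    rewrite mxE; apply: eq_bigr => l _; rewrite meanZ// EZZ.
    by congr (_ * _); rewrite -[in LHS]symM mxE.
  by rewrite MS mxtrace1.
by apply/funext => w; exact: QzE.
Qed.

Lemma sigma_measurable_S n k : sigma_measurable (past Xs n) (fun w => S n w ord0 k).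
Proof.
rewrite /sigma_measurable (_ : (fun w => _) = fun w => \sum_(i < n) z k (Xs i w)).
  by apply: measurable_sum => i; apply: past_borel => //; exact: borel_centered.
by apply/funext => w; rewrite /S summxE.
Qed.

Lemma measurable_S n k : measurable_fun setT (fun w => S n w ord0 k).
Proof. exact: (sigma_measurableW (past_measurable mXs (m:=n)) (@sigma_measurable_S n k)). Qed.

Lemma sigma_measurable_QS n : sigma_measurable (past Xs n) (fun w => Q (S n w)).
Proof.
by apply: (@measurable_qf _ (g_sigma_algebraType (past Xs n))) => k;
  exact: sigma_measurable_S.
Qed.

Lemma sigma_measurable_SM n k :
  sigma_measurable (past Xs n) (fun w => (S n w *m M) ord0 k).
Proof.
rewrite /sigma_measurable
  (_ : (fun w => _) = fun w => \sum_l S n w ord0 l * M l k).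
  apply: measurable_sum => l; apply: measurable_funM => //.
  exact: sigma_measurable_S.
by apply/funext => w; rewrite mxE.
Qed.

Section OneStep.
Variables (n : nat) (a : R).
Hypothesis a0 : 0 < a.

Let G w := expR (- (a * Q (S n w))).
Let SM k w : R := (S n w *m M) ord0 k.

Let G0 w : 0 < G w. Proof. exact: expR_gt0. Qed.
Let G1 w : G w <= 1.
Proof. by rewrite expR_le1 oppr_le0 mulr_ge0 ?Q0 ?(ltW a0). Qed.
(** Since [t exp(-t) <= 1], the weight [G] keeps quadratic expressions in [S n] bounded, which gives
    the integrability of all products below. *)
Let GQ w : G w * Q (S n w) <= a^-1.
Proof.
rewrite -[leRHS]mul1r ler_pdivlMr// -mulrA [Q _ * a]mulrC.
apply: le_trans (gauss_poly_bound (mulr_ge0 (ltW a0) (psdM (S n w)))).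
by rewrite ler_wpM2l ?expR_ge0// lerDr.
Qed.
Let SM2 k w : SM k w ^+ 2 <= Q (S n w) * M k k.
Proof.
rewrite /SM -qf_delta; apply: le_trans (qf_CauchySchwarz _ _ symM psdM) _.
by rewrite (qf_delta M (delta_mx ord0 k) k) -rowE mxE.
Qed.
Let Mkk k : 0 <= M k k.
Proof. by have := psdM (delta_mx ord0 k); rewrite qf_delta -rowE mxE. Qed.
Let GSM2 k w : G w * SM k w ^+ 2 <= a^-1 * M k k.
Proof.
apply: (@le_trans _ _ (G w * Q (S n w) * M k k)); last by rewrite ler_wpM2r.
by rewrite -mulrA ler_wpM2l// ltW.
Qed.

Let sG : sigma_measurable (past Xs n) G.
Proof.
rewrite /sigma_measurable /G; apply: measurableT_comp => //.
apply: measurableT_comp => //; apply: measurable_funM => //.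
exact: sigma_measurable_QS.
Qed.
Let sGSM k : sigma_measurable (past Xs n) (fun w => G w * SM k w).
Proof. exact: (measurable_funM sG (@sigma_measurable_SM n k)). Qed.
Let sGSM2 k l : sigma_measurable (past Xs n) (fun w => G w * SM k w * SM l w).
Proof. exact: (measurable_funM (sGSM k) (@sigma_measurable_SM n l)). Qed.

Let past_meas (f : T -> R) : sigma_measurable (past Xs n) f -> measurable_fun (setT : set T) f.
Proof. by move=> sf; exact: (sigma_measurableW (past_measurable mXs (m:=n)) sf). Qed.

Let LG : L1 P G.
Proof.
apply: (@L1_bounded _ _ _ P 1); first exact: past_meas.
by move=> w; rewrite gtr0_norm.
Qed.
Let LGSM k : L1 P (fun w => G w * SM k w).
Proof.
apply: (@L1_bounded _ _ _ P (1 + a^-1 * M k k)); first exact: past_meas.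
move=> w; rewrite normrM gtr0_norm//.
apply: (@le_trans _ _ (G w * (1 + SM k w ^+ 2))).
  rewrite ler_wpM2l ?(ltW (G0 w))// -(real_normK (num_real (SM k w))).
  by have := sqr_ge0 (`|SM k w| - 1); rewrite sqrrB; have := normr_ge0 (SM k w); nra.
by rewrite mulrDr mulr1 lerD.
Qed.
Let LGSM2 k l : L1 P (fun w => G w * SM k w * SM l w).
Proof.
apply: (@L1_bounded _ _ _ P (a^-1 * M k k + a^-1 * M l l)); first exact: past_meas.
move=> w; rewrite -mulrA normrM gtr0_norm//.
apply: (@le_trans _ _ (G w * (SM k w ^+ 2 + SM l w ^+ 2))).
  rewrite ler_wpM2l ?(ltW (G0 w))// ler_norml.
  have := sqr_ge0 (SM k w - SM l w); have := sqr_ge0 (SM k w + SM l w).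
  by have := sqr_ge0 (SM k w); have := sqr_ge0 (SM l w); move=> *; apply/andP; split; nra.
by rewrite mulrDr lerD.
Qed.

Let b w := a * qf M (S n w) (Xs n w - theta0).
Let h w := a * Q (Xs n w - theta0).

Let GbE w : G w * b w = \sum_k a * (G w * SM k w * z k (Xs n w)).
Proof. by rewrite /b qfE !mulr_sumr; apply: eq_bigr => k _; rewrite -/(SM k w) /z; ring. Qed.

Let Gb2E w : G w * b w ^+ 2 =
  \sum_k \sum_l a ^+ 2 * (G w * SM k w * SM l w * (z k (Xs n w) * z l (Xs n w))).
Proof.
rewrite expr2 mulrA GbE mulr_suml; apply: eq_bigr => k _.
rewrite /b qfE !mulr_sumr; apply: eq_bigr => l _.
by rewrite -/(SM l w) /z; ring.
Qed.

(** [G] and [S n] depend on the past only, and the present summand is centred. *)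
Let Gb_mean : L1 P (fun w => G w * b w) /\ mean P (fun w => G w * b w) = 0.
Proof.
have F k := mean_past_present mXs indXs (sGSM k) (borel_centered k) (LGSM k)
  (L1_law mX mXs lawXs n (borel_centered k) (LZ k)).
rewrite (_ : (fun w => _) = fun w => \sum_k a * (G w * SM k w * z k (Xs n w)));
  last exact/funext.
split; first by apply: L1_sum => k _; apply: L1Z; case: (F k).
rewrite mean_sum => [|k _]; last by apply: L1Z; case: (F k).
rewrite big1// => k _; rewrite meanZ; last by case: (F k).
by case: (F k) => _ ->; rewrite (mean_law mX mXs lawXs n (borel_centered k) (LZ k)) EZ !mulr0.
Qed.

Let LGQ : L1 P (fun w => G w * Q (S n w)).
Proof.
apply: (@L1_bounded _ _ _ P a^-1).
  by apply: past_meas; exact: (measurable_funM sG (@sigma_measurable_QS n)).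
by move=> w; rewrite ger0_norm ?GQ// mulr_ge0 ?Q0// ltW.
Qed.

(** The second moments of the present summand are [Sigma], and [M *m Sigma = 1] turns the resulting
    form [S M Sigma M S^T] back into [Q (S n w)]. *)
Let Gb2_mean : L1 P (fun w => G w * b w ^+ 2) /\
  mean P (fun w => G w * b w ^+ 2) = a ^+ 2 * mean P (fun w => G w * Q (S n w)).
Proof.
have F k l := mean_past_present mXs indXs (sGSM2 k l) (borel_centeredM k l) (LGSM2 k l)
  (L1_law mX mXs lawXs n (borel_centeredM k l) (LZZ k l)).
rewrite (_ : (fun w => G w * b w ^+ 2) = fun w => \sum_k \sum_l
  a ^+ 2 * (G w * SM k w * SM l w * (z k (Xs n w) * z l (Xs n w)))); last exact/funext.
have LF k l : L1 P (fun w =>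
    a ^+ 2 * (G w * SM k w * SM l w * (z k (Xs n w) * z l (Xs n w)))).
  by apply: L1Z; case: (F k l).
have LF2 k : L1 P (fun w => \sum_l
    a ^+ 2 * (G w * SM k w * SM l w * (z k (Xs n w) * z l (Xs n w)))).
  by apply: L1_sum.
split; first exact: L1_sum.
rewrite (_ : (fun w => G w * Q (S n w)) =
    fun w => \sum_k \sum_l Sigma k l * (G w * SM k w * SM l w)); last first.
  apply/funext => w; have -> : Q (S n w) = qf Sigma (S n w *m M) (S n w *m M).
    by rewrite /Q /qf trmx_mul symM -!mulmxA [M *m (Sigma *m _)]mulmxA MS mul1mx.
  rewrite qfEE mulr_sumr [RHS]exchange_big; apply: eq_bigr => k _ /=.
  rewrite mulr_suml mulr_sumr; apply: eq_bigr => l _.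
  by rewrite -/(SM l w) -/(SM k w); ring.
rewrite !mean_sum//; last by move=> k _; apply: L1_sum => l _; exact: L1Z.
rewrite mulr_sumr; apply: eq_bigr => k _.
rewrite !mean_sum//; last by move=> l _; exact: L1Z.
rewrite mulr_sumr; apply: eq_bigr => l _.
rewrite meanZ; last by case: (F k l).
rewrite meanZ//; case: (F k l) => _ ->.
rewrite (mean_law mX mXs lawXs n (borel_centeredM k l) (LZZ k l)) EZZ; ring.
Qed.

Let Gh_mean : L1 P (fun w => G w * h w) /\
  mean P (fun w => G w * h w) = a * d%:R * mean P G.
Proof.
have [L1h Eh] := mean_past_present mXs indXs sG borel_Q LG
  (L1_law mX mXs lawXs n borel_Q L1_Q).
rewrite (_ : (fun w => G w * h w) = fun w => a * (G w * Q (Xs n w - theta0))).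
  split; first exact: L1Z.
  rewrite meanZ// Eh (mean_law mX mXs lawXs n borel_Q L1_Q).
  by rewrite -/(mean P (fun w => Q (X w - theta0))) mean_Q; ring.
by apply/funext => w; rewrite /h; ring.
Qed.

Let second_order_mean :
  L1 P (fun w => G w * (1 - 2 * b w - h w + 2 * b w ^+ 2)) /\
  mean P (fun w => G w * (1 - 2 * b w - h w + 2 * b w ^+ 2)) =
  mean P (fun w => G w * (1 - a * d%:R + 2 * a * (a * Q (S n w)))).
Proof.
have [Lb Eb] := Gb_mean; have [Lb2 Eb2] := Gb2_mean; have [Lh Eh] := Gh_mean.
rewrite (_ : (fun w => _) = fun w =>
  G w - 2 * (G w * b w) - G w * h w + 2 * (G w * b w ^+ 2)); last first.
  by apply/funext => w; ring.
have L2b := L1Z 2 Lb; have L2b2 := L1Z 2 Lb2.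
have La := L1B LG L2b; have Lc := L1B La Lh.
split; first exact: L1D.
rewrite (meanD Lc L2b2) (meanB La Lh) (meanB LG L2b) (meanZ _ Lb) (meanZ _ Lb2).
rewrite Eb Eb2 Eh.
rewrite (_ : (fun w => G w * (1 - a * d%:R + 2 * a * (a * Q (S n w)))) = fun w =>
  (1 - a * d%:R) * G w + 2 * a ^+ 2 * (G w * Q (S n w))); last first.
  by apply/funext => w; ring.
rewrite (meanD (L1Z _ LG) (L1Z _ LGQ)) (meanZ _ LG) (meanZ _ LGQ).
ring.
Qed.

Let measurable_rho : borel_fun (fun v => a * Q (v - theta0) *
  Num.min 1 (Num.sqrt (a * Q (v - theta0)))).
Proof.
have mh : borel_fun (fun v => a * Q (v - theta0)).
  by apply: measurable_funM => //; exact: borel_Q.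
apply: (measurable_funM mh); apply: measurable_minr => //.
exact: (measurableT_comp (continuous_measurable_fun (@sqrt_continuous R)) mh).
Qed.

Lemma L1_rho : L1 P (fun w => a * Q (X w - theta0) *
  Num.min 1 (Num.sqrt (a * Q (X w - theta0)))).
Proof.
apply: (L1_le (borel_comp mX measurable_rho) (L1Z a L1_Q)) => w /=.
have q0 : 0 <= a * Q (X w - theta0) by rewrite mulr_ge0 ?Q0 ?(ltW a0).
rewrite ger0_norm; last by rewrite mulr_ge0// le_min ler01 sqrtr_ge0.
by rewrite -[leRHS]mulr1 ler_wpM2l// ge_min lexx.
Qed.

(* Conditionally on the past, the mean of the second-order expansion in the last
   summand is that of the Gaussian with the same covariance. *)
Lemma heat_one_step C1 C2 :
  (forall q h b : R, 0 <= q -> 0 <= h -> b ^+ 2 <= q * h ->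
  `|expR (- (q + 2 * b + h)) - expR (- q) * (1 - 2 * b - h + 2 * b ^+ 2)| <=
  C1 * (h * Num.min 1 (Num.sqrt h))) ->
  (forall q a : R, 0 <= q -> 0 < a <= 1 ->
  `|(1 + 2 * a) `^ (- (d%:R / 2)) * expR (- (q / (1 + 2 * a)))
    - expR (- q) * (1 - a * d%:R + 2 * a * q)| <= C2 * a ^+ 2) ->
  a <= 1 ->
  `|L n.+1 a - (1 + 2 * a) `^ (- (d%:R / 2)) * L n (a / (1 + 2 * a))| <=
  C1 * rho a + C2 * a ^+ 2.
Proof.
move=> HC1 HC2 a1; have [L2 E2] := second_order_mean.
have mL k (c : R) : 0 < c -> L1 P (fun w => expR (- (c * Q (S k w)))).
  move=> c0; apply: (@L1_bounded _ _ _ P 1).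
    apply: measurableT_comp => //; apply: measurableT_comp => //.
    apply: measurable_funM => //; apply: measurable_qf => j; exact: measurable_S.
  by move=> w; rewrite gtr0_norm ?expR_gt0// expR_le1 oppr_le0 mulr_ge0 ?Q0// ltW.
have a20 : 0 < a / (1 + 2 * a) by rewrite divr_gt0 ?addr_gt0 ?mulr_gt0.
have LSn := mL n.+1 a a0; have LSa := mL n _ a20.
rewrite /L -(meanZ _ LSa).
set A := mean P _; set B := mean P _.
pose D := mean P (fun w => G w * (1 - 2 * b w - h w + 2 * b w ^+ 2)).
(* [D] is the common second-order term: [HC1] compares it with the true summand, [HC2] with the
   Gaussian one. *)
have -> : A - B = (A - D) + (D - B) by ring.
apply: le_trans (ler_normD _ _) _; apply: lerD.
  rewrite /A /D -meanB//; apply: le_trans (ler_norm_mean (L1B LSn L2)) _.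
  rewrite /rho -(mean_law mX mXs lawXs n measurable_rho L1_rho).
  have LR := L1_law mX mXs lawXs n measurable_rho L1_rho.
  rewrite -meanZ//; apply: mean_le.
  - exact: L1_norm (L1B LSn L2).
  - exact: L1Z.
  move=> w; have := HC1 (a * Q (S n w)) (h w) (b w).
  rewrite /= -/(h w); have -> : a * Q (S n w) + 2 * b w + h w = a * Q (S n.+1 w).
    have -> : S n.+1 w = S n w + (Xs n w - theta0) by rewrite /S big_ord_recr.
    rewrite /h /b /Q; move: (S n w) (Xs n w - theta0) => s xi.
    by rewrite !(qfDl, qfDr) (qfC xi s symM); ring.
  apply.
  - by rewrite mulr_ge0 ?Q0 ?(ltW a0).
  - by rewrite mulr_ge0 ?Q0 ?(ltW a0).
  - rewrite /b /h exprMn (_ : _ * _ * (_ * _) = a ^+ 2 * (Q (S n w) * Q (Xs n w - theta0))); last by ring.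
    by rewrite ler_wpM2l ?sqr_ge0// qf_CauchySchwarz.
have LE : L1 P (fun w => G w * (1 - a * d%:R + 2 * a * (a * Q (S n w)))).
  rewrite (_ : (fun w => _) = fun w =>
    (1 - a * d%:R) * G w + 2 * a ^+ 2 * (G w * Q (S n w))); last first.
    by apply/funext => w; ring.
  by apply: L1D; exact: L1Z.
rewrite /D E2 /B distrC -meanB//; last exact: L1Z.
have LB := L1B (L1Z ((1 + 2 * a) `^ (- (d%:R / 2))) LSa) LE.
apply: le_trans (ler_norm_mean LB) _.
rewrite -[leRHS](mean_cst P); apply: mean_le => [||w].
- exact: L1_norm.
- exact: L1_cst.
have := HC2 (a * Q (S n w)) a; rewrite a0 a1 => HC.
have -> : a / (1 + 2 * a) * Q (S n w) = a * Q (S n w) / (1 + 2 * a) by ring.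
by apply: HC => //; exact: mulr_ge0 (ltW a0) (Q0 _).
Qed.

End OneStep.

(* The heat flow [a |-> a / (1 + 2 a)] composes: [1 / a] increases by 2 at each step. *)
Lemma heat_iter (a0 e : R) :
  (forall n a, 0 < a <= a0 ->
    `|L n.+1 a - (1 + 2 * a) `^ (- (d%:R / 2)) * L n (a / (1 + 2 * a))| <= e) ->
  forall n a, 0 < a <= a0 ->
    `|L n a - (1 + 2 * n%:R * a) `^ (- (d%:R / 2))| <= n%:R * e.
Proof.
move=> step; elim=> [|n IH] a /andP[ap aa].
  rewrite mulr0 mul0r addr0 mul0r powR1 /L (_ : (fun w => _) = fun=> 1).
    by rewrite mean_cst subrr normr0.
  apply/funext => w; rewrite /S big_ord0 /Q.
  by rewrite -(scale0r (0 : 'rV[R]_d)) qfZl mul0r mulr0 oppr0 expR0.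
have a2 : 0 < 1 + 2 * a by rewrite addr_gt0 ?mulr_gt0.
set p := - (d%:R / 2).
(* A prefactor at most 1 does not amplify errors, so those of successive steps simply add up. *)
have p1 : (1 + 2 * a) `^ p <= 1.
  rewrite -[leRHS](powRr0 (1 + 2 * a)) ler_powR//.
    by rewrite lerDl mulr_ge0// ltW.
  by rewrite oppr_le0 divr_ge0.
have -> : (1 + 2 * n.+1%:R * a) `^ p =
    (1 + 2 * a) `^ p * (1 + 2 * n%:R * (a / (1 + 2 * a))) `^ p.
  rewrite -powRM ?(ltW a2)//; last first.
    by rewrite addr_ge0// !mulr_ge0 ?invr_ge0// ltW.
  congr (_ `^ _); rewrite -natr1; field; exact: lt0r_neq0.
have -> : L n.+1 a - (1 + 2 * a) `^ p * (1 + 2 * n%:R * (a / (1 + 2 * a))) `^ p =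
    (L n.+1 a - (1 + 2 * a) `^ p * L n (a / (1 + 2 * a))) +
    (1 + 2 * a) `^ p * (L n (a / (1 + 2 * a)) - (1 + 2 * n%:R * (a / (1 + 2 * a))) `^ p).
  by rewrite mulrBr addrA subrK.
apply: le_trans (ler_normD _ _) _.
rewrite (_ : n.+1%:R * e = e + n%:R * e); last by rewrite -natr1; ring.
apply: lerD; first by apply: step; rewrite ap aa.
  rewrite normrM ger0_norm ?powR_ge0//.
  apply: le_trans (ler_piMl _ p1) _ => //; apply: IH.
  rewrite divr_gt0//=; apply: le_trans aa.
  by rewrite ler_pdivrMr// ler_peMr ?ltW// ltrDl mulr_gt0.
Qed.

(** The parameter decreases along the flow, so the remainder at the initial parameter bounds all the
    others. *)
Let rho_homo (a a' : R) : 0 < a -> a <= a' -> rho a <= rho a'.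
Proof.
move=> a0 aa; have a'0 : 0 < a' by exact: lt_le_trans aa.
apply: mean_le; [exact: L1_rho|exact: L1_rho|move=> w].
have qq : a * Q (X w - theta0) <= a' * Q (X w - theta0) by rewrite ler_wpM2r.
have q0 : 0 <= a * Q (X w - theta0) by rewrite mulr_ge0 ?(ltW a0).
apply: ler_pM => //; rewrite le_min; apply/andP; split.
  by rewrite ge_min lexx.
by rewrite ge_min ler_wsqrtr ?orbT.
Qed.

Theorem laplace_limit (lambda : R) : 0 < lambda ->
  mean P (fun w => expR (- (lambda / n%:R * Q (S n w)))) @[n --> \oo] -->
  (1 + 2 * lambda) `^ (- (d%:R / 2)).
Proof.
move=> l0; have [C1 C10 HC1] := gauss_second_order R.
have [C2 C20 HC2] := heat_second_order R d.
apply/cvgrPdist_le => e e0.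
(* [n] times the integrand of [rho (lambda / n)]: it tends to 0 pointwise and is dominated by
   [lambda * Q]. *)
pose F (n : nat) w := lambda * Q (X w - theta0) *
  Num.min 1 (Num.sqrt (lambda / n%:R * Q (X w - theta0))).
have F0 n w : 0 <= F n w.
  by rewrite !mulr_ge0 ?(ltW l0)// le_min ler01 sqrtr_ge0.
have mF n : measurable_fun (setT : set T) (F n).
  have mQ := borel_comp mX borel_Q.
  apply: measurable_funM; first exact: measurable_funM.
  apply: measurable_minr => //.
  apply: (measurableT_comp (continuous_measurable_fun (@sqrt_continuous R))).
  exact: measurable_funM.
have small : \forall n \near \oo, mean P (F n) <= e / 2 / C1.
  apply: (@mean_cvg0_le _ _ _ _ _ (fun w => lambda * Q (X w - theta0))) => //.
  - exact: L1Z L1_Q.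
  - move=> n w; rewrite ger0_norm// /F.
    apply: ler_piMr; first by rewrite mulr_ge0 ?Q0 ?(ltW l0).
    by rewrite ge_min lexx.
  - move=> w; rewrite -[X in _ --> X](mulr0 (lambda * Q (X w - theta0))).
    apply: cvgMr; apply: (@squeeze_cvgr _ _ _ _ (fun=> 0)
      (fun n => Num.sqrt (lambda * Q (X w - theta0) * n%:R^-1))).
    + apply: nearW => n; rewrite le_min ler01 sqrtr_ge0/= ge_min.
      by rewrite mulrAC lexx orbT.
    + exact: cvg_cst.
    + rewrite -(@sqrtr0 R); apply: continuous_cvg; first exact: sqrt_continuous.
      rewrite -(mulr0 (lambda * Q (X w - theta0))); apply: cvgMr.
      apply/gtr0_cvgV0; last exact: cvgr_idn.
      by exists 1%N => // k /= k0; rewrite ltr0n.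
  - by rewrite !divr_gt0.
near=> n.
have n0 : 0 < n%:R :> R by rewrite ltr0n; near: n; exact: nbhs_infty_gt.
have nl : lambda <= n%:R by near: n; exact: nbhs_infty_ger.
have nC : C2 * lambda ^+ 2 / (e / 2) <= n%:R by near: n; exact: nbhs_infty_ger.
pose a0 := lambda / n%:R.
have a00 : 0 < a0 by exact: divr_gt0.
have a01 : a0 <= 1 by rewrite ler_pdivrMr// mul1r.
have := @heat_iter a0 (C1 * rho a0 + C2 * a0 ^+ 2) _ n a0.
rewrite a00 lexx => /(_ _ isT).
rewrite (_ : 2 * n%:R * a0 = 2 * lambda); last first.
  by rewrite /a0; field; exact: lt0r_neq0.
rewrite distrC => H; apply: le_trans (H _) _.
  move=> m a /andP[ap aa]; apply: le_trans (heat_one_step m ap HC1 HC2 _) _.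
    exact: le_trans a01.
  rewrite lerD ?ler_pM2l ?rho_homo//.
  by rewrite lerXn2r// nnegrE ltW.
rewrite mulrDr [e]splitr; apply: lerD.
  have -> : n%:R * (C1 * rho a0) = C1 * mean P (F n).
    rewrite mulrCA /rho -(meanZ n%:R (L1_rho a00)).
    congr (_ * mean _ _); apply/funext => w; rewrite /F /a0 mulrA; congr (_ * _).
    by field; exact: lt0r_neq0.
  by rewrite -ler_pdivlMl// mulrC; near: n.
rewrite /a0 (_ : n%:R * _ = C2 * lambda ^+ 2 / n%:R); last first.
  by field; exact: lt0r_neq0.
by rewrite ler_pdivrMr//; move: nC; rewrite ler_pdivrMr ?divr_gt0// [n%:R * _]mulrC.
Unshelve. all: by end_near.
Qed.

End HeatFlow.

(** * The chi-square law and continuity of the Laplace transform *)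

Section ChiSquare.
Context {R : realType}.
Notation mu := (@lebesgue_measure R).

(** For [p < 0] the integrand is unbounded at 0, so the fundamental theorem of calculus is applied
    on [[1 / (n + 2), 1]] and monotone convergence exhausts the interval. *)
Lemma integral_powR01 (p : R) : -1 < p ->
  (\int[mu]_(t in `]0%R, 1%R]) (t `^ p)%:E <= ((p + 1)^-1)%:E)%E.
Proof.
move=> p1; have p0 : 0 < p + 1 by lra.
pose F (n : nat) : set R := `[n.+2%:R^-1, 1]%classic.
have Fpos n (t : R) : F n t -> 0 < t.
  by rewrite /F /= in_itv/= => /andP[+ _]; apply: lt_le_trans; rewrite invr_gt0.
have UF : \bigcup_n F n = `]0, 1]%classic.
  apply/seteqP; split => t.
    move=> [n _ Fn]; rewrite /= in_itv/= (Fpos _ _ Fn)/=.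
    by move: Fn; rewrite /F /= in_itv/= => /andP[].
  rewrite /= in_itv/= => /andP[t0 t1].
  have [n tn] : exists n : nat, t^-1 <= n%:R.
    exists (Num.truncn t^-1).+1; apply/ltW/truncnS_gt.
  exists n => //; rewrite /F /= in_itv/= t1 andbT -[leRHS]invrK lef_pV2 ?posrE ?invr_gt0//.
  by apply: le_trans tn _; rewrite ler_nat -addn2 leq_addr.
have mpow (D : set R) : measurable_fun D (fun t : R => (t `^ p)%:E).
  by apply/measurable_EFinP; apply: measurable_funTS.
have cvgF : (\int[mu]_(t in F n) (t `^ p)%:E)%E @[n --> \oo] -->
    (\int[mu]_(t in `]0%R, 1%R]) (t `^ p)%:E)%E.
  rewrite -UF; apply: ge0_nondecreasing_set_cvg_integral.
  - apply/nondecreasing_seqP => n; rewrite subsetEset => t.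
    rewrite /F /= !in_itv/= => /andP[nt ->]; rewrite andbT.
    by apply: le_trans nt; rewrite lef_pV2 ?posrE// ler_nat.
  - by move=> n; exact: measurable_itv.
  - by move=> n; exact: mpow.
  - by move=> n t _; rewrite lee_fin powR_ge0.
apply: (cvge_to_le cvgF); apply: nearW => n.
have n1 : (n.+2%:R^-1 : R) < 1 by rewrite invf_lt1// ltr1n.
have cpow (q t : R) : 0 < t -> {for t, continuous (@powR R ^~ q)}.
  move=> t0; apply: differentiable_continuous; apply/derivable1_diffP.
  by apply: derivable_powR; rewrite in_itv/= t0.
pose G (t : R) : R := (p + 1)^-1 * t `^ (p + 1).
have dG (t : R) : 0 < t -> is_derive t 1 G (t `^ p).
  move=> t0; have t0' : t \in `]0, +oo[%R by rewrite in_itv/= t0.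
  have dp : is_derive t 1 (@powR R ^~ (p + 1)) ((p + 1) * t `^ p).
    apply: DeriveDef; first exact: derivable_powR.
    by rewrite -derive1E powR_derive1// addrK.
  rewrite (_ : t `^ p = (p + 1)^-1 *: ((p + 1) * t `^ p)).
    exact: is_deriveZ.
  by rewrite /GRing.scale /= mulrA mulVf ?mul1r// gt_eqF.
rewrite (@continuous_FTC2 _ _ G) //.
- rewrite -EFinB lee_fin /G powR1 mulr1 lerBlDr lerDl mulr_ge0 ?powR_ge0//.
  by rewrite invr_ge0 ltW.
- apply: continuous_in_subspaceT => t; rewrite inE => /Fpos; exact: cpow.
- have cG (t : R) : 0 < t -> {for t, continuous G}.
    move=> t0; apply: differentiable_continuous; apply/derivable1_diffP.
    by have [] := dG _ t0.
  split.
  + move=> t; rewrite in_itv/= => /andP[nt _]; apply: ex_derive.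
    by apply: dG; apply: lt_trans nt; rewrite invr_gt0.
  + by apply: cvg_at_right_filter; apply: cG; rewrite invr_gt0.
  + by apply: cvg_at_left_filter; apply: cG.
- move=> t; rewrite in_itv/= => /andP[nt _]; rewrite derive1E.
  by apply: derive_val; apply: dG; apply: lt_trans nt; rewrite invr_gt0.
Qed.

(** By uniqueness of Lebesgue measure it suffices to check half-open intervals. *)
Lemma lebesgue_measure_scale (a : R) : 0 < a -> forall A : set R, measurable A ->
  mu A = (a%:E * mu ((fun t : R => (a * t)%R) @^-1` A))%E.
Proof.
move=> a0 A mA.
have ma : measurable_fun (setT : set (measurableTypeR R))
    (fun t : R => (a * t : measurableTypeR R)).
  exact: measurable_funM.
pose f : {mfun (measurableTypeR R) >-> (measurableTypeR R)} :=
  HB.pack (fun t : R => a * t) (isMeasurableFun.Build _ _ _ _ _ ma).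
pose m := mscale (NngNum (ltW a0)) (pushforward mu f).
rewrite (_ : (_ * _)%E = m ma A)//.
apply: lebesgue_measure_unique => // _ [[x y] _ <-] /=.
rewrite /m /mscale /= /pushforward.
rewrite (_ : _ @^-1` _ = `](x / a), (y / a)]%classic); last first.
  by apply/seteqP; split => t /=; rewrite !in_itv/= ltr_pdivrMr// ler_pdivlMr// mulrC.
rewrite !lebesgue_measure_itv/= !lte_fin ltr_pM2r ?invr_gt0//.
case: ifPn => _; last by rewrite mule0.
rewrite -!EFinB -EFinM; congr EFin; field; exact: lt0r_neq0.
Qed.

Lemma ge0_integral_scale (a : R) (f : R -> R) : 0 < a ->
  measurable_fun setT f -> (forall t, 0 <= f t) ->
  (\int[mu]_(t in `[0%R, +oo[) (f (a * t))%:E =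
   a^-1%:E * \int[mu]_(t in `[0%R, +oo[) (f t)%:E)%E.
Proof.
move=> a0 mf f0.
have ma : measurable_fun (setT : set (measurableTypeR R))
    (fun t : R => (a * t : measurableTypeR R)).
  exact: measurable_funM.
pose g : {mfun (measurableTypeR R) >-> (measurableTypeR R)} :=
  HB.pack (fun t : R => a * t) (isMeasurableFun.Build _ _ _ _ _ ma).
have E : `[0, +oo[%classic = g @^-1` `[0, +oo[%classic.
  by apply/seteqP; split => t /=; rewrite !in_itv/= !andbT pmulr_rge0.
rewrite {1}E -(@ge0_integral_pushforward _ _ _ _ _ g ma mu _ (EFin \o f))//; last 2 first.
  by apply/measurable_EFinP; exact: measurable_funTS.
  by move=> t _; rewrite lee_fin.
have ai : 0 <= a^-1 by rewrite invr_ge0 ltW.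
rewrite (eq_measure_integral (mscale (NngNum ai) mu)); last first.
  move=> A mA _.
  have E2 : (mu (g @^-1` A) = a^-1%:E * mu A)%E.
    rewrite [X in (_ = _ * X)%E](lebesgue_measure_scale a0 mA) muleA -EFinM.
    by rewrite mulVf ?mul1e// gt_eqF.
  exact: E2.
rewrite ge0_integral_mscale//; last by move=> t _; rewrite lee_fin.
by apply/measurable_EFinP; exact: measurable_funTS.
Qed.

Variable k : nat.
Hypothesis k0 : (0 < k)%N.
Let K : R -> R := chi2_kernel k.
Let p : R := k%:R / 2 - 1.
Let H : set R := `[0, +oo[%classic.

Let mH : measurable H. Proof. exact: measurable_itv. Qed.

Lemma chi2_kernel_ge0 t : 0 <= K t.
Proof. by rewrite /K /chi2_kernel mulr_ge0 ?powR_ge0 ?expR_ge0. Qed.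

Lemma measurable_chi2_kernel : measurable_fun setT K.
Proof.
apply: measurable_funM => //; apply: measurableT_comp => //.
by apply: measurable_funM => //; exact: measurableT_comp.
Qed.

(** On []0, 1]] the power is integrable because [p > -1]; beyond 1 half of the exponential decay
    absorbs the power. *)
Lemma chi2_kernel_finite : (\int[mu]_(t in H) (K t)%:E < +oo)%E.
Proof.
have kR : (0 : R) < k%:R by rewrite ltr0n.
have p1 : -1 < p by rewrite /p; lra.
rewrite /H -(@integral_itv_obnd_cbnd _ 0 +oo%O); last first.
  by apply/measurable_EFinP/measurable_funTS; exact: measurable_chi2_kernel.
have -> : `]0, +oo[%classic = `]0, 1] `|` `]1, +oo[ :> set R.
  apply/seteqP; split => t /=; rewrite !in_itv/= !andbT.
    by move=> ->; case: (leP t 1); [left|right].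
  by move=> [/andP[]//|]; apply: lt_trans.
have mK (D : set R) : measurable_fun D (EFin \o K).
  by apply/measurable_EFinP/measurable_funTS; exact: measurable_chi2_kernel.
rewrite ge0_integral_setU//=; last 3 first.
  exact: mK.
  by move=> t _; rewrite lee_fin chi2_kernel_ge0.
  apply/disj_setPS => t /= []; rewrite !in_itv/= andbT => /andP[_ t1].
  by rewrite ltNge t1.
apply: lte_add_pinfty.
  apply: le_lt_trans (ltry ((p + 1)^-1)).
  apply: le_trans _ (integral_powR01 p1); apply: ge0_le_integral => //.
  - by move=> t _; rewrite lee_fin chi2_kernel_ge0.
  - exact: mK.
  - by apply/measurable_EFinP; apply: measurable_funTS.
  - move=> t; rewrite /= in_itv/= => /andP[t0 _].
    rewrite lee_fin /K /chi2_kernel -/p ler_piMr ?powR_ge0// expR_le1; lra.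
(* From [(t / 4) ^+ k / k! <= exp(t / 4)], combined with [t^p <= t^k] for [t >= 1]. The factor 4 in
   front of [C] below undoes the normalisation of the exponential density of rate 1/4. *)
pose C : R := 4 ^+ k * k`!%:R.
have C0 : 0 <= C by rewrite mulr_ge0 ?exprn_ge0.
apply: (@le_lt_trans _ _ (\int[mu]_(t in `]1%R, +oo[) ((4 * C) * exponential_pdf 4^-1 t)%:E)%E).
  apply: ge0_le_integral => //.
  - by move=> t _; rewrite lee_fin chi2_kernel_ge0.
  - exact: mK.
  - apply/measurable_EFinP; apply: measurable_funM => //.
    apply: measurable_funTS; exact: measurable_exponential_pdf.
  - move=> t; rewrite /= in_itv/= andbT => t1; have t0 : 0 <= t by lra.
    rewrite lee_fin exponential_pdfE// /K /chi2_kernel -/p.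
    have tp : t `^ p <= C * expR (t / 4).
      apply: (@le_trans _ _ (t ^+ k)).
        rewrite -powR_mulrn// ler_powR//; first exact: ltW.
        by rewrite /p; have := ler0n R k; lra.
      have t4 : 0 <= t / 4 by lra.
      have := expR_ge1Dxn k.-1 t4; rewrite prednK// => e4.
      have : (t / 4) ^+ k / k`!%:R <= expR (t / 4) by lra.
      rewrite ler_pdivrMr ?ltr0n ?fact_gt0// exprMn exprVn ler_pdivrMr ?exprn_gt0//.
      by rewrite /C => h; apply: le_trans h _; rewrite le_eqVlt; apply/orP; left;
        apply/eqP; ring.
    apply: (@le_trans _ _ (C * expR (t / 4) * expR (- t / 2))).
      by rewrite ler_wpM2r// expR_ge0.
    rewrite -mulrA -expRD (_ : t / 4 + - t / 2 = - 4^-1 * t); last by field.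
    by rewrite le_eqVlt; apply/orP; left; apply/eqP; field.
have iE := @integrable_exponential_pdf R 4^-1 (ltac:(by rewrite invr_gt0)).
have iE2 := integrableZl measurableT (4 * C) iE.
have : mu.-integrable `]1, +oo[ (fun x => ((4 * C)%:E * (exponential_pdf 4^-1 x)%:E)%E).
  by apply: (integrableS _ _ _ iE2).
move=> /integrableP[_]; apply: le_lt_trans; apply: ge0_le_integral => //.
- by move=> t _; rewrite lee_fin !mulr_ge0// exponential_pdf_ge0.
- apply/measurable_EFinP; apply: measurable_funM => //.
  apply: measurable_funTS; exact: measurable_exponential_pdf.
- apply: measurableT_comp => //; apply: measurable_funTS; apply/measurable_EFinP.
  by apply: measurable_funM => //; exact: measurable_exponential_pdf.
- by move=> t _ /=; rewrite lee_fin ler_norm.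
Qed.

Lemma chi2_kernel_pos : (0 < \int[mu]_(t in H) (K t)%:E)%E.
Proof.
have p1 : -1 <= p by rewrite /p; have := ler0n R k; lra.
(* A lower bound of the kernel on [[1, 2]], where [t^p >= 1/t >= 1/2] and [exp(-t/2) >= exp(-1)]. *)
pose c : R := 2^-1 * expR (-1).
have c0 : 0 < c by rewrite mulr_gt0 ?invr_gt0 ?expR_gt0.
apply: (@lt_le_trans _ _ (\int[mu]_(t in `[1%R, 2%R]) (cst c%:E) t)%E).
  rewrite integral_cst// [X in (_ * X)%E](@lebesgue_measure_itv R `[1, 2])/=.
  rewrite lte_fin ltr1n -EFinB -EFinM lte_fin.
  by rewrite mulr_gt0//; lra.
have mK (D : set R) : measurable_fun D (EFin \o K).
  by apply/measurable_EFinP/measurable_funTS; exact: measurable_chi2_kernel.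
apply: (@le_trans _ _ (\int[mu]_(t in `[1%R, 2%R]) (K t)%:E)%E).
  apply: ge0_le_integral => //.
  - by move=> t _; rewrite lee_fin ltW.
  - exact: mK.
  - move=> t; rewrite /= in_itv/= => /andP[t1 t2]; rewrite lee_fin /K /chi2_kernel -/p.
    apply: ler_pM; [by rewrite invr_ge0|exact: expR_ge0| |by rewrite ler_expR; lra].
    apply: (@le_trans _ _ (t `^ (-1))); last by rewrite ler_powR.
    by rewrite powR_inv1 ?lef_pV2 ?posrE//; lra.
apply: ge0_subset_integral => //.
- exact: mK.
- by move=> t _; rewrite lee_fin chi2_kernel_ge0.
- by move=> t; rewrite /H /= !in_itv/= andbT => /andP[t1 _]; lra.
Qed.

(** With [a = 1 + 2 lambda] the integrand is [a^(-p) K(a t)]; the change of variable brings one more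
    factor [1/a], and [p + 1 = k / 2]. *)
Lemma chi2_kernel_laplace (lambda : R) : 0 <= lambda ->
  (\int[mu]_(t in H) (expR (- (lambda * t)) * K t)%:E =
  ((1 + 2 * lambda) `^ (- (k%:R / 2)))%:E * \int[mu]_(t in H) (K t)%:E)%E.
Proof.
move=> l0; pose a := 1 + 2 * lambda; have a0 : 0 < a by rewrite /a; lra.
have -> : (\int[mu]_(t in H) (expR (- (lambda * t)) * K t)%:E =
    \int[mu]_(t in H) ((a `^ (- p))%:E * (K (a * t))%:E))%E.
  apply: eq_integral => t; rewrite inE /H /= in_itv/= andbT => t0.
  rewrite -EFinM; congr EFin; rewrite /K /chi2_kernel -/p.
  rewrite powRM// ?(ltW a0)// powRN.
  have ap : a `^ p != 0 by rewrite powR_eq0 gt_eqF.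
  rewrite -[a `^ p * _ * _]mulrA mulKf// mulrCA -expRD; congr (_ * expR _).
  by rewrite /a; field.
rewrite ge0_integralZl; [|exact: mH|..]; last 3 first.
  apply/measurable_EFinP; apply: measurable_funTS.
  by apply: measurableT_comp; [exact: measurable_chi2_kernel|exact: measurable_funM].
  by move=> t _; rewrite lee_fin chi2_kernel_ge0.
  by rewrite lee_fin powR_ge0.
rewrite ge0_integral_scale//; last 2 first.
  exact: measurable_chi2_kernel.
  exact: chi2_kernel_ge0.
rewrite muleA -EFinM; congr (_%:E * _)%E.
rewrite -powR_inv1 ?(ltW a0)// -powRD ?(gt_eqF a0) ?implybT//.
by congr (_ `^ _); rewrite /p; ring.
Qed.

Let I0 : R := fine (\int[mu]_(t in H) (K t)%:E).

Let I0E : (\int[mu]_(t in H) (K t)%:E)%E = I0%:E.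
Proof. by rewrite /I0 fineK// ge0_fin_numE ?chi2_kernel_finite// ltW// chi2_kernel_pos. Qed.

Let I0_gt0 : 0 < I0.
Proof. by rewrite -lte_fin -I0E chi2_kernel_pos. Qed.

Lemma integrable_chi2_kernel : mu.-integrable H (EFin \o K).
Proof.
apply/integrableP; split.
  by apply/measurable_EFinP/measurable_funTS; exact: measurable_chi2_kernel.
under eq_integral do rewrite /= ger0_norm ?chi2_kernel_ge0//.
exact: chi2_kernel_finite.
Qed.

(** Expectation under the chi-square law with [k] degrees of freedom. *)
Definition chi2_mean (f : R -> R) : R := Rintegral mu H (fun t => f t * K t) / I0.

Lemma integrable_chi2M (f : R -> R) (C : R) : measurable_fun setT f ->
  (forall t, 0 <= t -> `|f t| <= C) -> mu.-integrable H (EFin \o (fun t => f t * K t)).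
Proof.
move=> mf fC.
have iK : mu.-integrable H (fun t => (C%:E * (K t)%:E)%E).
  by apply: integrableZl => //; exact: integrable_chi2_kernel.
apply: (le_integrable _ _ _ iK) => //.
  apply/measurable_EFinP; apply: measurable_funTS.
  by apply: measurable_funM => //; exact: measurable_chi2_kernel.
move=> t; rewrite /H /= in_itv/= andbT => t0; rewrite lee_fin.
rewrite !normrM ler_wpM2r//; apply: le_trans (fC t t0) _; exact: ler_norm.
Qed.

Lemma chi2_mean_laplace (lambda : R) : 0 <= lambda ->
  chi2_mean (fun t => expR (- (lambda * t))) = (1 + 2 * lambda) `^ (- (k%:R / 2)).
Proof.
move=> l0; rewrite /chi2_mean /Rintegral chi2_kernel_laplace// I0E -EFinM /=.
by rewrite mulfK// gt_eqF.
Qed.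

Lemma chi2_cdfE (x : R) : chi2_cdf k x = chi2_mean \1_[set t : R | t <= x].
Proof.
rewrite /chi2_cdf /chi2_mean -/K -/H -/I0; congr (_ / _).
rewrite /Rintegral; congr fine.
transitivity (\int[mu]_(t in H) (((EFin \o K) \_ [set u : R | (u <= x)%R]) t))%E.
  rewrite -integral_mkcondr; congr (integral _ _ _).
  apply/seteqP; split => t; rewrite /H /= !in_itv/= andbT.
    by move=> /andP[-> ->].
  by move=> [-> ->].
apply: eq_integral => t _; rewrite /= patchE indicE.
by case: ifPn => _; rewrite ?mul1r ?mul0r.
Qed.

Lemma chi2_meanZD (a : R) (f g : R -> R) (Cf Cg : R) :
  measurable_fun setT f -> (forall t, 0 <= t -> `|f t| <= Cf) ->
  measurable_fun setT g -> (forall t, 0 <= t -> `|g t| <= Cg) ->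
  chi2_mean (fun t => a * f t + g t) = a * chi2_mean f + chi2_mean g.
Proof.
move=> mf fC mg gC; rewrite /chi2_mean mulrA -mulrDl; congr (_ / _).
have If := integrable_chi2M mf fC; have Ig := integrable_chi2M mg gC.
have Iaf : mu.-integrable H (EFin \o (fun t => a * (f t * K t))).
  rewrite (_ : _ \o _ = EFin \o (fun t => (a * f t) * K t)).
    apply: (@integrable_chi2M _ (`|a| * Cf)); first exact: measurable_funM.
    by move=> t t0; rewrite normrM ler_wpM2l// fC.
  by apply/funext => t /=; rewrite mulrA.
rewrite -RintegralZl// -RintegralD//.
by apply: eq_Rintegral => t _; ring.
Qed.

Lemma chi2_mean_le (f g : R -> R) (Cf Cg : R) :
  measurable_fun setT f -> (forall t, 0 <= t -> `|f t| <= Cf) ->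
  measurable_fun setT g -> (forall t, 0 <= t -> `|g t| <= Cg) ->
  (forall t, 0 <= t -> f t <= g t) -> chi2_mean f <= chi2_mean g.
Proof.
move=> mf fC mg gC fg; rewrite -subr_ge0.
have -> : chi2_mean g - chi2_mean f = chi2_mean (fun t => (- 1) * f t + g t).
  by rewrite (chi2_meanZD _ mf fC mg gC); ring.
apply: divr_ge0; last exact: ltW.
apply: Rintegral_ge0 => t; rewrite /H /= in_itv/= andbT => t0.
by rewrite mulr_ge0 ?chi2_kernel_ge0// mulN1r addrC subr_ge0 fg.
Qed.

Lemma chi2_mean_cst (r : R) : chi2_mean (fun=> r) = r.
Proof.
rewrite /chi2_mean RintegralZl//; last exact: integrable_chi2_kernel.
by rewrite /Rintegral I0E mulfK// gt_eqF.
Qed.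

Lemma chi2_cdf_lt0 (x : R) : x < 0 -> chi2_cdf k x = 0.
Proof.
move=> x0; rewrite /chi2_cdf /= set_itv_ge ?integral_set0 ?mul0r//.
by rewrite bnd_simp -ltNge.
Qed.

Lemma chi2_cdf_continuous (x e : R) : 0 <= x -> 0 < e ->
  exists2 delta, 0 < delta & forall y, 0 <= y -> `|y - x| < delta ->
    `|chi2_cdf k y - chi2_cdf k x| <= e.
Proof.
move=> x0 e0; pose b := x + 1; have b0 : 0 <= b by rewrite /b; lra.
have iK : mu.-integrable `[0, b] (EFin \o K).
  apply: (integrableS _ _ _ integrable_chi2_kernel) => //.
  by move=> t; rewrite /H /= !in_itv/= andbT => /andP[].
have := parameterized_integral_continuous b0 iK.
move=> /subspace_continuousP /(_ x).
have xb : `[0, b]%classic x by rewrite /= in_itv/= x0 /b; lra.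
move=> /(_ xb) /cvgrPdist_le /(_ (e * I0)); rewrite mulr_gt0// => /(_ isT).
move=> /nbhs_ballP[delta /= delta0 xdelta].
exists (Num.min delta 1); first by rewrite lt_min delta0 ltr01.
move=> y y0; rewrite lt_min => /andP[yd y1].
have yb : `[0, b]%classic y.
  by rewrite /= in_itv/= y0 /b; move: y1; rewrite ltr_norml => /andP[_]; lra.
have := xdelta y _ yb; rewrite /ball /= distrC => /(_ yd).
rewrite /parameterized_integral distrC => xye.
rewrite /chi2_cdf -/K -/H -/I0 -mulrBl normrM [`|I0^-1|]gtr0_norm ?invr_gt0//.
by rewrite ler_pdivrMr.
Qed.

End ChiSquare.

(** * From Laplace transforms to distribution functions *)

Section LaplaceContinuity.
Context {dsp : measure_display} {T : measurableType dsp} {R : realType}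
        (P : probability T R).
Variables (k : nat) (V : nat -> T -> R).
Hypothesis k0 : (0 < k)%N.
Hypothesis mV : forall n, measurable_fun setT (V n).
Hypothesis V0 : forall n w, 0 <= V n w.
Hypothesis laplaceV : forall lambda : R, 0 < lambda ->
  mean P (fun w => expR (- (lambda * V n w))) @[n --> \oo] -->
  (1 + 2 * lambda) `^ (- (k%:R / 2)).
Let F := @chi2_cdf R k.

Let laplaceV0 (lambda : R) : 0 <= lambda ->
  mean P (fun w => expR (- (lambda * V n w))) @[n --> \oo] -->
  chi2_mean k (fun t => expR (- (lambda * t))).
Proof.
move=> l0; rewrite chi2_mean_laplace//.
move: l0; rewrite le_eqVlt => /orP[/eqP <-|l0]; last exact: laplaceV.
rewrite mulr0 addr0 powR1 (_ : (fun n => _) = fun=> 1); first exact: cvg_cst.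
apply/funext => n; rewrite -[RHS](mean_cst P); congr mean.
by apply/funext => w; rewrite mul0r oppr0 expR0.
Qed.

(** At [lambda = 0] this approximates the indicator of large [t]. The extra factor closes the family
    under induction on [b]: [psi] at [b.+1] is a difference of [psi] at [b] for [lambda] and
    [lambda + a], and [b = 0] is a Laplace transform. *)
Let psi (a lambda : R) (b : nat) (t : R) : R :=
  expR (- (lambda * t)) * (1 - expR (- (a * t))) ^+ b.

Let mpsi a lambda b : measurable_fun setT (psi a lambda b).
Proof.
have mE (c : R) : measurable_fun setT (fun t : R => expR (- (c * t))).
  by apply: measurableT_comp => //; apply: measurableT_comp => //; exact: measurable_funM.
apply: measurable_funM => //; apply: measurable_funX.
by apply: measurable_funB => //; exact: mE.
Qed.

Let psi01 a lambda b t : 0 <= a -> 0 <= lambda -> 0 <= t -> 0 <= psi a lambda b t <= 1.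
Proof.
move=> a0 l0 t0.
have u0 : 0 <= 1 - expR (- (a * t)) <= 1.
  have e1 : expR (- (a * t)) <= 1 by rewrite expR_le1 oppr_le0 mulr_ge0.
  by have e2 := expR_ge0 (- (a * t)); apply/andP; split; lra.
case/andP: u0 => u0 u1; apply/andP; split.
  by rewrite mulr_ge0 ?expR_ge0 ?exprn_ge0.
rewrite mulr_ile1 ?expR_ge0 ?exprn_ge0 ?exprn_ile1//.
by rewrite expR_le1 oppr_le0 mulr_ge0.
Qed.

Let psi_norm a lambda b t : 0 <= a -> 0 <= lambda -> 0 <= t -> `|psi a lambda b t| <= 1.
Proof. by move=> a0 l0 t0; have /andP[? ?] := psi01 b a0 l0 t0; rewrite ger0_norm. Qed.

Let Lpsi a lambda b n : 0 <= a -> 0 <= lambda -> L1 P (fun w => psi a lambda b (V n w)).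
Proof.
move=> a0 l0; apply: (@L1_bounded _ _ _ P 1); last by move=> w; exact: psi_norm.
exact: (measurableT_comp (@mpsi a lambda b) (mV n)).
Qed.

Let psi_cvg a b : 0 <= a -> forall lambda, 0 <= lambda ->
  mean P (fun w => psi a lambda b (V n w)) @[n --> \oo] --> chi2_mean k (psi a lambda b).
Proof.
move=> a0; elim: b => [|b IH] lambda l0.
  have E (t : R) : psi a lambda 0 t = expR (- (lambda * t)) by rewrite /psi expr0 mulr1.
  rewrite (funext E); apply: cvg_trans (laplaceV0 l0).
  by apply: near_eq_cvg; apply: nearW => n; congr mean; apply/funext => w.
have la : 0 <= lambda + a by exact: addr_ge0.
have E (t : R) : psi a lambda b.+1 t = (- 1) * psi a (lambda + a) b t + psi a lambda b t.
  rewrite /psi exprS (_ : - ((lambda + a) * t) = - (lambda * t) - a * t); last by ring.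
  by rewrite expRD; ring.
have -> : chi2_mean k (psi a lambda b.+1) =
    (- 1) * chi2_mean k (psi a (lambda + a) b) + chi2_mean k (psi a lambda b).
  rewrite (funext E) (@chi2_meanZD _ _ k0 _ _ _ 1 1)//; try exact: mpsi;
    by move=> t; exact: psi_norm.
rewrite (_ : (fun n => _) = fun n => (- 1) * mean P (fun w => psi a (lambda + a) b (V n w))
    + mean P (fun w => psi a lambda b (V n w))).
  by apply: cvgD; [apply: cvgMr; exact: IH|exact: IH].
apply/funext => n; rewrite -meanZ ?Lpsi// -meanD ?Lpsi//; last exact/L1Z/Lpsi.
by congr mean; apply/funext => w; rewrite E.
Qed.

(* [1 - psi] is a polynomial in [expR (- t)] approximating the indicator of
   [t <= (x + y) / 2]; [b] is chosen of the order of [expR (a (x + y) / 2)]. *)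
Let approx (x y e : R) : 0 <= x -> x < y -> 0 < e ->
  exists a b, [/\ 0 <= a, forall t, 0 <= t <= x -> psi a 0 b t <= e &
                  forall t, y <= t -> 1 - e <= psi a 0 b t].
Proof.
move=> x0 xy e0; pose m := (x + y) / 2; pose d := (y - x) / 2.
have d0 : 0 < d by rewrite divr_gt0// subr_gt0.
have m0 : 0 <= m by rewrite divr_ge0// addr_ge0// ltW// (le_lt_trans x0).
(* Chosen so that [a d = 2 / e], whence [exp(-a d) <= e / 2]. *)
pose a := 2 / (d * e); have a0 : 0 < a by rewrite divr_gt0// mulr_gt0.
pose b := (Num.truncn (expR (a * m))).+1.
have b1 : expR (a * m) <= b%:R by apply/ltW/truncnS_gt.
have b2 : b%:R <= 2 * expR (a * m).
  have e1 : 1 <= expR (a * m) by rewrite -expR0 ler_expR mulr_ge0// ltW.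
  have tr : (Num.truncn (expR (a * m)))%:R <= expR (a * m) by rewrite truncn_le expR_ge0.
  have -> : b%:R = (Num.truncn (expR (a * m)))%:R + 1 :> R by rewrite natr1.
  lra.
have small : expR (- (a * d)) <= e / 2.
  rewrite expRN -[leRHS]invrK lef_pV2 ?posrE ?invr_gt0 ?divr_gt0 ?expR_gt0//.
  apply: le_trans (expR_ge1Dx _); rewrite (_ : a * d = (e / 2)^-1) ?lerDr//.
  by rewrite /a; field; rewrite !lt0r_neq0.
exists a, b; split; first exact: ltW.
  move=> t /andP[t0 tx]; rewrite /psi mul0r oppr0 expR0 mul1r.
  (* With [v = exp(-a t)], [1 - v <= exp(-v)] bounds the power by [exp(-b v)], and [b v >= exp(a d)]
     for [t <= x = m - d]. *)
  apply: (@le_trans _ _ (expR (- expR (- (a * t))) ^+ b)).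
    apply: lerXn2r; rewrite ?nnegrE ?expR_ge0 ?subr_ge0//.
      by rewrite expR_le1 oppr_le0 mulr_ge0// ltW.
    exact: expR_ge1Dx.
  rewrite -expRM_natl; apply: (@le_trans _ _ (expR (- expR (a * d)))).
    rewrite ler_expR mulrN lerN2.
    apply: (@le_trans _ _ (expR (a * m) * expR (- (a * t)))).
      rewrite -expRD ler_expR -mulrBr ler_pM2l//.
      by rewrite /m /d; lra.
    by rewrite ler_wpM2r// expR_ge0.
  apply: (@le_trans _ _ (expR (- (a * d)))); last by apply: le_trans small _; lra.
  by rewrite ler_expR lerN2; apply: le_trans (expR_ge1Dx _); rewrite lerDr.
move=> t yt; rewrite /psi mul0r oppr0 expR0 mul1r.
have t0 : 0 <= t by apply: le_trans yt; apply: le_trans (ltW xy).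
have v0 : 0 <= expR (- (a * t)) <= 1.
  by rewrite expR_ge0 expR_le1 oppr_le0 mulr_ge0// ltW.
(* Bernoulli's inequality; for [t >= y = m + d] the loss [b exp(-a t)] is at most
   [2 exp(-a d) <= e]. *)
have bern (u : R) : 0 <= u <= 1 -> forall n : nat, 1 - n%:R * u <= (1 - u) ^+ n.
  move=> /andP[u0 u1]; elim=> [|n IH]; first by rewrite expr0 mul0r subr0.
  rewrite exprS; apply: (@le_trans _ _ ((1 - u) * (1 - n%:R * u))).
    by rewrite -natr1; have := mulr_ge0 (ler0n R n) (sqr_ge0 u); nra.
  by rewrite ler_wpM2l// subr_ge0.
apply: le_trans (bern _ v0 b); rewrite lerD2l lerN2.
apply: (@le_trans _ _ (2 * expR (a * m) * expR (- (a * t)))).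
  by rewrite ler_wpM2r// expR_ge0.
rewrite -mulrA -expRD.
apply: (@le_trans _ _ (2 * expR (- (a * d)))); last by lra.
rewrite ler_wpM2l// ler_expR -mulrBr -mulrN ler_pM2l//.
by rewrite /m /d; lra.
Qed.

Let mA n x : measurable [set w | V n w <= x].
Proof. exact: measurable_set_le. Qed.

Let mI x : measurable_fun setT (\1_[set t : R | t <= x] : R -> R).
Proof. by apply: measurable_indic; exact: measurable_set_le. Qed.

Let I1 x (t : R) : 0 <= t -> `|\1_[set t : R | t <= x] t| <= 1 :> R.
Proof. by move=> _; rewrite indicE; case: (_ \in _); rewrite ?normr1 ?normr0. Qed.

Let Pr_indic n x : Pr P [set w | V n w <= x] =
  mean P (fun w => \1_[set t : R | t <= x] (V n w)).
Proof.
by rewrite -mean_indic.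
Qed.

Let LI n x : L1 P (fun w => \1_[set t : R | t <= x] (V n w) : R).
Proof.
apply: (L1_bounded P (measurableT_comp (@mI x) (mV n))) => w.
exact: I1.
Qed.

(** Up to [e / 3], the function [1 - psi] lies between the indicators of [t <= x] and [t <= y]; only
    its mean has to converge. The gap between [x] and [y] is closed later by continuity of [F]. *)
Let compare x y e : 0 <= x -> x < y -> 0 < e ->
  \forall n \near \oo, Pr P [set w | V n w <= x] <= F y + e /\
                       F x - e <= Pr P [set w | V n w <= y].
Proof.
move=> x0 xy e0; have e3 : 0 < e / 3 by lra.
have [a [b [a0 psix psiy]]] := approx x0 xy e3.
have /cvgrPdist_le/(_ _ e3) := @psi_cvg a b a0 0 (lexx 0).
have chi01 z : chi2_cdf k z = chi2_mean k \1_[set t : R | t <= z] := chi2_cdfE k z.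
have lowx t : 0 <= t -> (\1_[set t : R | t <= x] t : R) <= (1 + e / 3) + - 1 * psi a 0 b t.
  move=> t0; have /andP[p0 p1] := psi01 b a0 (lexx 0) t0.
  rewrite indicE; case: (boolP (t \in _)) => [/set_mem /= tx|_] /=; last by lra.
  by have := psix t; rewrite t0 tx => /(_ isT); lra.
have uppy t : 0 <= t -> 1 + - 1 * psi a 0 b t <= (\1_[set t : R | t <= y] t : R) + e / 3.
  move=> t0; have /andP[p0 p1] := psi01 b a0 (lexx 0) t0.
  rewrite indicE; case: (boolP (t \in _)) => [_|/negP ty] /=; first by lra.
  have {}ty : y <= t by rewrite ltW// ltNge; apply/negP => h; apply: ty; exact/mem_set.
  by have := psiy t ty; lra.
have c1 (r : R) : chi2_mean k (fun t => - 1 * psi a 0 b t + r) =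
    - 1 * chi2_mean k (psi a 0 b) + r.
  rewrite (@chi2_meanZD _ _ k0 _ _ _ 1 `|r|) ?chi2_mean_cst//.
  by move=> t; exact: psi_norm.
have nI (r : R) t : 0 <= t -> `|- 1 * psi a 0 b t + r| <= 1 + `|r|.
  move=> t0; apply: le_trans (ler_normD _ _) _; rewrite lerD2r normrM normrN1 mul1r.
  exact: psi_norm.
have mpr (r : R) : measurable_fun setT (fun t => - 1 * psi a 0 b t + r).
  by apply: measurable_funD => //; exact: measurable_funM.
apply: filterS => n; rewrite ler_norml => /andP[m1 m2].
have LP := Lpsi b n a0 (lexx 0).
have LPr (r : R) : L1 P (fun w => - 1 * psi a 0 b (V n w) + r).
  by apply: L1D; [exact: L1Z|exact: L1_cst].
have EPr (r : R) : mean P (fun w => - 1 * psi a 0 b (V n w) + r) =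
    - 1 * mean P (fun w => psi a 0 b (V n w)) + r.
  by rewrite (meanD (L1Z _ LP) (L1_cst P r)) meanZ// mean_cst.
split.
  have h1 : Pr P [set w | V n w <= x] <= - 1 * mean P (fun w => psi a 0 b (V n w)) + (1 + e / 3).
    rewrite Pr_indic -EPr; apply: mean_le => // w.
    by rewrite addrC lowx.
  have h2 : - 1 * chi2_mean k (psi a 0 b) + (1 - e / 3) <= F y.
    rewrite /F chi01 -c1; apply: (@chi2_mean_le _ _ k0 _ _ (1 + `|1 - e / 3|) 1) => //.
    - exact: nI.
    - exact: I1.
    - by move=> t t0; have := uppy t t0; lra.
  lra.
have h1 : - 1 * mean P (fun w => psi a 0 b (V n w)) + (1 - e / 3) <= Pr P [set w | V n w <= y].
  rewrite Pr_indic -EPr; apply: mean_le => // w.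
  by have := uppy (V n w) (V0 n w); lra.
have h2 : F x <= - 1 * chi2_mean k (psi a 0 b) + (1 + e / 3).
  rewrite /F chi01 -c1; apply: (@chi2_mean_le _ _ k0 _ _ 1 (1 + `|1 + e / 3|)) => //.
  - exact: I1.
  - exact: nI.
  - by move=> t t0; rewrite addrC lowx.
lra.
Qed.

Theorem laplace_cdf_cvg x e : 0 <= x -> 0 < e ->
  \forall n \near \oo, `|Pr P [set w | V n w <= x] - F x| <= e.
Proof.
move=> x0 e0; have e2 : 0 < e / 2 by lra.
have [delta d0 Fd] := chi2_cdf_continuous k0 x0 e2.
have y1 : x < x + delta / 2 by rewrite ltrDl divr_gt0.
have Fy : F (x + delta / 2) <= F x + e / 2.
  have : `|F (x + delta / 2) - F x| <= e / 2.
    by apply: Fd; rewrite ?[x + _ - x]addrAC ?subrr ?add0r ?gtr0_norm ?divr_gt0//; lra.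
  by rewrite ler_norml => /andP[_]; lra.
have up : \forall n \near \oo, Pr P [set w | V n w <= x] <= F x + e.
  by apply: filterS (compare x0 y1 e2) => n [+ _]; lra.
have low : \forall n \near \oo, F x - e <= Pr P [set w | V n w <= x].
  have [xd|xd] := ltP (x - delta / 2) 0; last first.
    have y2 : x - delta / 2 < x by rewrite ltrBlDr ltrDl divr_gt0.
    have Fz : F x - e / 2 <= F (x - delta / 2).
      have : `|F (x - delta / 2) - F x| <= e / 2.
        by apply: Fd => //; rewrite [x - _ - x]addrAC subrr add0r normrN gtr0_norm ?divr_gt0//; lra.
      by rewrite ler_norml => /andP[+ _]; lra.
    by apply: filterS (compare xd y2 e2) => n [_]; lra.
  (* There is no room on the left when [x < delta / 2], but then [F x] is close to [F 0 = 0] and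
     nonnegativity of the probability suffices. *)
  have Fz : F x - F 0 <= e / 2.
    have : `|F 0 - F x| <= e / 2 by apply: Fd => //; rewrite sub0r normrN ger0_norm//; lra.
    by rewrite ler_norml => /andP[+ _]; lra.
  have F0 : F 0 = 0.
    rewrite /F /chi2_cdf set_itv1 integral_set1 /= ?mul0r//.
  by apply: nearW => n; have := Pr_ge0 P [set w | V n w <= x]; lra.
apply: filterS2 up low => n ? ?.
by rewrite ler_norml; apply/andP; split; lra.
Qed.

(** Markov's inequality for [1 - exp(-V / K)], which is at least [c] on [K < V]. Its mean tends to
    [1 - (1 + 2 / K)^(-k/2)], which is small for large [K]. *)
Theorem laplace_tight (e : R) : 0 < e ->
  exists2 K : R, 0 < K & \forall n \near \oo, Pr P [set w | K < V n w] <= e.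
Proof.
move=> e0; pose c : R := 1 - expR (-1).
have c0 : 0 < c by rewrite subr_gt0 expR_lt1; lra.
have ec : 0 < e * c / 2 by rewrite divr_gt0// mulr_gt0.
have lim0 : 1 + 2 * (n%:R^-1) @[n --> \oo] --> (1 + 2 * 0 : R).
  apply: cvgD; first exact: cvg_cst.
  apply: cvgMr; apply/gtr0_cvgV0; last exact: cvgr_idn.
  by exists 1%N => // m /= m0; rewrite ltr0n.
have cpow : {for (1 + 2 * 0 : R), continuous (@powR R ^~ (- (k%:R / 2)))}.
  apply: differentiable_continuous; apply/derivable1_diffP.
  by apply: derivable_powR; rewrite in_itv/= mulr0 addr0 ltr01.
have := cvg_comp _ _ lim0 cpow; rewrite mulr0 addr0 powR1 => lim1.
have /cvgrPdist_le/(_ _ ec) := lim1; move=> [N _ HN].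
have := HN N.+1 (leqnSn N); rewrite ler_norml => /andP[_ HN1].
exists N.+1%:R; first by rewrite ltr0n.
have l0 : 0 < N.+1%:R^-1 :> R by rewrite invr_gt0 ltr0n.
have /cvgrPdist_le/(_ _ ec) := laplaceV l0.
apply: filterS => n; rewrite ler_norml => /andP[_ HV].
have LE : L1 P (fun w => expR (- (N.+1%:R^-1 * V n w))).
  apply: (@L1_bounded _ _ _ P 1).
    by apply: measurableT_comp => //; apply: measurableT_comp => //; exact: measurable_funM.
  by move=> w; rewrite ger0_norm ?expR_ge0// expR_le1 oppr_le0 mulr_ge0.
have LD := L1B (L1_cst P 1) LE.
have E0 w : 0 <= 1 - expR (- (N.+1%:R^-1 * V n w)).
  by rewrite subr_ge0 expR_le1 oppr_le0 mulr_ge0// ltW.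
have : Pr P [set w | N.+1%:R < V n w] <=
    mean P (fun w => c^-1 * (1 - expR (- (N.+1%:R^-1 * V n w)))).
  apply: Pr_le_mean.
  - exact: measurable_set_gt.
  - exact: L1Z.
  - by move=> w; rewrite mulr_ge0// invr_ge0 ltW.
  - move=> w /= NV; rewrite ler_pdivlMl// mulr1 /c lerD2l lerN2 ler_expR lerN2.
    by rewrite ler_pdivlMl ?ltr0n// mulr1 ltW.
move=> h; apply: le_trans h _; rewrite (meanZ _ LD) (meanB (L1_cst P 1) LE) mean_cst.
rewrite ler_pdivrMl//; move: HN1 HV => /=.
set A := _ `^ _; set B := mean P _ => HN1 HV; lra.
Qed.

End LaplaceContinuity.

(** * Geometry of the empirical likelihood ratio *)

Section EmpiricalLikelihood.
Context {R : realType} {n d : nat}.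
Implicit Types (x : 'I_n -> 'rV[R]_d) (th : 'rV[R]_d) (w : 'I_n -> R).

Definition feasible x th w :=
  [/\ (forall i, 0 <= w i), \sum_i w i = 1 & \sum_i w i *: (x i - th) = 0].

Definition likelihood w : R := \prod_i (n%:R * w i).

Lemma likelihood_ge0 w : (forall i, 0 <= w i) -> 0 <= likelihood w.
Proof. by move=> w0; apply: prodr_ge0 => i _; rewrite mulr_ge0. Qed.

Lemma AMGM (a : 'I_n -> R) : (forall i, 0 <= a i) -> \sum_i a i = 1 ->
  \prod_i (n%:R * a i) <= 1.
Proof.
move=> a0 a1.
have [] := @leif_AGM R 'I_n predT (fun i => n%:R * a i).
  by move=> i _; rewrite mulr_ge0.
rewrite card_ord -mulr_sumr a1 mulr1 => + _; case: (posnP n) => [n0|n0].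
  by rewrite [in _ ^+ _]n0 expr0.
by rewrite divff ?expr1n// pnatr_eq0 -lt0n.
Qed.

Lemma likelihood_le1 x th w : feasible x th w -> likelihood w <= 1.
Proof. by move=> [w0 w1 _]; exact: AMGM. Qed.

Lemma EL_ratio_ge x th w : feasible x th w -> likelihood w <= EL_ratio x th.
Proof.
move=> fw; apply: ub_le_sup.
  exists 1 => _ [w' [w0 w1 wx ->]].
  by apply: (@likelihood_le1 x th); split.
by exists w; case: fw => ? ? ?; split.
Qed.

(** The condition [0 <= c] covers points without feasible weights, where the supremum of the empty
    set is 0. *)
Lemma EL_ratio_le x th c : 0 <= c ->
  (forall w, feasible x th w -> likelihood w <= c) -> EL_ratio x th <= c.
Proof.
move=> c0 H; rewrite /EL_ratio; set E := [set r | _].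
have [->|/set0P E0] := eqVneq E set0; first by rewrite sup0.
by apply: ge_sup => // _ [w [w0 w1 wx ->]]; apply: H; split.
Qed.

Lemma EL_ratio_ge0 x th : 0 <= EL_ratio x th.
Proof.
rewrite /EL_ratio; set E := [set r | _].
have [->|/set0P [r Er]] := eqVneq E set0; first by rewrite sup0.
have [w [w0 w1 wx rE]] := Er.
apply: (@le_trans _ _ (likelihood w)); first exact: likelihood_ge0.
by apply: EL_ratio_ge; split.
Qed.

Lemma EL_ratio_le1 x th : EL_ratio x th <= 1.
Proof. by apply: EL_ratio_le => // w; exact: likelihood_le1. Qed.

Lemma ell_ge0 x th : 0 <= ell x th.
Proof.
by rewrite /ell mulNr oppr_ge0 mulr_ge0_le0// ln_le0// EL_ratio_le1.
Qed.

(* Weak duality: AM-GM applied to [w i * (1 + l . (x i - th))], which sums to 1. *)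
Lemma EL_ratio_dual x th (l : 'rV[R]_d) :
  (forall i, 0 < 1 + (l *m (x i - th)^T) ord0 ord0) ->
  EL_ratio x th <= (\prod_i (1 + (l *m (x i - th)^T) ord0 ord0))^-1.
Proof.
move=> l0; have P0 : 0 < \prod_i (1 + (l *m (x i - th)^T) ord0 ord0).
  exact: prodr_gt0.
apply: EL_ratio_le => [|w [w0 w1 wx]]; first by rewrite invr_ge0 ltW.
rewrite -[leRHS]mul1r ler_pdivlMr// /likelihood -big_split /=.
rewrite (eq_bigr (fun i => n%:R * (w i * (1 + (l *m (x i - th)^T) ord0 ord0)))).
  apply: AMGM => [i|]; first by rewrite mulr_ge0// ltW.
  under eq_bigr do rewrite mulrDr mulr1.
  rewrite big_split /= w1 (_ : \sum_i _ = (l *m (\sum_i w i *: (x i - th))^T) ord0 ord0).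
    by rewrite wx trmx0 mulmx0 mxE addr0.
  rewrite raddf_sum /= mulmx_sumr summxE; apply: eq_bigr => i _.
  by rewrite linearZ /= -scalemxAr [RHS]mxE.
by move=> i _; rewrite mulrA.
Qed.

(* Vanishes exactly on the feasible weights of likelihood at least [c]. *)
Definition violation x th (c : R) (w : 'rV[R]_n) : R :=
  \sum_i Num.max 0 (- w ord0 i) + `|\sum_i w ord0 i - 1|
  + \sum_k `|\sum_i w ord0 i * (x i - th) ord0 k|
  + Num.max 0 (c - likelihood (fun i => w ord0 i)).

Lemma max0_ge0 (r : R) : 0 <= Num.max 0 r.
Proof. by rewrite le_max lexx. Qed.

Lemma violation_ge0 x th c (w : 'rV[R]_n) : 0 <= violation x th c w.
Proof.
rewrite /violation !addr_ge0 ?max0_ge0 ?normr_ge0 ?sumr_ge0//.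
by move=> i _; exact: max0_ge0.
Qed.

Lemma feasible_violation x th w c : feasible x th w -> c <= likelihood w ->
  violation x th c (\row_i w i) = 0.
Proof.
move=> [w0 w1 wx] cw; rewrite /violation.
rewrite big1 => [|i _]; last by rewrite mxE max_l// oppr_le0.
rewrite (eq_bigr w) => [|i _]; last by rewrite mxE.
rewrite w1 subrr normr0 !add0r big1 ?add0r => [|k _].
  rewrite max_l// subr_le0 (_ : (fun i => _) = w)//.
  by apply/funext => i; rewrite mxE.
apply/eqP; rewrite normr_eq0; apply/eqP.
transitivity ((\sum_i w i *: (x i - th)) ord0 k); last by rewrite wx mxE.
by rewrite summxE; apply: eq_bigr => i _; rewrite !mxE.
Qed.

Lemma violation_eq0 x th c (w : 'rV[R]_n) : violation x th c w = 0 ->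
  feasible x th (fun i => w ord0 i) /\ c <= likelihood (fun i => w ord0 i).
Proof.
rewrite /violation => v0.
have s1 : 0 <= \sum_i Num.max 0 (- w ord0 i).
  by apply: sumr_ge0 => i _; exact: max0_ge0.
have s3 : 0 <= \sum_k `|\sum_i w ord0 i * (x i - th) ord0 k| by exact: sumr_ge0.
have s4 := max0_ge0 (c - likelihood (fun i => w ord0 i)).
have s2 := normr_ge0 (\sum_i w ord0 i - 1).
have v1 : \sum_i Num.max 0 (- w ord0 i) = 0 by lra.
have v2 : `|\sum_i w ord0 i - 1| = 0 by lra.
have v3 : \sum_k `|\sum_i w ord0 i * (x i - th) ord0 k| = 0 by lra.
have v4 : Num.max 0 (c - likelihood (fun i => w ord0 i)) = 0 by lra.
have max0 (r : R) : Num.max 0 r = 0 -> r <= 0.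
  by move=> r0; rewrite -r0 le_max lexx orbT.
have w0 i : 0 <= w ord0 i.
  rewrite -oppr_le0; apply: max0; apply/eqP.
  move/eqP: v1; rewrite psumr_eq0 => [|j _]; last exact: max0_ge0.
  by move=> /allP/(_ i (mem_index_enum _)).
split; last by rewrite -subr_le0; apply: max0.
split => //; first by apply/eqP; rewrite -subr_eq0 -normr_eq0 v2.
apply/rowP => k; rewrite summxE [RHS]mxE.
move/eqP: v3; rewrite psumr_eq0// => /allP/(_ k (mem_index_enum _)).
rewrite /= normr_eq0 => /eqP {}v3; rewrite -[RHS]v3; apply: eq_bigr => i _.
by rewrite [LHS]mxE.
Qed.

(** All weights are at least -1 and their sum is at most 2, so each one is at most [2 + (n - 1)]. *)
Lemma violation_bounded x th c (w : 'rV[R]_n) : violation x th c w < 1 ->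
  forall i, w ord0 i \in `[-1, n%:R + 1]%R.
Proof.
rewrite /violation => v1.
have s1 : 0 <= \sum_i Num.max 0 (- w ord0 i).
  by apply: sumr_ge0 => i _; exact: max0_ge0.
have s3 : 0 <= \sum_k `|\sum_i w ord0 i * (x i - th) ord0 k| by exact: sumr_ge0.
have s4 := max0_ge0 (c - likelihood (fun i => w ord0 i)).
have s2 := normr_ge0 (\sum_i w ord0 i - 1).
have low i : -1 <= w ord0 i.
  have : Num.max 0 (- w ord0 i) <= \sum_i Num.max 0 (- w ord0 i).
    rewrite (bigD1 i)//= lerDl; apply: sumr_ge0 => j _; exact: max0_ge0.
  have : - w ord0 i <= Num.max 0 (- w ord0 i) by rewrite le_max lexx orbT.
  lra.
move=> i; rewrite in_itv/= low/=.
have : \sum_i w ord0 i <= 2.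
  have : `|\sum_i w ord0 i - 1| < 1 by lra.
  by rewrite ltr_norml => /andP[_]; lra.
rewrite (bigD1 i)//=.
have : \sum_(j | j != i) (-1 : R) <= \sum_(j | j != i) w ord0 j by exact: ler_sum.
rewrite sumr_const mulNrn.
have -> : #|(fun j : 'I_n => j != i)| = n.-1.
  by have := cardC1 i; rewrite card_ord => <-; apply: eq_card => j.
have : (n.-1%:R : R) + 1 = n%:R by rewrite natr1 prednK// (leq_ltn_trans _ (ltn_ord i)).
lra.
Qed.

Lemma continuous_bigprod (T : topologicalType) (I : Type) (s : seq I) (F : I -> T -> R) :
  (forall i, continuous (F i)) -> continuous (fun t => \prod_(i <- s) F i t).
Proof.
move=> cF; elim: s => [|i s IH].
  rewrite (_ : (fun t => _) = fun=> 1); first by move=> t; exact: cvg_cst.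
  by apply/funext => t; rewrite big_nil.
rewrite (_ : (fun t => _) = fun t => F i t * \prod_(i <- s) F i t).
  by move=> t; apply: cvgM; [exact: cF|exact: IH].
by apply/funext => t; rewrite big_cons.
Qed.

Lemma continuous_bigsum (T : topologicalType) (I : Type) (s : seq I) (F : I -> T -> R) :
  (forall i, continuous (F i)) -> continuous (fun t => \sum_(i <- s) F i t).
Proof.
move=> cF; elim: s => [|i s IH].
  rewrite (_ : (fun t => _) = fun=> 0); first by move=> t; exact: cvg_cst.
  by apply/funext => t; rewrite big_nil.
rewrite (_ : (fun t => _) = fun t => F i t + \sum_(i <- s) F i t).
  by move=> t; apply: cvgD; [exact: cF|exact: IH].
by apply/funext => t; rewrite big_cons.
Qed.

Lemma continuous_violation x th c : continuous (violation x th c).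
Proof.
have cw i : continuous (fun w : 'rV[R]_n => w ord0 i) by exact: coord_continuous.
have cmax (f : 'rV[R]_n -> R) : continuous f -> continuous (fun w : 'rV[R]_n => Num.max 0 (f w)).
  move=> cf v; have maxE (r : R) : Num.max 0 r = (r + `|r|) * 2^-1.
    by rewrite maxr_absE sub0r normrN add0r.
  rewrite (_ : (fun u : 'rV[R]_n => _) = fun u => (f u + `|f u|) * 2^-1).
    exact: (cvgM (cvgD (cf v) (cvg_norm (cf v))) (cvg_cst _)).
  by apply/funext => u; rewrite maxE.
have f1 : continuous (fun w : 'rV[R]_n => \sum_i Num.max 0 (- w ord0 i)).
  by apply: continuous_bigsum => i; apply: cmax => v; exact: (cvgN (cw i v)).
have f2 : continuous (fun w : 'rV[R]_n => `|\sum_i w ord0 i - 1|).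
  move=> v; have cs := @continuous_bigsum _ _ (index_enum 'I_n) _ cw.
  exact: (cvg_norm (cvgB (cs v) (cvg_cst (1 : R)))).
have f3 : continuous (fun w : 'rV[R]_n =>
    \sum_k `|\sum_i w ord0 i * (x i - th) ord0 k|).
  apply: continuous_bigsum => k v.
  have cs : continuous (fun w : 'rV[R]_n => \sum_i w ord0 i * (x i - th) ord0 k).
    apply: continuous_bigsum => i u; exact: (cvgM (cw i u) (cvg_cst _)).
  exact: (cvg_norm (cs v)).
have f4 : continuous (fun w : 'rV[R]_n => Num.max 0 (c - likelihood (fun i => w ord0 i))).
  apply: cmax => v.
  have cs : continuous (fun w : 'rV[R]_n => likelihood (fun i => w ord0 i)).
    apply: continuous_bigprod => i u; exact: (cvgM (cvg_cst _) (cw i u)).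
  exact: (cvgB (cvg_cst c) (cs v)).
move=> v; exact: (cvgD (cvgD (cvgD (f1 v) (f2 v)) (f3 v)) (f4 v)).
Qed.

(** Weights of violation below 1 lie in a compact box, so the minimum over the box is the global
    infimum, here 0. *)
Lemma violation_attained x th c :
  (forall e, 0 < e -> exists w : 'rV[R]_n, violation x th c w < e) ->
  exists2 w, feasible x th w & c <= likelihood w.
Proof.
move=> H; pose K := [set w : 'rV[R]_n | forall i, w ord0 i \in `[-1, n%:R + 1]%R].
have cK : compact K.
  exact: (@rV_compact R n (fun=> `[-1, n%:R + 1]%classic)
    (fun i => @segment_compact R (-1) (n%:R + 1))).
have K0 : K !=set0.
  by have [w w1] := H 1 ltr01; exists w; exact: violation_bounded w1.
have [w _ wmin] := EVT_min_rV K0 cK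
  (@continuous_subspaceT _ _ K _ (@continuous_violation x th c)).
suff v0 : violation x th c w = 0.
  by have [fw cw] := violation_eq0 v0; exists (fun i => w ord0 i).
apply/eqP; rewrite eq_le violation_ge0 andbT leNgt; apply/negP => v0.
have [] := H (Num.min 1 (violation x th c w)); first by rewrite lt_min ltr01.
move=> v.
rewrite lt_min => /andP[v1 vw].
have := wmin v; rewrite inE => /(_ (violation_bounded v1)).
by rewrite leNgt vw.
Qed.

Lemma EL_ratio_attained x th c : 0 < c -> c <= EL_ratio x th ->
  exists2 w, feasible x th w & c <= likelihood w.
Proof.
move=> c0 cE; apply: violation_attained => e e0.
have [w fw lw] : exists2 w, feasible x th w & EL_ratio x th - Num.min c e / 2 < likelihood w.
  apply: contrapT => H.
  have me : 0 < Num.min c e by rewrite lt_min c0 e0.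
  have mc : Num.min c e <= c by rewrite ge_min lexx.
  have : EL_ratio x th <= EL_ratio x th - Num.min c e / 2.
    apply: EL_ratio_le; first lra.
    by move=> w fw; rewrite leNgt; apply/negP => lw; apply: H; exists w.
  lra.
(* At the lowered level [c'] the weights [w] have violation 0; returning to level [c] costs at most
   [c - c' < e]. *)
pose c' := Num.min c (likelihood w).
exists (\row_i w i).
have v0 : violation x th c' (\row_i w i) = 0.
  by apply: feasible_violation => //; rewrite ge_min lexx orbT.
have : violation x th c (\row_i w i) <= violation x th c' (\row_i w i) + (c - c').
  have lE : likelihood (fun i => (\row_i w i : 'rV[R]_n) ord0 i) = likelihood w.
    by congr likelihood; apply/funext => i; rewrite mxE.
  have h1 : Num.max 0 (c - likelihood w) <= Num.max 0 (c' - likelihood w) + (c - c').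
    have h2 : c' - likelihood w <= Num.max 0 (c' - likelihood w) by rewrite le_max lexx orbT.
    have h3 : 0 <= c - c' by rewrite subr_ge0 ge_min lexx.
    by have h4 := max0_ge0 (c' - likelihood w); rewrite ge_max; apply/andP; split; lra.
  by rewrite /violation lE -[X in _ <= X]addrA lerD2l.
rewrite v0 add0r => /le_lt_trans; apply.
have : c - e < c'.
  have : Num.min c e <= e by rewrite ge_min lexx orbT.
  by rewrite /c' lt_min; move=> me; apply/andP; split; lra.
lra.
Qed.

End EmpiricalLikelihood.

(** * The sample covariance matrix and the interior of the hull *)

Section Scatter.
Context {R : realType} {n d : nat}.
Implicit Types (x : 'I_n -> 'rV[R]_d) (u v th : 'rV[R]_d).

Definition dot u v : R := (u *m v^T) ord0 ord0.

Lemma dotE u v : dot u v = \sum_k u ord0 k * v ord0 k.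
Proof. by rewrite /dot mxE; apply: eq_bigr => k _; rewrite [v^T _ _]mxE. Qed.
Lemma dotDr u v1 v2 : dot u (v1 + v2) = dot u v1 + dot u v2.
Proof. by rewrite /dot linearD /= mulmxDr mxE. Qed.
Lemma dotZl a u v : dot (a *: u) v = a * dot u v.
Proof. by rewrite /dot -scalemxAl mxE. Qed.
Lemma dotZr a u v : dot u (a *: v) = a * dot u v.
Proof. by rewrite /dot linearZ /= -scalemxAr mxE. Qed.
Lemma dotBr u v1 v2 : dot u (v1 - v2) = dot u v1 - dot u v2.
Proof. by rewrite dotDr -scaleN1r dotZr mulN1r. Qed.
Lemma dotC u v : dot u v = dot v u.
Proof. by rewrite !dotE; apply: eq_bigr => k _; rewrite mulrC. Qed.
Lemma dot_sumr (I : Type) (s : seq I) u (F : I -> 'rV[R]_d) :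
  dot u (\sum_(i <- s) F i) = \sum_(i <- s) dot u (F i).
Proof. by rewrite /dot raddf_sum /= mulmx_sumr summxE. Qed.
Lemma qf_dot (M : 'M[R]_d) u v : qf M u v = dot (u *m M) v.
Proof. by []. Qed.
Lemma dot_eq0 u : dot u u = 0 -> u = 0.
Proof.
rewrite dotE => /eqP; rewrite psumr_eq0 => [/allP u0|k _]; last by rewrite -expr2 sqr_ge0.
apply/rowP => k; rewrite mxE; apply/eqP.
by have := u0 k (mem_index_enum _); rewrite /= mulf_eq0 orbb.
Qed.

(** The empirical covariance. For [n > 0] it is invertible exactly when the convex hull has nonempty
    interior, by [pos_weights_interior] and [Theta_degenerate]. *)
Definition scatter x : 'M[R]_d :=
  n%:R^-1 *: \sum_i (x i - sample_mean x)^T *m (x i - sample_mean x).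

Lemma qf_scatter x u v : qf (scatter x) u v =
  n%:R^-1 * \sum_i dot u (x i - sample_mean x) * dot v (x i - sample_mean x).
Proof.
rewrite /qf /scatter -scalemxAr -scalemxAl [LHS]mxE mulmx_sumr mulmx_suml summxE.
congr (_ * _); apply: eq_bigr => i _.
rewrite (dotC v) /dot; set c := x i - _.
have -> : u *m (c^T *m c) *m v^T = (u *m c^T) *m (c *m v^T) by rewrite !mulmxA.
by rewrite mxE big_ord1.
Qed.

Lemma scatter_psd x u : 0 <= qf (scatter x) u u.
Proof.
rewrite qf_scatter mulr_ge0 ?invr_ge0// sumr_ge0// => i _.
by rewrite -expr2 sqr_ge0.
Qed.

Hypothesis n0 : (0 < n)%N.

Let nR : (0 : R) < n%:R. Proof. by rewrite ltr0n. Qed.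

Lemma sum_centered x : \sum_i (x i - sample_mean x) = 0.
Proof.
rewrite sumrB sumr_const card_ord /sample_mean -scaler_nat scalerA mulfV ?scale1r ?subrr//.
by rewrite gt_eqF.
Qed.

Lemma sum_wcentered x (w : 'I_n -> R) th : \sum_i w i = 1 ->
  \sum_i w i *: (x i - th) = \sum_i w i *: x i - th.
Proof.
move=> w1; under eq_bigr do rewrite scalerBr.
by rewrite sumrB -scaler_suml w1 scale1r.
Qed.

(** Signed weights of total mass 0 and barycentre [v]: adding them to a weight vector moves the
    represented point by [v]. *)
Definition tilt x v (i : 'I_n) : R :=
  n%:R^-1 * dot (v *m invmx (scatter x)) (x i - sample_mean x).

Lemma sum_tilt x v : \sum_i tilt x v i = 0.
Proof.
rewrite /tilt -mulr_sumr -dot_sumr sum_centered /dot trmx0 mulmx0 mxE mulr0//.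
Qed.

Lemma sum_tilt_scale x v : scatter x \in unitmx -> \sum_i tilt x v i *: x i = v.
Proof.
move=> Su; transitivity (\sum_i tilt x v i *: (x i - sample_mean x)).
  under [RHS]eq_bigr do rewrite scalerBr.
  by rewrite sumrB -scaler_suml sum_tilt scale0r subr0.
transitivity (v *m invmx (scatter x) *m scatter x); last by rewrite mulmxKV.
rewrite {2}/scatter -scalemxAr mulmx_sumr scaler_sumr; apply: eq_bigr => i _.
rewrite /tilt -scalerA; congr (_ *: _); rewrite mulmxA.
set u := _ *m invmx _; rewrite /dot; set e := u *m _.
by rewrite [e]mx11_scalar mul_scalar_mx mxE eqxx.
Qed.

Lemma EL_ratio_tilt x th (w : 'I_n -> R) v : scatter x \in unitmx ->
  \sum_i w i = 1 -> \sum_i w i *: x i = th ->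
  (forall i, 0 <= w i + tilt x v i) -> feasible x (th + v) (fun i => w i + tilt x v i).
Proof.
move=> Su w1 wx w0.
have s1 : \sum_i (w i + tilt x v i) = 1 by rewrite big_split/= sum_tilt addr0.
split => //; rewrite sum_wcentered//.
under eq_bigr do rewrite scalerDl.
by rewrite big_split/= wx sum_tilt_scale// subrr.
Qed.

Lemma continuous_dot_row (A : 'M[R]_d) (u : 'rV[R]_d) (th : 'rV[R]_d) :
  continuous (fun v : 'rV[R]_d => dot ((v - th) *m A) u).
Proof.
have E (v : 'rV[R]_d) : dot ((v - th) *m A) u =
    \sum_k (v ord0 k * (A *m u^T) k ord0) - dot (th *m A) u.
  rewrite /dot mulmxBl mulmxBl mxE -mulmxA mxE; congr (_ + _).
  by rewrite [LHS]mxE.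
rewrite (funext E) => v.
have cs : continuous (fun v : 'rV[R]_d => \sum_k (v ord0 k * (A *m u^T) k ord0)).
  apply: continuous_bigsum => k w.
  exact: (cvgM (@coord_continuous _ _ _ ord0 k w) (cvg_cst _)).
exact: (cvgB (cs v) (cvg_cst _)).
Qed.

(** Strictly positive weights stay positive under the tilt of any small enough vector, so all nearby
    points are in the hull. *)
Lemma pos_weights_interior x (w : 'I_n -> R) : scatter x \in unitmx ->
  (forall i, 0 < w i) -> \sum_i w i = 1 -> Theta x (\sum_i w i *: x i).
Proof.
move=> Su w0 w1; rewrite /Theta /interior /=; set th := \sum_i _.
have wt i : \forall v \near th, 0 < w i + tilt x (v - th) i.
  pose f (v : 'rV[R]_d) := w i + n%:R^-1 * dot ((v - th) *m invmx (scatter x))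
    (x i - sample_mean x).
  have cf : f v @[v --> th] --> w i + n%:R^-1 * dot ((th - th) *m invmx (scatter x))
    (x i - sample_mean x).
    have c1 := @continuous_dot_row (invmx (scatter x)) (x i - sample_mean x) th th.
    exact: (cvgD (cvg_cst _) (cvgM (cvg_cst _) c1)).
  apply: (cvgr_gt _ cf).
  by rewrite subrr mul0mx /dot mul0mx mxE mulr0 addr0.
apply: (filterS _ (filter_forall _ wt)) => v vw.
have fw := @EL_ratio_tilt x th w (v - th) Su w1 erefl (fun i => ltW (vw i)).
case: fw => f0 f1 fx; exists (fun i => w i + tilt x (v - th) i); split => //.
by move: fx; rewrite sum_wcentered// [th + _]addrC subrK => /eqP; rewrite subr_eq0 => /eqP.
Qed.

Lemma sample_meanE x : sample_mean x = \sum_(i < n) n%:R^-1 *: x i.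
Proof. by rewrite /sample_mean scaler_sumr. Qed.

Lemma sum_unif : \sum_(i < n) (n%:R^-1 : R) = 1.
Proof. by rewrite sumr_const card_ord -[LHS]mulr_natl mulfV// gt_eqF. Qed.

Lemma feasible_mean x : feasible x (sample_mean x) (fun=> n%:R^-1).
Proof.
split; first by move=> i; rewrite invr_ge0.
  exact: sum_unif.
by rewrite -scaler_sumr sum_centered scaler0.
Qed.

Lemma EL_ratio_mean x : EL_ratio x (sample_mean x) = 1.
Proof.
apply/eqP; rewrite eq_le EL_ratio_le1/=.
apply: le_trans (EL_ratio_ge (feasible_mean x)).
by rewrite /likelihood big1// => i _; rewrite mulfV// gt_eqF.
Qed.

(** The supremum is attained, and one vanishing weight would annihilate the product. *)
Lemma EL_ratio_gt0_weights x th : 0 < EL_ratio x th ->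
  exists w, [/\ feasible x th w, likelihood w = EL_ratio x th & forall i, 0 < w i].
Proof.
move=> E0; have [w fw Ew] := EL_ratio_attained E0 (lexx _).
exists w; split => //; first by apply/eqP; rewrite eq_le Ew EL_ratio_ge.
have [w0 _ _] := fw; move=> i; rewrite lt_neqAle w0 andbT eq_sym.
apply/eqP => wi; have : likelihood w = 0.
  by rewrite /likelihood (bigD1 i)//= wi mulr0 mul0r.
by move=> l0; move: Ew; rewrite l0 leNgt E0.
Qed.

Lemma EL_ratio_gt0_Theta x th : scatter x \in unitmx -> 0 < EL_ratio x th -> Theta x th.
Proof.
move=> Su /EL_ratio_gt0_weights[w [[w0 w1 wx] _ wp]].
rewrite (_ : th = \sum_i w i *: x i); first exact: pos_weights_interior.
by move: wx; rewrite sum_wcentered// => /eqP; rewrite subr_eq0 => /eqP.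
Qed.

Lemma Theta_line x th v : Theta x th -> exists2 t, 0 < t & conv_hull x (th + t *: v).
Proof.
rewrite /Theta /interior /= => th_in.
have ct : (th + t *: v) @[t --> (0:R)] --> th.
  rewrite -[X in _ --> X](_ : th + (0 : R) *: v = th); last by rewrite scale0r addr0.
  by exact: (cvgD (cvg_cst _) (cvgZ cvg_id (cvg_cst _))).
have /nbhs_ballP[e /= e0 He] := ct _ th_in.
exists (e / 2); first by rewrite divr_gt0.
by apply: He; rewrite /ball /= sub0r normrN gtr0_norm ?divr_gt0//; lra.
Qed.

Lemma Theta_EL_ratio_gt0 x th : Theta x th -> 0 < EL_ratio x th.
Proof.
move=> /(@Theta_line x th (th - sample_mean x))[t t0 [w [w0 w1 wx]]].
have t1 : 0 < 1 + t by lra.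
(* The point of the hull slightly beyond [th], seen from the mean, is mixed with the uniform
   weights: the mixture represents [th] and has no zero weight. *)
pose w' i := (1 + t)^-1 * (w i + t * n%:R^-1).
have w'0 i : 0 < w' i.
  by rewrite mulr_gt0 ?invr_gt0// ltr_wpDl// mulr_gt0// invr_gt0.
have w'1 : \sum_i w' i = 1.
  by rewrite -mulr_sumr big_split/= w1 -mulr_sumr sum_unif mulr1 mulVf// gt_eqF.
have fw : feasible x th w'.
  split => //; first by move=> i; exact: ltW.
  rewrite sum_wcentered//; apply/eqP; rewrite subr_eq0; apply/eqP.
  under eq_bigr do rewrite -scalerA scalerDl -scalerA.
  rewrite -scaler_sumr big_split/= -wx -scaler_sumr -sample_meanE.
  rewrite scalerBr addrA subrK -{1}[th]scale1r -scalerDl scalerA mulVf ?scale1r//.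
  by rewrite gt_eqF.
apply: lt_le_trans (EL_ratio_ge fw).
by apply: prodr_gt0 => i _; rewrite mulr_gt0.
Qed.

(** A null vector [u] of the covariance is constant on the sample, hence on the hull, whereas an
    interior point can be moved in the direction [u]. *)
Lemma Theta_degenerate x : scatter x \notin unitmx -> Theta x = set0.
Proof.
move=> Su; apply/seteqP; split => // th th_in.
have [u u0 uS] : exists2 u : 'rV[R]_d, u != 0 & u *m scatter x = 0.
  move: Su; rewrite -row_free_unit -kermx_eq0 => /rowV0Pn[u uk u0].
  by exists u => //; apply/sub_kermxP.
have ux i : dot u (x i) = dot u (sample_mean x).
  have q0 : \sum_i dot u (x i - sample_mean x) * dot u (x i - sample_mean x) = 0.
    have : qf (scatter x) u u = 0 by rewrite /qf uS mul0mx mxE.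
    rewrite qf_scatter => /eqP; rewrite mulf_eq0 invr_eq0 gt_eqF//=.
    by move/eqP.
  move/eqP: q0; rewrite psumr_eq0 => [/allP/(_ i (mem_index_enum _))|j _]; last first.
    by rewrite -expr2 sqr_ge0.
  by rewrite /= mulf_eq0 orbb dotBr subr_eq0 => /eqP.
have hull v : conv_hull x v -> dot u v = dot u (sample_mean x).
  move=> [w [w0 w1 ->]]; rewrite dot_sumr.
  under eq_bigr do rewrite dotZr ux.
  by rewrite -mulr_suml w1 mul1r.
have [t t0 ht] := Theta_line u th_in.
have := hull _ ht; rewrite dotDr dotZr (hull th); last exact: interior_subset th_in.
move=> h; have /eqP : t * dot u u = 0 by lra.
rewrite mulf_eq0 (gt_eqF t0) /= => /eqP /dot_eq0 /eqP.
by rewrite (negbTE u0).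
Qed.

End Scatter.

(** * The likelihood ratio along rays from the sample mean *)

Section Ray.
Context {R : realType} {n d : nat}.
Variables (x : 'I_n -> 'rV[R]_d) (th0 : 'rV[R]_d).
Hypothesis n0 : (0 < n)%N.

Let m := sample_mean x.
Let D := th0 - m.
Let ray (s : R) := m + s *: D.
Let f (s : R) := EL_ratio x (ray s).

Let nR : (0 : R) < n%:R. Proof. by rewrite ltr0n. Qed.

Let f_0 : f 0 = 1.
Proof. by rewrite /f /ray scale0r addr0 EL_ratio_mean. Qed.

(** Convexity between 0 and [u]: the tangent inequalities at [t * u] are averaged with weights
    [1 - t] and [t]. *)
Lemma expR_chord (t u : R) : 0 <= t <= 1 -> expR (t * u) <= (1 - t) + t * expR u.
Proof.
move=> /andP[t0 t1]; set z := t * u.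
have e1 : expR z * (1 - z) <= 1.
  have := expR_ge1Dx (- z); rewrite expRN -[X in _ <= X -> _]mul1r ler_pdivlMr ?expR_gt0//.
  by rewrite mulrC.
have e2 : expR z * (1 + u - z) <= expR u.
  have := expR_ge1Dx (u - z); rewrite expRB ler_pdivlMr ?expR_gt0//.
  by rewrite mulrC addrA.
have h1 : (1 - t) * (expR z * (1 - z)) <= (1 - t) * 1 by rewrite ler_wpM2l// subr_ge0.
have h2 : t * (expR z * (1 + u - z)) <= t * expR u by rewrite ler_wpM2l.
have h3 : (1 - t) * (expR z * (1 - z)) + t * (expR z * (1 + u - z)) = expR z.
  by rewrite /z; ring.
lra.
Qed.

(* The likelihood is log-concave in the weights and maximal at the mean. *)
Lemma EL_ratio_ray_decreasing (s s' : R) : 0 <= s -> s <= s' -> f s' <= f s.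
Proof.
move=> s0 ss'; have [Es'|Es'] := leP (f s') 0.
  by apply: le_trans Es' _; exact: EL_ratio_ge0.
have [s'0|s'0] := leP s' 0.
  by rewrite (_ : s = s')//; apply/eqP; rewrite eq_le ss' (le_trans s'0).
have [w [[w0 w1 wx] wE wp]] := EL_ratio_gt0_weights Es'.
rewrite {1}/f -wE.
pose t := s / s'; have t01 : 0 <= t <= 1.
  by rewrite divr_ge0 ?(ltW s'0)//= ler_pdivrMr// mul1r.
have /andP[t0 t1] := t01.
have ts : t * s' = s by rewrite /t divfK// gt_eqF.
(* Mixing with the uniform weights, which represent the mean, moves the point from parameter [s']
   down to [t s' = s]. *)
pose w' i := (1 - t) * n%:R^-1 + t * w i.
have w'1 : \sum_i w' i = 1.
  by rewrite big_split/= -!mulr_sumr w1 sum_unif// !mulr1 subrK.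
have fw : feasible x (ray s) w'.
  split => //; first by move=> i; apply: addr_ge0; apply: mulr_ge0; rewrite ?subr_ge0 ?invr_ge0.
  rewrite sum_wcentered//; apply/eqP; rewrite subr_eq0; apply/eqP.
  under eq_bigr do rewrite scalerDl -!scalerA.
  rewrite big_split/= -!scaler_sumr -/m.
  have -> : n%:R^-1 *: \sum_i x i = m by [].
  have -> : \sum_i w i *: x i = ray s'.
    by apply/eqP; rewrite -subr_eq0 -sum_wcentered// wx.
  rewrite [s *: (_ *: _)]scalerA -/t /ray scalerDr [t *: (s' *: D)]scalerA ts addrA -scalerDl.
  by rewrite subrK scale1r.
apply: le_trans (EL_ratio_ge fw).
have lw : likelihood w = expR (\sum_i ln (n%:R * w i)).
  rewrite expR_sum; apply: eq_bigr => i _.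
  by rewrite lnK// posrE mulr_gt0.
have S0 : \sum_i ln (n%:R * w i) <= 0.
  have := @likelihood_le1 _ _ _ x (ray s') w; rewrite lw expR_le1; apply.
  by split.
(* The sum of logarithms is nonpositive, so multiplying it by [t <= 1] increases it; the chord bound
   then applies factor by factor. *)
apply: (@le_trans _ _ (expR (t * \sum_i ln (n%:R * w i)))).
  by rewrite lw ler_expR; nra.
rewrite mulr_sumr expR_sum; apply: ler_prod => i _; rewrite expR_ge0/=.
apply: le_trans (expR_chord _ t01) _; rewrite lnK ?posrE ?mulr_gt0//.
by rewrite le_eqVlt; apply/orP; left; apply/eqP; rewrite /w'; field; exact: lt0r_neq0.
Qed.

(** Weights of likelihood at least [c] at a nearby [s'] violate the constraint at [s] by at most
    [|s - s'| * B]; compactness then yields such weights at [s] itself. *)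
Let usc (s c : R) : 0 < c -> f s < c -> \forall s' \near s, f s' < c.
Proof.
move=> c0 fs; apply: contrapT => H.
suff : c <= f s by rewrite leNgt fs.
have [w fw lw] : exists2 w, feasible x (ray s) w & c <= likelihood w.
  apply: violation_attained => e e0.
  pose B := \sum_k `|D ord0 k|; have B0 : 0 <= B by exact: sumr_ge0.
  have B1 : 0 < B + 1 by lra.
  apply: contrapT => He; apply: H; apply/nbhs_ballP; exists (e / (B + 1)) => /=.
    exact: divr_gt0.
  move=> s'; rewrite /ball /= => ss'; rewrite ltNge; apply/negP => cf.
  have [w fw lw] := EL_ratio_attained c0 cf; apply: He.
  exists (\row_i w i).
  apply: (@le_lt_trans _ _ (violation x (ray s') c (\row_i w i) + `|s - s'| * B)).
    rewrite /violation.
    have h : \sum_k `|\sum_i (\row_i w i : 'rV_n) ord0 i * (x i - ray s) ord0 k| <=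
      \sum_k `|\sum_i (\row_i w i : 'rV_n) ord0 i * (x i - ray s') ord0 k| + `|s - s'| * B.
      rewrite mulr_sumr -big_split/=; apply: ler_sum => k _.
      rewrite (distrC s) -normrM; apply: le_trans (ler_normD _ _).
      rewrite le_eqVlt; apply/orP; left; apply/eqP; congr `|_|.
      rewrite (eq_bigr (fun i => w i * (x i - ray s') ord0 k + w i * ((s' - s) * D ord0 k))).
        have [_ w1 _] := fw; rewrite big_split/= -mulr_suml w1 mul1r; congr (_ + _).
        by apply: eq_bigr => i _; rewrite [(\row_i w i) _ _]mxE.
      by move=> i _; rewrite [(\row_i w i) _ _]mxE /ray !mxE; ring.
    lra.
  rewrite (feasible_violation fw lw) add0r.
  apply: (@le_lt_trans _ _ (`|s - s'| * (B + 1))); first by rewrite ler_wpM2l// lerDl.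
  by rewrite -ltr_pdivlMr.
exact: le_trans lw (EL_ratio_ge fw).
Qed.

Hypothesis Su : scatter x \in unitmx.

(** Tilting the positive optimal weights at [s] gives feasible weights at every nearby [s'], with
    continuously varying likelihood. *)
Let lsc (s c : R) : c < f s -> \forall s' \near s, c < f s'.
Proof.
move=> cf; have [c0|c0] := ltP c 0.
  by apply: filterE => s'; apply: lt_le_trans c0 _; exact: EL_ratio_ge0.
have fs := le_lt_trans c0 cf.
have [w [[w0 w1 wx] wE wp]] := EL_ratio_gt0_weights fs.
have wx' : \sum_i w i *: x i = ray s.
  by apply/eqP; rewrite -subr_eq0 -sum_wcentered// wx.
pose g s' i := w i + (s' - s) * tilt x D i.
have cg i : g s' i @[s' --> s] --> w i + (s - s) * tilt x D i.
  exact: (cvgD (cvg_cst _) (cvgM (cvgB cvg_id (cvg_cst _)) (cvg_cst _))).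
have gs i : w i + (s - s) * tilt x D i = w i by rewrite subrr mul0r addr0.
have pos' i : \forall s' \near s, 0 < g s' i.
  by have := cvgr_gt _ (cg i); rewrite gs; apply.
have pos : \forall s' \near s, forall i, 0 < g s' i.
  exact: (filter_forall _ pos').
have cl : likelihood (g s') @[s' --> s] --> likelihood (g s).
  apply: (@continuous_bigprod _ _ _ (index_enum 'I_n) (fun i s' => n%:R * g s' i)) => i u.
  apply: cvgM; first exact: cvg_cst.
  exact: (cvgD (cvg_cst _) (cvgM (cvgB cvg_id (cvg_cst _)) (cvg_cst _))).
have lE : likelihood (g s) = f s.
  by rewrite /f -wE; congr likelihood; apply/funext => i; rewrite /g gs.
have lpos : \forall s' \near s, c < likelihood (g s').
  by have := cvgr_gt _ cl; rewrite lE; apply.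
apply: filterS2 pos lpos => s' gp gc; apply: lt_le_trans gc _.
have tE i : (s' - s) * tilt x D i = tilt x ((s' - s) *: D) i.
  by rewrite /tilt -scalemxAl dotZl mulrCA.
have fw : feasible x (ray s') (g s').
  rewrite (_ : ray s' = ray s + (s' - s) *: D); last first.
    by rewrite /ray -addrA -scalerDl [s + _]addrC subrK.
  rewrite /g; under eq_fun do rewrite tE.
  apply: EL_ratio_tilt => // i; rewrite -tE; exact: ltW (gp i).
exact: EL_ratio_ge.
Qed.

Lemma continuous_EL_ray : continuous f.
Proof.
move=> s; apply/cvgrPdist_lt => e e0.
have u : \forall s' \near s, f s' < f s + e.
  by apply: usc; [apply: ltr_wpDl => //; exact: EL_ratio_ge0|rewrite ltrDl].
have l : \forall s' \near s, f s - e < f s' by apply: lsc; rewrite ltrBlDr ltrDl.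
by apply: filterS2 u l => s' ? ?; rewrite ltr_norml; apply/andP; split; lra.
Qed.

(* On the ray the equation [hC eta = th0] reads [s (1 + l / 2 n) = 1], that is
   [f s = exp (n (1 - 1 / s))]; the right side goes from 0 to 1. *)
Lemma hC_root : exists2 s : R, 0 < s <= 1 & f s = expR (n%:R * (1 - s^-1)).
Proof.
have : \forall s \near (0 : R), 1 / 2 < f s.
  by apply: lsc; rewrite f_0; lra.
move=> /nbhs_ballP[e /= e0 He].
(* With [s0 <= 1/3] and [n >= 1] the right side is at most [exp(-2) <= 1/3], below the value of
   [f]. *)
pose s0 : R := Num.min (e / 2) (1 / 3).
have s00 : 0 < s0 by rewrite lt_min divr_gt0//=; lra.
have s0e : s0 <= e / 2 by rewrite ge_min lexx.
have s03 : s0 <= 1 / 3 by rewrite ge_min lexx orbT.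
have fs0 : 1 / 2 < f s0.
  by apply: He; rewrite /ball /= sub0r normrN gtr0_norm//; lra.
pose g s := f s - expR (n%:R * (1 - s^-1)).
have gs0 : 0 <= g s0.
  rewrite subr_ge0; apply: le_trans (ltW fs0).
  have n1 : (1 : R) <= n%:R by rewrite ler1n.
  have i3 : 3 <= s0^-1 by rewrite -[leLHS]invrK lef_pV2 ?posrE//; lra.
  apply: (@le_trans _ _ (expR (- 2))); first by rewrite ler_expR; nra.
  have e3 : 3 <= expR 2 :> R by apply: le_trans (expR_ge1Dx _); lra.
  have : (expR 2)^-1 <= 3^-1 :> R by rewrite lef_pV2 ?posrE ?expR_gt0.
  by rewrite expRN; lra.
have g1 : g 1 <= 0.
  by rewrite /g invr1 subrr mulr0 expR0 subr_le0 EL_ratio_le1.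
have cg : {within `[s0, 1], continuous g}.
  apply: continuous_in_subspaceT => s; rewrite inE /= in_itv/= => /andP[ss _].
  have s_neq0 : s != 0 by rewrite gt_eqF// (lt_le_trans s00).
  have c1 : (expR (n%:R * (1 - u^-1))) @[u --> s] --> expR (n%:R * (1 - s^-1)).
    apply: continuous_cvg; first exact: continuous_expR.
    exact: (cvgM (cvg_cst _) (cvgB (cvg_cst _) (cvgV s_neq0 cvg_id))).
  have c2 : f u @[u --> s] --> f s by exact: continuous_EL_ray.
  exact: (cvgB c2 c1).
have s01 : s0 <= 1 by lra.
have [|s] := IVT s01 cg (v := 0).
  by rewrite ge_min le_max g1 gs0 /= orbT.
rewrite in_itv/= => /andP[ss s1] /eqP; rewrite subr_eq0 => /eqP fE.
by exists s; rewrite ?fE// s1 (lt_le_trans s00).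
Qed.

(** The root of [hC_root] is a witness, so [hC_inv] returns a genuine preimage and not its default
    value. *)
Lemma hC_invP : Theta x (hC_inv x th0) /\ hC x (hC_inv x th0) = th0.
Proof.
have [s /andP[s0 s1] fE] := hC_root.
have fs : 0 < f s by rewrite fE expR_gt0.
apply: (@xgetPex _ 0 [set eta | Theta x eta /\ hC x eta = th0]); exists (ray s).
split; first exact: EL_ratio_gt0_Theta.
rewrite /hC -/m /ell -/(f s) fE expRK /ray [m + _ - m]addrC addKr scalerA.
rewrite (_ : _ * s = 1) ?scale1r; last by field; rewrite !gt_eqF.
by rewrite /D addrC subrK.
Qed.

(** [hC] stretches from the mean by a positive factor, so every preimage lies on the ray; in
    particular the chosen one does. *)
Let inv_ray : let eta := hC_inv x th0 in
  let s := (1 + ell x eta / (2 * n%:R))^-1 in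
  [/\ 0 < s, s <= 1, eta = ray s, 0 < f s & ell x eta = - 2 * ln (f s)].
Proof.
move=> eta s; have [Te hE] := hC_invP.
have l0 : 0 <= ell x eta / (2 * n%:R) by apply: divr_ge0; [exact: ell_ge0|exact: mulr_ge0].
have l1 : 0 < 1 + ell x eta / (2 * n%:R) by lra.
have eE : eta = ray s.
  have hD : D = (1 + ell x eta / (2 * n%:R)) *: (eta - m).
    by rewrite /D -{1}hE /hC -/m -/eta [m + _ - m]addrC addKr.
  by rewrite /ray hD scalerA /s mulVf ?gt_eqF// scale1r addrC subrK.
split => //.
- by rewrite invr_gt0.
- by rewrite invf_le1//; lra.
- by rewrite /f -eE Theta_EL_ratio_gt0.
- by rewrite /f -eE.
Qed.

(** The parameter [s] decreases in the value [l], and [f] decreases in [s]; so comparing [l] with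
    [c] amounts to comparing [f] at the parameter of [c] with [exp(-c/2)]. *)
Lemma ell_star_le (c : R) : 0 <= c ->
  (ell_star x th0 <= c) =
  (expR (- (c / 2)) <= EL_ratio x (m + (1 + c / (2 * n%:R))^-1 *: (th0 - m))).
Proof.
move=> c0; have [s0 s1 eE fs lE] := inv_ray.
set s := (1 + ell x _ / _)^-1 in s0 s1 eE fs lE.
rewrite /ell_star -/D -/(ray _) -/(f _).
have l0 := ell_ge0 x (hC_inv x th0).
set l := ell x (hC_inv x th0) in l0 s s0 s1 eE fs lE *.
set sc := (1 + c / (2 * n%:R))^-1.
have n2 : 0 < 2 * n%:R :> R by rewrite mulr_gt0.
have lc (a b : R) : 0 <= a -> 0 <= b ->
    ((1 + b / (2 * n%:R))^-1 <= (1 + a / (2 * n%:R))^-1) = (a <= b).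
  move=> a0 b0; rewrite lef_pV2 ?posrE ?ltr_pwDl// ?divr_ge0 ?(ltW n2)//.
  by rewrite lerD2l ler_pM2r ?invr_gt0.
have sc0 : 0 < sc by rewrite invr_gt0 ltr_pwDl// divr_ge0// ltW.
have lle : (l <= c) = (expR (- (c / 2)) <= f s).
  have fE : f s = expR (ln (f s)) by rewrite lnK// posrE.
  by rewrite [in RHS]fE ler_expR lE; apply/idP/idP; lra.
have [lc'|lc'] := leP l c.
  have scs : sc <= s by rewrite /s /sc lc.
  apply/esym; apply: le_trans (EL_ratio_ray_decreasing (ltW sc0) scs).
  by rewrite -lle.
apply/esym/negbTE; rewrite -ltNge.
have sle : s <= sc by rewrite /s /sc lc// ltW.
apply: le_lt_trans (EL_ratio_ray_decreasing (ltW s0) sle) _.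
by rewrite ltNge -lle -ltNge.
Qed.

End Ray.

(* The interior of the hull is then empty, so that [hC_inv] takes the default value 0. *)
Lemma ell_star_degenerate {R : realType} {n d : nat} (x : 'I_n -> 'rV[R]_d)
    (th0 : 'rV[R]_d) : (0 < n)%N -> scatter x \notin unitmx ->
  ell_star x th0 = ell x 0.
Proof.
move=> n0 Su; rewrite /ell_star /hC_inv Theta_degenerate//.
by rewrite xgetPN// => eta [].
Qed.

(** * Measurability *)

Section Measurability.
Context {dsp : measure_display} {T : measurableType dsp} {R : realType} {n d : nat}.

Let V (xs : T -> 'I_n -> 'rV[R]_d) (th : T -> 'rV[R]_d) (c : R) (q : 'rV[rat]_n) (w : T) : R :=
  violation (xs w) (th w) c (map_mx ratr q).

Lemma rational_violation (x : 'I_n -> 'rV[R]_d) (th : 'rV[R]_d) (c : R) (w : 'rV[R]_n) (e : R) :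
  violation x th c w < e -> exists q : 'rV[rat]_n, violation x th c (map_mx ratr q) < e.
Proof.
move=> we; have := @continuous_violation R n d x th c w.
move=> /cvgrPdist_lt /(_ (e - violation x th c w)); rewrite subr_gt0 => /(_ we).
move=> /nbhs_ballP[delta /= delta0 Hd].
have qE i : exists q : rat, `|w ord0 i - ratr q| < delta.
  have lt1 : w ord0 i - delta < w ord0 i + delta by lra.
  have [q] := rat_in_itvoo lt1; rewrite in_itv/= => /andP[q1 q2].
  by exists q; rewrite ltr_norml; apply/andP; split; lra.
have [q qP] := choice qE.
exists (\row_i q i).
have := Hd (map_mx ratr (\row_i q i)) _; rewrite distrC => H.
have := H _; rewrite ltr_norml => {}H.
have /andP[_] : - (e - violation x th c w) <
   violation x th c (map_mx ratr (\row_i q i)) - violation x th c w < e - violation x th c w.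
  apply: H; split => // i j; rewrite (ord1 i) /ball /= !mxE; exact: qP.
lra.
Qed.

(* By compactness the bound is attained as soon as [violation] has infimum 0, and
   by continuity the infimum may be taken over the countably many rational weights. *)
Lemma measurable_EL_ratio_ge (xs : T -> 'I_n -> 'rV[R]_d) (th : T -> 'rV[R]_d) (c : R) :
  (forall i k, measurable_fun setT (fun w => xs w i ord0 k)) ->
  (forall k, measurable_fun setT (fun w => th w ord0 k)) -> 0 < c ->
  measurable [set w | c <= EL_ratio (xs w) (th w)].
Proof.
move=> mxs mth c0.
have mV q : measurable_fun setT (V xs th c q).
  rewrite /V /violation.
  do 2 apply: measurable_funD => //.
  apply: measurable_sum => k; apply: measurableT_comp => //.
  apply: measurable_sum => i; apply: measurable_funM => //.
  rewrite (_ : (fun w => _) = fun w => xs w i ord0 k - th w ord0 k).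
    exact: measurable_funB.
  by apply/funext => w; rewrite !mxE.
rewrite (_ : [set w | _] = \bigcap_(j : nat) \bigcup_(q : 'rV[rat]_n)
    [set w | V xs th c q w < j.+1%:R^-1]).
  apply: bigcapT_measurable => j.
  rewrite (_ : \bigcup_q _ = \bigcup_(k : nat)
      (if unpickle k is Some q then [set w | V xs th c q w < j.+1%:R^-1] else set0)).
    apply: bigcupT_measurable => k; case: unpickle => [q|]; last exact: measurable0.
    exact: measurable_set_lt.
  apply/seteqP; split => w [] => [q _ Vq|k _].
    by exists (pickle q) => //; rewrite pickleK.
  by case: unpickle => // q Vq; exists q.
apply/seteqP; split => w /= => [cE j _|H].
  have [u fu cu] := EL_ratio_attained c0 cE.
  have [q qj] := @rational_violation (xs w) (th w) c (\row_i u i) j.+1%:R^-1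
    (ltac:(by rewrite (feasible_violation fu cu) invr_gt0)).
  by exists q.
have [u fu cu] : exists2 u, feasible (xs w) (th w) u & c <= likelihood u.
  apply: violation_attained => e e0.
  have [q _ /= Vq] := H (Num.truncn e^-1) Logic.I.
  exists (map_mx ratr q); apply: lt_trans Vq _.
  rewrite -[ltRHS]invrK ltf_pV2 ?posrE ?invr_gt0//; exact: truncnS_gt.
exact: le_trans cu (EL_ratio_ge fu).
Qed.

(* Where [EL_ratio] is 0 (no feasible weights), [ell] is 0 because [ln 0 = 0]. *)
Lemma measurable_ell_le (xs : T -> 'I_n -> 'rV[R]_d) (th : T -> 'rV[R]_d) (c : R) :
  (forall i k, measurable_fun setT (fun w => xs w i ord0 k)) ->
  (forall k, measurable_fun setT (fun w => th w ord0 k)) -> 0 <= c ->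
  measurable [set w | ell (xs w) (th w) <= c].
Proof.
move=> mxs mth c0.
rewrite (_ : [set w | _] = ~` (\bigcup_(j : nat) [set w | j.+1%:R^-1 <= EL_ratio (xs w) (th w)])
   `|` [set w | expR (- (c / 2)) <= EL_ratio (xs w) (th w)]).
  apply: measurableU.
    apply: measurableC; apply: bigcupT_measurable => j.
    by apply: measurable_EL_ratio_ge => //; rewrite invr_gt0.
  by apply: measurable_EL_ratio_ge => //; exact: expR_gt0.
have pos w : 0 < EL_ratio (xs w) (th w) ->
    (ell (xs w) (th w) <= c) = (expR (- (c / 2)) <= EL_ratio (xs w) (th w)).
  move=> E0; rewrite -[in RHS](@lnK _ (EL_ratio _ _)) ?posrE// ler_expR /ell.
  by apply/idP/idP; lra.
apply/seteqP; split => w /= => [le|].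
  have [E0|E0] := ltP 0 (EL_ratio (xs w) (th w)); first by right; rewrite -pos.
  left => -[j _ /=]; apply/negP; rewrite -ltNge; apply: le_lt_trans E0 _.
  by rewrite invr_gt0.
have [E0|E0] := ltP 0 (EL_ratio (xs w) (th w)).
  case=> [H|]; last by rewrite pos.
  exfalso; apply: H; exists (Num.truncn (EL_ratio (xs w) (th w))^-1) => //=.
  rewrite -[leRHS]invrK lef_pV2 ?posrE ?invr_gt0//; apply/ltW; exact: truncnS_gt.
have -> : ell (xs w) (th w) = 0.
  rewrite /ell (_ : EL_ratio _ _ = 0) ?ln0 ?mulr0//.
  by apply/eqP; rewrite eq_le E0 EL_ratio_ge0.
by [].
Qed.

Hypothesis n0 : (0 < n)%N.

Lemma measurable_sample_mean (xs : T -> 'I_n -> 'rV[R]_d) k :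
  (forall i k, measurable_fun setT (fun w => xs w i ord0 k)) ->
  measurable_fun setT (fun w => sample_mean (xs w) ord0 k).
Proof.
move=> mxs; rewrite (_ : (fun w => _) = fun w => n%:R^-1 * \sum_i xs w i ord0 k).
  by apply: measurable_funM => //; exact: measurable_sum.
by apply/funext => w; rewrite mxE summxE.
Qed.

Lemma measurable_unitmx_scatter (xs : T -> 'I_n -> 'rV[R]_d) :
  (forall i k, measurable_fun setT (fun w => xs w i ord0 k)) ->
  measurable [set w | scatter (xs w) \in unitmx].
Proof.
move=> mxs.
have mS k l : measurable_fun setT (fun w => scatter (xs w) k l).
  rewrite (_ : (fun w => _) = fun w => n%:R^-1 * \sum_i
     ((xs w i ord0 k - sample_mean (xs w) ord0 k)
      * (xs w i ord0 l - sample_mean (xs w) ord0 l))).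
    apply: measurable_funM => //; apply: measurable_sum => i.
    by apply: measurable_funM; apply: measurable_funB => //; exact: measurable_sample_mean.
  apply/funext => w; rewrite /scatter mxE summxE; congr (_ * _); apply: eq_bigr => i _.
  by rewrite mxE big_ord1 !mxE.
have mdet : measurable_fun setT (fun w => \det (scatter (xs w))).
  rewrite /determinant; apply: measurable_sum => s; apply: measurable_funM => //.
  exact: measurable_prod.
have mD : measurable (~` [set w | `|\det (scatter (xs w))| <= 0]).
  by apply: measurableC; apply: measurable_set_le; exact: measurableT_comp.
rewrite (_ : [set w | _] = ~` [set w | `|\det (scatter (xs w))| <= 0])//.
by apply/seteqP; split => w /=; rewrite unitmxE unitfE normr_le0 => /negP.
Qed.

(** The choice inside [hC_inv] is removed on both pieces: by [ell_star_le] on nondegenerate samples,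
    and by the default value 0 on the others. *)
Lemma measurable_ell_star_le (xs : T -> 'I_n -> 'rV[R]_d) (theta0 : 'rV[R]_d) (c : R) :
  (forall i k, measurable_fun setT (fun w => xs w i ord0 k)) -> 0 <= c ->
  measurable [set w | ell_star (xs w) theta0 <= c].
Proof.
move=> mxs c0.
pose th (w : T) := sample_mean (xs w) +
  (1 + c / (2 * n%:R))^-1 *: (theta0 - sample_mean (xs w)).
pose N := [set w : T | scatter (xs w) \in unitmx].
have mN : measurable N by exact: measurable_unitmx_scatter.
rewrite (_ : [set w | _] =
  (N `&` [set w | expR (- (c / 2)) <= EL_ratio (xs w) (th w)]) `|`
  (~` N `&` [set w | ell (xs w) 0 <= c])).
  apply: measurableU; apply: measurableI => //.
  - apply: measurable_EL_ratio_ge => //; last exact: expR_gt0.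
    move=> k; rewrite (_ : (fun w => _) = fun w => sample_mean (xs w) ord0 k +
      (1 + c / (2 * n%:R))^-1 * (theta0 ord0 k - sample_mean (xs w) ord0 k)).
      have mm := measurable_sample_mean k mxs.
      by apply: measurable_funD => //; apply: measurable_funM => //; exact: measurable_funB.
    by apply/funext => w; rewrite !mxE.
  - exact: measurableC.
  - exact: measurable_ell_le.
apply/seteqP; split => w /=.
  have [Nw|Nw] := boolP (scatter (xs w) \in unitmx).
    by rewrite (ell_star_le theta0 n0 Nw c0) => ?; left.
  by rewrite (ell_star_degenerate theta0 n0 Nw) => ?; right; split => //; exact/negP.
case=> -[Nw]; first by rewrite (ell_star_le theta0 n0 Nw c0).
by move/negP in Nw; rewrite (ell_star_degenerate theta0 n0 Nw).
Qed.

End Measurability.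

(** * Asymptotics of the likelihood ratio *)

(** The difference [g] is minimal at 0: [dg u] has the sign of [u], because
    [1 / (1 + u) <= 1 + 2 tau] as soon as [u >= - tau] and [tau <= 1/2]. *)
Lemma ln1D_quadratic {R : realType} (tau t : R) : tau <= 1 / 2 -> `|t| <= tau ->
  t - (1 / 2 + tau) * t ^+ 2 <= ln (1 + t).
Proof.
move=> tau2 ttau.
pose g : R -> R := fun u => ln (1 + u) - u + (1 / 2 + tau) * u ^+ 2.
pose dg : R -> R := fun u => (1 + u)^-1 - 1 + (1 / 2 + tau) * (2 * u).
have tau0 : 0 <= tau by exact: le_trans ttau.
have dgP (u : R) : -1 < u -> is_derive u 1 g (dg u).
  move=> u1; have u1' : 0 < 1 + u by lra.
  have dl : is_derive u 1 (fun v : R => ln (1 + v)) (1 + u)^-1.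
    have d1 : is_derive u 1 (fun v : R => 1 + v) 1.
      by rewrite -[X in is_derive _ _ _ X]add0r; apply: is_deriveD.
    have := @is_derive1_comp _ (@ln R) (fun v => 1 + v) u _ _ (is_derive1_ln u1') d1.
    by rewrite mulr1.
  have gE : g = (fun v : R => ln (1 + v)) - id + (1 / 2 + tau) *: (id ^+ 2).
    by apply/funext.
  have dq := is_deriveZ (1 / 2 + tau) (is_deriveX 2 (is_derive_id u (1 : R))).
  rewrite gE; apply: (is_derive_eq (is_deriveD (is_deriveB dl (is_derive_id u (1 : R))) dq)).
  by rewrite /dg /GRing.scale /=; ring.
have sgn (u : R) : `|u| <= tau -> 0 <= dg u * u.
  rewrite ler_norml => /andP[u1 u2].
  have u10 : 0 < 1 + u by lra.
  have -> : dg u * u = u ^+ 2 * ((1 + 2 * tau) - (1 + u)^-1).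
    by rewrite /dg; field; exact: lt0r_neq0.
  rewrite mulr_ge0 ?sqr_ge0// subr_ge0 -[leLHS]mul1r ler_pdivrMr//.
  have tt2 : 0 <= tau * (1 / 2 - tau) by apply: mulr_ge0 => //; lra.
  have tt3 : 0 <= (1 + 2 * tau) * (u + tau) by apply: mulr_ge0; lra.
  nra.
have g0 : g 0 = 0 by rewrite /g addr0 ln1 expr0n mulr0 subr0 addr0.
suff : 0 <= g t by rewrite /g; lra.
have cg (a b : R) : -1 < a -> {within `[a, b], continuous g}.
  move=> a1; apply: continuous_in_subspaceT => u; rewrite inE /= in_itv/= => /andP[au _].
  apply: differentiable_continuous; apply/derivable1_diffP.
  by have [] := dgP u (lt_le_trans a1 au).
have [t0|t0] := leP 0 t.
  have dg' (u : R) : u \in `]0, t[%R -> is_derive u 1 g (dg u).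
    by rewrite in_itv/= => /andP[u0 _]; apply: dgP; lra.
  have [|c] := MVT_segment t0 dg' (cg _ _ _); first lra.
  rewrite in_itv/= => /andP[c0 ct]; rewrite g0 !subr0 => ->.
  have ctau : `|c| <= tau by rewrite ger0_norm// (le_trans ct)// (le_trans (ler_norm t)).
  have [->|cn0] := eqVneq c 0; first by rewrite /dg addr0 invr1 subrr !mulr0 addr0 mul0r.
  have cp : 0 < c by rewrite lt_neqAle eq_sym cn0.
  by have := sgn c ctau; rewrite pmulr_lge0// => h; rewrite mulr_ge0.
have tm : -1 < t by move: ttau; rewrite ler_norml => /andP[]; lra.
have dg' (u : R) : u \in `]t, 0[%R -> is_derive u 1 g (dg u).
  by rewrite in_itv/= => /andP[u0 _]; apply: dgP; lra.
have [c] := MVT_segment (ltW t0) dg' (cg _ _ tm).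
rewrite in_itv/= => /andP[tc c0]; rewrite g0 !sub0r => /eqP.
rewrite mulrN eqr_opp => /eqP ->.
have ctau : `|c| <= tau.
  by rewrite ler0_norm//; move: ttau; rewrite ltr0_norm//; lra.
have [->|cn0] := eqVneq c 0; first by rewrite /dg addr0 invr1 subrr !mulr0 addr0 mul0r.
have cp : c < 0 by rewrite lt_neqAle cn0.
have := sgn c ctau; rewrite nmulr_lge0// => h.
by rewrite mulr_le0// ltW.
Qed.

Lemma prod_ge_exp {R : realType} {n : nat} (tau : R) (t : 'I_n -> R) : tau <= 1 / 2 ->
  (forall i, `|t i| <= tau) ->
  expR (\sum_i t i - (1 / 2 + tau) * \sum_i t i ^+ 2) <= \prod_i (1 + t i).
Proof.
move=> tau2 tt; have t1 i : 0 < 1 + t i.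
  by have := tt i; rewrite ler_norml => /andP[]; lra.
rewrite mulr_sumr -sumrB expR_sum; apply: ler_prod => i _; rewrite expR_ge0/=.
by rewrite -[leRHS]lnK ?posrE// ler_expR ln1D_quadratic.
Qed.

(** * Deterministic two-sided bounds on the likelihood ratio *)

Section Comparison.
Context {R : realType} {n d : nat}.
Variables (x : 'I_n -> 'rV[R]_d) (theta0 : 'rV[R]_d) (Sigma M : 'M[R]_d).
Hypothesis n0 : (0 < n)%N.
Hypothesis symM : M^T = M.
Hypothesis symS : Sigma^T = Sigma.
Hypothesis psdM : forall u, 0 <= qf M u u.
Hypothesis MS : M *m Sigma = 1%:M.

Let m := sample_mean x.
Let Q u := qf M u u.
Let Z i := x i - theta0.
Let Zb := m - theta0.
Let V := n%:R * Q Zb.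

Let nR : (0 : R) < n%:R. Proof. by rewrite ltr0n. Qed.

Let SM : Sigma *m M = 1%:M. Proof. exact: mulmx1C. Qed.

Let Q0 u : 0 <= Q u. Proof. exact: psdM. Qed.

Lemma qf_Sigma u : qf Sigma u u = Q (u *m Sigma).
Proof. by rewrite /Q /qf trmx_mul symS -[u *m _ *m M]mulmxA SM mulmx1 mulmxA. Qed.

(** [Sigma] and [M] define dual norms: [dot u v] is the [M]-product of [u *m Sigma] and [v]. *)
Lemma dot_CauchySchwarz u v : dot u v ^+ 2 <= qf Sigma u u * Q v.
Proof.
have -> : dot u v = qf M (u *m Sigma) v by rewrite qf_dot -mulmxA SM mulmx1.
by rewrite qf_Sigma; exact: qf_CauchySchwarz.
Qed.

Lemma Q_addr_le u v : Q (u + v) <= 2 * (Q u + Q v).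
Proof.
rewrite -subr_ge0; have := Q0 (u - v); rewrite /Q !(qfDl, qfDr, qfNl, qfNr).
by rewrite (qfC v u symM); lra.
Qed.

Variables (eps K c : R).
Hypothesis eps0 : 0 < eps.
Hypothesis eps4 : eps <= 1 / 4.
Hypothesis VK : V <= K.
Hypothesis maxZ : forall i, 8 * K * (Q (Z i) / n%:R + K / n%:R) <= eps ^+ 2.
Hypothesis Kn : K / n%:R <= eps.
Hypothesis closeS : forall u,
  `|qf (scatter x) u u - qf Sigma u u| <= eps * qf Sigma u u.

Let Sig0 u : 0 <= qf Sigma u u. Proof. by rewrite qf_Sigma. Qed.

(** On a null vector of the covariance [closeS] reads [q <= eps * q], which forces [q = 0] because
    [eps < 1]. *)
Lemma scatter_unitmx : scatter x \in unitmx.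
Proof.
rewrite -row_free_unit -kermx_eq0; apply/rowV0P => u /sub_kermxP uS.
have := closeS u; rewrite {1}/qf uS mul0mx mxE sub0r normrN ger0_norm// => h.
have h4 : 0 <= (1 / 4 - eps) * qf Sigma u u by rewrite mulr_ge0 ?subr_ge0.
have q0 : qf Sigma u u = 0 by apply/eqP; rewrite eq_le Sig0 andbT; lra.
apply: dot_eq0; apply/eqP; rewrite -sqrf_eq0 eq_le sqr_ge0 andbT.
by have := dot_CauchySchwarz u u; rewrite q0 mul0r.
Qed.

Let Qn : Q Zb <= K / n%:R.
Proof. by rewrite ler_pdivlMr// mulrC. Qed.

Let K0 : 0 <= K.
Proof. by apply: le_trans VK; rewrite mulr_ge0. Qed.

Let n1 : n%:R^-1 <= 1 :> R.
Proof. by rewrite invf_le1// ler1n. Qed.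

(** Common bound on the squares [t i ^+ 2] of both constructions: the 2 comes from [Q_addr_le], and
    the 4 leaves room for the estimate of the tilt. Together they explain the 8 in [maxZ]. *)
Let QKn i (r : R) : 0 <= r <= 1 ->
  K / n%:R * (4 * (2 * (Q (Z i) + Q (- (r *: Zb))))) <= eps ^+ 2.
Proof.
move=> /andP[r0 r1].
have -> : Q (- (r *: Zb)) = r ^+ 2 * Q Zb.
  by rewrite /Q !(qfNl, qfNr, qfZl, qfZr); ring.
have r2 : r ^+ 2 * Q Zb <= K / n%:R.
  apply: le_trans Qn; rewrite ler_piMl// ?exprn_ile1//.
apply: le_trans (maxZ i).
have -> : K / n%:R * (4 * (2 * (Q (Z i) + r ^+ 2 * Q Zb))) =
  8 * K * (Q (Z i) / n%:R + r ^+ 2 * Q Zb / n%:R) by ring.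
apply: ler_wpM2l; first by rewrite mulr_ge0.
rewrite lerD2l; apply: le_trans (_ : K / n%:R * n%:R^-1 <= _).
  by rewrite ler_wpM2r// invr_ge0 ltW.
by rewrite ler_piMr// divr_ge0// ltW.
Qed.

Let xE i : x i - m = Z i + - (1 *: Zb).
Proof. by rewrite scale1r /Z /Zb opprB addrA subrK. Qed.

(* The witness is [w i = (1 + b . (x i - m)) / n], with [b] chosen so that the
   weighted mean is the required point. *)
Lemma EL_ratio_lower_bound (s : R) : 0 <= s <= 1 -> V * (1 + 4 * eps) <= c ->
  expR (- (c / 2)) <= EL_ratio x (m + s *: (theta0 - m)).
Proof.
move=> /andP[s0 s1] Vc; have Su := scatter_unitmx.
have e0 := eps0; have e4 := eps4.
pose v := s *: (theta0 - m); pose b := v *m invmx (scatter x).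
pose t i := dot b (x i - m).
pose r := qf (scatter x) b b.
have rE : r = dot v b by rewrite /r qf_dot /b mulmxKV.
have r0 : 0 <= r by exact: scatter_psd.
have eps4' : 0 <= 1 / 4 - eps by rewrite subr_ge0.
have Sb : qf Sigma b b <= 2 * r.
  have h1 := mulr_ge0 eps4' (Sig0 b); have h2 := Sig0 b.
  by have := closeS b; rewrite ler_norml -/r => /andP[+ _]; lra.
have Qv : Q v = s ^+ 2 * Q Zb.
  by rewrite /v /Zb -opprB /Q !(qfZl, qfZr, qfNl, qfNr); ring.
have Qvq : Q v <= Q Zb by rewrite Qv ler_piMl// exprn_ile1.
(* Cauchy-Schwarz gives [r^2 <= qf Sigma b b * Q v], and [closeS] bounds [qf Sigma b b] by
   [r / (1 - eps)]; one factor [r] is then cancelled. *)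
have rV : (1 - eps) * r <= Q Zb.
  have cs : r ^+ 2 <= qf Sigma b b * Q v.
    by rewrite {1}rE dotC; exact: dot_CauchySchwarz.
  have Sb' : (1 - eps) * qf Sigma b b <= r.
    by have := closeS b; rewrite ler_norml -/r => /andP[+ _]; lra.
  have h1 : (1 - eps) * r ^+ 2 <= r * Q Zb.
    apply: (@le_trans _ _ ((1 - eps) * qf Sigma b b * Q v)).
      by rewrite -mulrA ler_wpM2l//; lra.
    apply: (@le_trans _ _ (r * Q v)); first by rewrite ler_wpM2r.
    by rewrite ler_wpM2l.
  have [->|rn0] := eqVneq r 0; first by rewrite mulr0.
  have rp : 0 < r by rewrite lt_neqAle eq_sym rn0.
  by rewrite -(ler_pM2l rp) mulrCA -expr2.
have rK : r <= 2 * (K / n%:R) by have := Qn; have := mulr_ge0 eps4' r0; lra.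
have teps i : `|t i| <= eps.
  rewrite -(@ler_pXn2r _ 2)// ?nnegrE ?(ltW eps0)// real_normK ?num_real//.
  apply: le_trans (dot_CauchySchwarz _ _) _; rewrite xE.
  apply: le_trans (QKn i (_ : 0 <= 1 <= 1)); last by rewrite ler01 lexx.
  apply: (@le_trans _ _ (4 * (K / n%:R) * (2 * (Q (Z i) + Q (- (1 *: Zb)))))).
    apply: ler_pM => //; last exact: Q_addr_le.
    by apply: le_trans Sb _; lra.
  by rewrite le_eqVlt; apply/orP; left; apply/eqP; ring.
pose w i := n%:R^-1 + tilt x v i.
have wt i : n%:R * w i = 1 + t i.
  by rewrite /w /tilt mulrDr mulVKf ?mulfV// gt_eqF.
have wp i : 0 <= w i.
  rewrite -(pmulr_rge0 _ nR) wt.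
  by have := teps i; rewrite ler_norml => /andP[]; lra.
have fw : feasible x (m + v) w.
  by apply: EL_ratio_tilt => //; [exact: sum_unif|rewrite /m sample_meanE].
apply: le_trans (EL_ratio_ge fw); rewrite /likelihood.
under eq_bigr do rewrite wt.
apply: le_trans (prod_ge_exp (tau := eps) _ teps); last by lra.
rewrite ler_expR.
have -> : \sum_i t i = 0 by rewrite /t -dot_sumr sum_centered// /dot trmx0 mulmx0 mxE.
have -> : \sum_i t i ^+ 2 = n%:R * r.
  by rewrite /r qf_scatter mulrA mulfV ?gt_eqF// mul1r; apply: eq_bigr => i _.
rewrite sub0r lerN2.
have nr0 : 0 <= n%:R * r by rewrite mulr_ge0// ltW.
have nrV : (1 - eps) * (n%:R * r) <= V.
  by rewrite /V mulrCA ler_wpM2l// ltW.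
(* Encodes [1 + 2 eps <= (1 + 4 eps)(1 - eps)], valid for [eps <= 1/4]. *)
have h1 : 0 <= n%:R * r * (eps * (1 / 4 - eps)) by rewrite !mulr_ge0// ltW.
have h2 : (1 + 4 * eps) * ((1 - eps) * (n%:R * r)) <= (1 + 4 * eps) * V.
  by rewrite ler_wpM2l//; have := eps0; lra.
move: (n%:R * r) nr0 nrV h1 h2 => N nr0 nrV h1 h2; lra.
Qed.

(* Dual bound at [l = (m - theta0) M], the first-order Lagrange multiplier. *)
Lemma EL_ratio_upper_bound (s : R) : 1 - eps / 2 <= s <= 1 -> c < V * (1 - 6 * eps) ->
  EL_ratio x (m + s *: (theta0 - m)) < expR (- (c / 2)).
Proof.
move=> /andP[s0 s1] Vc; have e0 := eps0; have e4 := eps4.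
pose l := Zb *m M; pose th := m + s *: (theta0 - m).
have yE i : x i - th = (x i - m) + s *: Zb.
  by rewrite /th /Zb -[m - theta0]opprB scalerN opprD addrA.
pose t i := dot l (x i - th).
have tQ i : t i ^+ 2 <= Q Zb * Q (x i - th).
  by rewrite /t -qf_dot; exact: qf_CauchySchwarz.
have V0 : 0 <= V by rewrite mulr_ge0// ltW.
have teps i : `|t i| <= eps.
  rewrite -(@ler_pXn2r _ 2)// ?nnegrE ?(ltW eps0)// real_normK ?num_real//.
  apply: le_trans (tQ i) _.
  have -> : x i - th = Z i + - ((1 - s) *: Zb).
    by rewrite yE xE scalerBl !scale1r; move: (Z i) (s *: Zb) Zb => u a b; rewrite opprB addrA addrAC.
  have s01 : 0 <= 1 - s <= 1 by apply/andP; split; lra.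
  apply: le_trans (QKn i s01); apply: ler_pM => //.
  apply: le_trans (Q_addr_le _ _) _.
  have h := addr_ge0 (Q0 (Z i)) (Q0 (- ((1 - s) *: Zb))); lra.
have tpos i : 0 < 1 + t i by have := teps i; rewrite ler_norml => /andP[]; lra.
apply: le_lt_trans (@EL_ratio_dual _ _ _ x th l tpos) _.
have tprod : 0 < \prod_i (1 + t i) by apply: prodr_gt0 => i _; exact: tpos.
rewrite expRN ltf_pV2 ?posrE ?expR_gt0//.
apply: lt_le_trans (prod_ge_exp (tau := eps) _ teps); last by lra.
rewrite ltr_expR.
have sc0 : \sum_i dot l (x i - m) = 0.
  by rewrite -dot_sumr sum_centered// /dot trmx0 mulmx0 mxE.
have lZ : dot l Zb = Q Zb by rewrite -qf_dot.
have -> : \sum_i t i = s * V.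
  rewrite /t; under eq_bigr do rewrite yE dotDr dotZr lZ.
  by rewrite big_split/= sc0 add0r sumr_const card_ord -mulr_natl /V; ring.
have lS : qf Sigma l l = Q Zb.
  by rewrite qf_Sigma /l -mulmxA MS mulmx1.
have -> : \sum_i t i ^+ 2 = n%:R * qf (scatter x) l l + n%:R * (s * Q Zb) ^+ 2.
  rewrite qf_scatter mulrA mulfV ?gt_eqF// mul1r.
  rewrite (eq_bigr (fun i => dot l (x i - m) * dot l (x i - m) +
    (2 * (s * Q Zb) * dot l (x i - m) + (s * Q Zb) ^+ 2))); last first.
    by move=> i _; rewrite /t yE dotDr dotZr lZ; ring.
  rewrite !big_split/= -mulr_sumr sc0 mulr0 add0r sumr_const card_ord.
  by rewrite -[(_ ^+ 2) *+ n]mulr_natl.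
have h1 : n%:R * qf (scatter x) l l <= (1 + eps) * V.
  have := closeS l; rewrite ler_norml lS => /andP[_ h].
  by rewrite /V mulrCA ler_wpM2l ?(ltW nR)//; lra.
have h2 : n%:R * (s * Q Zb) ^+ 2 <= eps * V.
  rewrite exprMn; apply: (@le_trans _ _ (n%:R * (Q Zb) ^+ 2)).
    rewrite ler_wpM2l ?(ltW nR)// ler_piMl ?sqr_ge0// exprn_ile1//; lra.
  rewrite expr2 mulrA mulrC ler_wpM2r//; exact: le_trans Qn Kn.
have h3 : (1 / 2 + eps) * (n%:R * qf (scatter x) l l + n%:R * (s * Q Zb) ^+ 2) <=
    (1 / 2 + eps) * ((1 + 2 * eps) * V).
  by rewrite ler_wpM2l//; lra.
have h4 : (1 - eps / 2) * V <= s * V by rewrite ler_wpM2r.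
(* The net coefficient of [V] is [(1 - eps/2) - (1/2 + eps)(1 + 2 eps)], at least [(1 - 6 eps) / 2]
   for [eps <= 1/4]. *)
have h5 : 0 <= V * (eps * (1 / 4 - eps)) by rewrite !mulr_ge0//; lra.
nra.
Qed.

End Comparison.

Section CloseScatter.
Context {R : realType} {n d : nat}.
Variables (x : 'I_n -> 'rV[R]_d) (theta0 : 'rV[R]_d) (Sigma M : 'M[R]_d).
Hypothesis n0 : (0 < n)%N.
Hypothesis symM : M^T = M.
Hypothesis symS : Sigma^T = Sigma.
Hypothesis psdM : forall u, 0 <= qf M u u.
Hypothesis MS : M *m Sigma = 1%:M.

Let zz k l i := (x i - theta0) ord0 k * (x i - theta0) ord0 l.

Definition cov_error : R :=
  \sum_k \sum_l `|n%:R^-1 * \sum_i zz k l i - Sigma k l|.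

(** The error is relative to [Sigma]: each product of coordinates of [u] is at most [q * \tr M] by
    Cauchy-Schwarz, and centring at the sample mean instead of [theta0] costs
    [dot u (m - theta0) ^+ 2 <= q * r]. *)
Lemma close_scatter (r : R) u :
  qf M (sample_mean x - theta0) (sample_mean x - theta0) <= r ->
  `|qf (scatter x) u u - qf Sigma u u| <= (cov_error * \tr M + r) * qf Sigma u u.
Proof.
move=> Qr; have nR : (0 : R) < n%:R by rewrite ltr0n.
set q := qf Sigma u u; set m := sample_mean x in Qr *.
have CS v : dot u v ^+ 2 <= q * qf M v v by exact: dot_CauchySchwarz.
have q0 : 0 <= q by rewrite /q (qf_Sigma symS MS).
have Mkk k : 0 <= M k k by have := psdM (delta_mx ord0 k); rewrite qf_delta -rowE mxE.
have ukE k : u ord0 k = dot u (delta_mx ord0 k).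
  rewrite dotE (bigD1 k)//= big1 => [|j jk].
    by rewrite [delta_mx _ _ _ _]mxE !eqxx mulr1 addr0.
  by rewrite [delta_mx _ _ _ _]mxE (negbTE jk) andbF mulr0.
have uk k : u ord0 k ^+ 2 <= q * \tr M.
  apply: (@le_trans _ _ (q * M k k)).
    rewrite ukE; apply: le_trans (CS _) _.
    by rewrite (qf_delta M (delta_mx ord0 k) k) -rowE mxE.
  rewrite ler_wpM2l// /mxtrace (bigD1 k)//= lerDl; exact: sumr_ge0.
have ukl k l : `|u ord0 k * u ord0 l| <= q * \tr M.
  have h1 := uk k; have h2 := uk l.
  have h3 := sqr_ge0 (u ord0 k - u ord0 l); have h4 := sqr_ge0 (u ord0 k + u ord0 l).
  by rewrite ler_norml; apply/andP; split; nra.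
have sE : qf (scatter x) u u =
    n%:R^-1 * \sum_i dot u (x i - theta0) ^+ 2 - dot u (m - theta0) ^+ 2.
  rewrite qf_scatter -/m.
  have cE i : x i - m = (x i - theta0) - (m - theta0) by rewrite opprB addrA subrK.
  have sm : \sum_i dot u (x i - theta0) = n%:R * dot u (m - theta0).
    rewrite -dot_sumr (_ : \sum_i (x i - theta0) = n%:R *: (m - theta0)) ?dotZr//.
    rewrite sumrB sumr_const card_ord scalerBr /m /sample_mean scalerA mulfV ?gt_eqF//.
    by rewrite scale1r scaler_nat.
  under eq_bigr do rewrite cE dotBr.
  rewrite (eq_bigr (fun i => dot u (x i - theta0) ^+ 2 +
    (- 2 * dot u (m - theta0) * dot u (x i - theta0) + dot u (m - theta0) ^+ 2))); last first.
    by move=> i _; ring.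
  rewrite !big_split/= -mulr_sumr sm sumr_const card_ord.
  by rewrite -[(_ ^+ 2) *+ n]mulr_natl; field; exact: lt0r_neq0.
have dE : n%:R^-1 * \sum_i dot u (x i - theta0) ^+ 2 - q =
    \sum_k \sum_l (u ord0 k * u ord0 l) * (n%:R^-1 * \sum_i zz k l i - Sigma k l).
  rewrite /q qfEE mulr_sumr.
  have -> : \sum_k (\sum_l u ord0 l * Sigma l k) * u ord0 k =
      \sum_k \sum_l (u ord0 k * u ord0 l) * Sigma k l.
    rewrite exchange_big /=; apply: eq_bigr => k _; rewrite mulr_suml.
    by apply: eq_bigr => l _; ring.
  have -> : \sum_i n%:R^-1 * dot u (x i - theta0) ^+ 2 =
      \sum_k \sum_l (u ord0 k * u ord0 l) * (n%:R^-1 * \sum_i zz k l i).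
    rewrite [RHS](eq_bigr (fun k => \sum_i \sum_l
        (u ord0 k * u ord0 l) * (n%:R^-1 * zz k l i))); last first.
      move=> k _; rewrite exchange_big /=; apply: eq_bigr => l _.
      by rewrite -!mulr_sumr.
    rewrite exchange_big /=; apply: eq_bigr => i _.
    rewrite expr2 dotE mulr_suml mulr_sumr; apply: eq_bigr => k _.
    rewrite !mulr_sumr; apply: eq_bigr => l _; rewrite /zz.
    by move: ((x i - theta0) ord0 k) ((x i - theta0) ord0 l) => a b; ring.
  rewrite -sumrB; apply: eq_bigr => k _; rewrite -sumrB; apply: eq_bigr => l _; ring.
rewrite sE -/q (_ : _ - _ - q = (n%:R^-1 * \sum_i dot u (x i - theta0) ^+ 2 - q)
   - dot u (m - theta0) ^+ 2); last by ring.
apply: le_trans (ler_normB _ _) _; rewrite mulrDl; apply: lerD.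
  rewrite dE; apply: le_trans (ler_norm_sum _ _ _) _.
  rewrite -mulrA /cov_error mulr_suml; apply: ler_sum => k _.
  apply: le_trans (ler_norm_sum _ _ _) _.
  rewrite mulr_suml; apply: ler_sum => l _.
  by rewrite normrM mulrC ler_wpM2l// [\tr M * q]mulrC.
rewrite ger0_norm ?sqr_ge0//; apply: le_trans (CS _) _.
by rewrite mulrC ler_wpM2r.
Qed.

End CloseScatter.

(** * Transfer of the limit law from the quadratic form to [ell_star] *)

Section Wilks.
Context {dsp : measure_display} {T : measurableType dsp} {R : realType}
        (P : probability T R) {d : nat}.
Variables (X : T -> 'rV[R]_d) (Xs : nat -> T -> 'rV[R]_d).
Hypothesis d0 : (0 < d)%N.
Hypothesis mX : forall k, measurable_fun setT (fun w => X w ord0 k).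
Hypothesis mXs : forall i k, measurable_fun setT (fun w => Xs i w ord0 k).
Hypothesis indXs : mutually_independent P Xs.
Hypothesis lawXs : forall i, same_law P (Xs i) X.
Variables (theta0 : 'rV[R]_d) (Sigma M : 'M[R]_d).
Let z (k : 'I_d) (v : 'rV[R]_d) : R := (v - theta0) ord0 k.
Hypothesis LZ : forall k, L1 P (z k \o X).
Hypothesis LZZ : forall k l, L1 P (fun w => z k (X w) * z l (X w)).
Hypothesis EZ : forall k, mean P (z k \o X) = 0.
Hypothesis EZZ : forall k l, mean P (fun w => z k (X w) * z l (X w)) = Sigma k l.
Hypothesis symM : M^T = M.
Hypothesis psdM : forall u, 0 <= qf M u u.
Hypothesis MS : M *m Sigma = 1%:M.

Let Q u := qf M u u.
Let S n w : 'rV[R]_d := \sum_(i < n) (Xs i w - theta0).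
Let xs n w := fun i : 'I_n => Xs i w.
Let V n w := n%:R^-1 * Q (S n w).

Let symS : Sigma^T = Sigma. Proof. exact: symS EZZ. Qed.

Let mV n : measurable_fun setT (V n).
Proof.
apply: measurable_funM => //; apply: measurable_qf => k; exact: measurable_S.
Qed.

Let V0 n w : 0 <= V n w.
Proof. by rewrite mulr_ge0 ?invr_ge0 ?psdM. Qed.

Let lapV (lambda : R) : 0 < lambda ->
  mean P (fun w => expR (- (lambda * V n w))) @[n --> \oo] -->
  (1 + 2 * lambda) `^ (- (d%:R / 2)).
Proof.
move=> l0; have := laplace_limit mX mXs indXs lawXs LZ LZZ EZ EZZ symM psdM MS l0.
apply: cvg_trans; apply: near_eq_cvg; apply: nearW => n; congr mean.
by apply/funext => w; rewrite /V mulrA.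
Qed.

Let VE n w : (0 < n)%N ->
  V n w = n%:R * Q (sample_mean (@xs n w) - theta0).
Proof.
move=> n0; have nR : (0 : R) < n%:R by rewrite ltr0n.
have -> : sample_mean (@xs n w) - theta0 = n%:R^-1 *: S n w.
  rewrite /S sumrB sumr_const card_ord scalerBr -[theta0 *+ n]scaler_nat scalerA mulVf ?gt_eqF//.
  by rewrite scale1r.
by rewrite /V /Q qfZl qfZr; field; exact: lt0r_neq0.
Qed.

Let covE n w := cov_error (@xs n w) theta0 Sigma.

Let L1_covE_term n k l : L1 P (fun w => `|n%:R^-1 * \sum_(i < n)
  (z k (Xs i w) * z l (Xs i w)) - Sigma k l|).
Proof.
apply/L1_norm/L1B; last exact: L1_cst.
apply/L1Z/L1_sum => i _.
exact: (L1_law mX mXs lawXs i (@borel_centeredM _ _ theta0 k l) (LZZ k l)).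
Qed.

Let L1_covE n : L1 P (covE n).
Proof. by apply: L1_sum => k _; apply: L1_sum => l _; exact: L1_covE_term. Qed.

Let covE_small (r e : R) : 0 < r -> 0 < e ->
  \forall n \near \oo, Pr P [set w | r <= covE n w] <= e.
Proof.
(* The weak law is used for each of the [d * d] entries, followed by Markov's inequality at level
   [r]. *)
move=> r0 e0; pose e' := r * e / (d%:R * d%:R).
have dR : (0 : R) < d%:R by rewrite ltr0n.
have e'0 : 0 < e' by rewrite divr_gt0 ?mulr_gt0.
have wl (k : 'I_d) : \forall n \near \oo, forall l,
    mean P (fun w => `|n%:R^-1 * \sum_(i < n) (z k (Xs i w) * z l (Xs i w)) - Sigma k l|) <= e'.
  apply: filter_forall => l; rewrite -EZZ.
  exact: (weak_law mX mXs indXs lawXs (@borel_centeredM _ _ theta0 k l) (LZZ k l) e'0).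
have {}wl := filter_forall (eventually_filter : Filter \oo) wl.
apply: filterS wl => n wn.
apply: le_trans (Pr_markov (L1_covE n) _ r0) _.
  by move=> w; do 2 apply: sumr_ge0 => ? _.
rewrite ler_pdivrMr// /covE /cov_error mean_sum => [|k _]; last first.
  by apply: L1_sum => l _; exact: L1_covE_term.
apply: (@le_trans _ _ (\sum_(k < d) \sum_(l < d) e')).
  apply: ler_sum => k _; rewrite mean_sum => [|l _]; last exact: L1_covE_term.
  by apply: ler_sum => l _; exact: wn.
rewrite !sumr_const !card_ord -mulrnA -mulr_natr natrM.
by rewrite /e' divfK ?mulf_neq0 ?gt_eqF// mulrC.
Qed.

(* Off this event the deterministic bounds on [EL_ratio] apply. *)
Let bad n (eta r K : R) := [set w | exists i : 'I_n, eta * n%:R < Q (Xs i w - theta0)]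
  `|` [set w | r <= covE n w] `|` [set w | K < V n w].

Let mbad1 n (eta : R) : measurable [set w | exists i : 'I_n, eta * n%:R < Q (Xs i w - theta0)].
Proof.
rewrite (_ : [set w | _] = \bigcup_(i in [set: 'I_n]) [set w | eta * n%:R < Q (Xs i w - theta0)]).
  apply: fin_bigcup_measurable => // i _; apply: measurable_set_gt.
  exact: (borel_comp (mXs i) (@borel_Q _ _ theta0 M)).
by apply/seteqP; split => w /= [i]; [move=> qi; exists i|move=> _ qi; exists i].
Qed.

Let mbad2 n (r : R) : measurable [set w | r <= covE n w].
Proof. exact: measurable_set_ge (L1_measurable (L1_covE n)). Qed.

Let mbad n eta r K : measurable (bad n eta r K).
Proof.
apply: measurableU; last exact: measurable_set_gt.
by apply: measurableU; [exact: mbad1|exact: mbad2].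
Qed.

Let bad_small (eta r K e : R) : 0 < eta -> 0 < r -> 0 < e ->
  (\forall n \near \oo, Pr P [set w | K < V n w] <= e) ->
  \forall n \near \oo, Pr P (bad n eta r K) <= 3 * e.
Proof.
move=> eta0 r0 e0 VK.
have LQ : L1 P ((fun v => Q (v - theta0)) \o X) by exact: L1_Q.
have b1 := max_negligible mX mXs lawXs (@borel_Q _ _ theta0 M)
  (fun v => psdM (v - theta0)) LQ eta0 e0.
have b2 := covE_small r0 e0.
apply: filterS3 b1 b2 VK => n h1 h2 h3.
apply: le_trans (PrU _ _ _) _; [|exact: measurable_set_gt|].
  by apply: measurableU; [exact: mbad1|exact: mbad2].
have := PrU P (mbad1 n eta) (mbad2 n r).
rewrite -/Q in h1; lra.
Qed.

(** Tightness of [V] supplies the level [K] that the deterministic bounds require; the shift [delta]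
    pays for their relative error. *)
Lemma wilks_sandwich (x delta e : R) : 0 <= x -> 0 < delta -> 0 < e ->
  \forall n \near \oo,
    Pr P [set w | V n w <= x - delta] - e <= Pr P [set w | ell_star (@xs n w) theta0 <= x]
    /\ Pr P [set w | ell_star (@xs n w) theta0 <= x] <= Pr P [set w | V n w <= x + delta] + e.
Proof.
move=> x0 delta0 e0; have e3 : 0 < e / 3 by lra.
have [K K0 VK] := laplace_tight mV V0 lapV e3.
(* Chosen so that [(x - delta)(1 + 4 eps) <= x < (x + delta)(1 - 6 eps)]; the added 1 makes the
   second inequality strict, and 1/6 keeps its last factor nonnegative. *)
pose eps := Num.min (1 / 6) (delta / (6 * (x + delta) + 1)).
have D1 : 0 < 6 * (x + delta) + 1 by lra.
have eps0 : 0 < eps by rewrite lt_min [0 < _ / (_ + 1)]divr_gt0// andbT; lra.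
have eps6 : eps <= 1 / 6 by rewrite ge_min lexx.
have eps4 : eps <= 1 / 4 by lra.
have epsd : eps * (6 * (x + delta) + 1) <= delta.
  by rewrite -ler_pdivlMr// ge_min lexx orbT.
(* Gives [8 K eta = eps^2 / 2], half of the bound [maxZ]; the other half comes from [K2n]. *)
pose eta := eps ^+ 2 / (16 * K).
have eta0 : 0 < eta by rewrite divr_gt0 ?exprn_gt0 ?mulr_gt0.
have tr0 : 0 <= \tr M.
  by apply: sumr_ge0 => k _; have := psdM (delta_mx ord0 k); rewrite qf_delta -rowE mxE.
(* The covariance error gets one half of [eps] in [closeS], the centring error, at most [K / n], the
   other half. *)
pose r := eps / (2 * (\tr M + 1)).
have r0 : 0 < r by rewrite divr_gt0// mulr_gt0//; lra.
have rtr : r * \tr M <= eps / 2.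
  rewrite /r mulrAC ler_pdivrMr; last by rewrite mulr_gt0//; lra.
  rewrite (_ : eps / 2 * (2 * (\tr M + 1)) = eps * (\tr M + 1)); last by field.
  by rewrite ler_wpM2l ?(ltW eps0)//; lra.
have bs := bad_small eta0 r0 e3 VK.
near=> n.
have n0 : (0 < n)%N by near: n; exact: nbhs_infty_gt.
have nR : (0 : R) < n%:R by rewrite ltr0n.
have Kn : K / n%:R <= eps / 2.
  rewrite ler_pdivrMr// mulrC -ler_pdivrMr ?divr_gt0//.
  by near: n; exact: nbhs_infty_ger.
have K2n : 16 * K ^+ 2 / n%:R <= eps ^+ 2.
  rewrite ler_pdivrMr// [leRHS]mulrC -ler_pdivrMr ?exprn_gt0//.
  by near: n; exact: nbhs_infty_ger.
have xn : x / n%:R <= eps.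
  rewrite ler_pdivrMr// mulrC -ler_pdivrMr//.
  by near: n; exact: nbhs_infty_ger.
have bn : Pr P (bad n eta r K) <= e.
  have : Pr P (bad n eta r K) <= 3 * (e / 3) by near: n.
  by rewrite (_ : 3 * (e / 3) = e)//; field.
have good w : ~ bad n eta r K w ->
    (V n w <= x - delta -> ell_star (@xs n w) theta0 <= x) /\
    (ell_star (@xs n w) theta0 <= x -> V n w <= x + delta).
  move=> /not_orP[/not_orP[b1 b2] /negP]; rewrite -leNgt => VKw.
  have Qmax i : Q (Xs i w - theta0) / n%:R <= eta \/ (n <= i)%N.
    have [i_n|] := ltnP i n; last by right.
    left; rewrite ler_pdivrMr// leNgt; apply/negP => h.
    by apply: b1; exists (Ordinal i_n).
  have VnK : n%:R * Q (sample_mean (@xs n w) - theta0) <= K by rewrite -VE.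
  have maxZ (i : 'I_n) : 8 * K * (Q (@xs n w i - theta0) / n%:R + K / n%:R) <= eps ^+ 2.
    have [h|] := Qmax i; last by rewrite leqNgt ltn_ord.
    apply: (@le_trans _ _ (8 * K * (eta + K / n%:R))).
      by rewrite ler_wpM2l ?lerD2r// mulr_ge0// ltW.
    rewrite mulrDr (_ : 8 * K * eta = eps ^+ 2 / 2); last first.
      by rewrite /eta; field; exact: lt0r_neq0.
    have : 8 * K * (K / n%:R) = 16 * K ^+ 2 / n%:R / 2.
      by field; exact: lt0r_neq0.
    lra.
  have Kn' : K / n%:R <= eps by lra.
  have closeS u : `|qf (scatter (@xs n w)) u u - qf Sigma u u| <= eps * qf Sigma u u.
    have Qr : Q (sample_mean (@xs n w) - theta0) <= eps / 2.
      by apply: le_trans Kn; rewrite ler_pdivlMr// mulrC.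
    apply: le_trans (close_scatter n0 symM symS psdM MS u Qr) _.
    have q0 : 0 <= qf Sigma u u by rewrite (qf_Sigma symS MS).
    rewrite ler_wpM2r//; have cr : covE n w <= r.
      by rewrite leNgt; apply/negP => h; apply: b2; rewrite /= ltW.
    have : covE n w * \tr M <= r * \tr M by rewrite ler_wpM2r.
    rewrite -/(covE n w); lra.
  have Su := scatter_unitmx symM symS psdM MS eps4 closeS.
  rewrite (ell_star_le theta0 n0 Su x0).
  set s := (1 + x / (2 * n%:R))^-1.
  have xn0 : 0 <= x / n%:R by rewrite divr_ge0// ltW.
  have xE : x / (2 * n%:R) = x / n%:R / 2 by field; exact: lt0r_neq0.
  have sD : 0 < 1 + x / (2 * n%:R) by rewrite xE; lra.
  have s1 : s <= 1 by rewrite invf_le1// xE; lra.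
  have s0 : 1 - eps / 2 <= s.
    rewrite -[leRHS]mul1r ler_pdivlMr// xE.
    have := mulr_ge0 (ltW eps0) xn0; lra.
  have Vw := V0 n w; have VEw := VE w n0.
  have Vw' : n%:R * qf M (sample_mean (@xs n w) - theta0) (sample_mean (@xs n w) - theta0)
    = V n w by rewrite VEw.
  split=> [Vx|].
    apply: (EL_ratio_lower_bound n0 symM symS psdM MS eps0 eps4 VnK maxZ closeS).
      by apply/andP; split; lra.
    rewrite Vw'; apply: (@le_trans _ _ ((x - delta) * (1 + 4 * eps))).
      by rewrite ler_wpM2r//; lra.
    have := mulr_ge0 (ltW eps0) x0; have := mulr_ge0 (ltW eps0) (ltW delta0); lra.
  rewrite leNgt => /negP EL; rewrite leNgt; apply/negP => Vx; apply: EL.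
  apply: (EL_ratio_upper_bound n0 symM symS psdM MS eps0 eps4 VnK maxZ Kn' closeS).
    by apply/andP; split; lra.
  rewrite Vw'; apply: (@lt_le_trans _ _ ((x + delta) * (1 - 6 * eps))).
    nra.
  by rewrite ler_wpM2r//; [lra|exact: ltW].
have mE : measurable [set w | ell_star (@xs n w) theta0 <= x].
  by apply: measurable_ell_star_le => // i k; exact: mXs.
have mVx y : measurable [set w | V n w <= y] by exact: measurable_set_le.
have mb := mbad n eta r K.
split.
  have : Pr P [set w | V n w <= x - delta] <=
      Pr P ([set w | ell_star (@xs n w) theta0 <= x] `|` bad n eta r K).
    apply: Pr_le => //; first exact: measurableU.
    move=> w /= Vx; have [bw|bw] := pselect (bad n eta r K w); first by right.
    by left; apply: (good w bw).1.
  by have := PrU P mE mb; lra.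
have : Pr P [set w | ell_star (@xs n w) theta0 <= x] <=
    Pr P ([set w | V n w <= x + delta] `|` bad n eta r K).
  apply: Pr_le => //; first exact: measurableU.
  move=> w /= Ex; have [bw|bw] := pselect (bad n eta r K w); first by right.
  by left; apply: (good w bw).2.
by have := PrU P (mVx (x + delta)) mb; lra.
Unshelve. all: by end_near.
Qed.

(** One third of [e] each for the sandwich, the limit law at the shifted level and the continuity of
    the chi-square distribution function; when [x - delta < 0] the lower bound follows from
    [chi2_cdf d 0 = 0]. *)
Theorem wilks (x e : R) : 0 <= x -> 0 < e ->
  \forall n \near \oo,
    `|Pr P [set w | ell_star (@xs n w) theta0 <= x] - chi2_cdf d x| <= e.
Proof.
move=> x0 e0; have e3 : 0 < e / 3 by lra.
have [delta2 delta20 Fd] := chi2_cdf_continuous d0 x0 e3.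
pose delta := delta2 / 2; have delta0 : 0 < delta by rewrite divr_gt0.
have sw := wilks_sandwich x0 delta0 e3.
have xd0 : 0 <= x + delta by lra.
have cu := laplace_cdf_cvg d0 mV V0 lapV xd0 e3.
have Fu : `|chi2_cdf d (x + delta) - chi2_cdf d x| <= e / 3.
  apply: Fd => //; rewrite [x + _ - x]addrAC subrr add0r gtr0_norm//.
  by rewrite /delta; lra.
have [xd|xd] := leP 0 (x - delta).
  have cl := laplace_cdf_cvg d0 mV V0 lapV xd e3.
  have Fl : `|chi2_cdf d (x - delta) - chi2_cdf d x| <= e / 3.
    apply: Fd => //; rewrite [x - _ - x]addrAC subrr add0r normrN gtr0_norm//.
    by rewrite /delta; lra.
  apply: filterS3 sw cu cl => n [s1 s2]; move: Fu Fl; rewrite !ler_norml.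
  move=> /andP[? ?] /andP[? ?] /andP[? ?] /andP[? ?]; apply/andP; split; lra.
have F0 : chi2_cdf d 0 = 0 :> R.
  by rewrite /chi2_cdf set_itv1 integral_set1 /= mul0r.
have Fl : `|chi2_cdf d 0 - chi2_cdf d x| <= e / 3.
  apply: Fd => //; rewrite sub0r normrN ger0_norm//.
  by rewrite /delta in xd; lra.
apply: filterS2 sw cu => n [s1 s2]; move: Fu Fl; rewrite F0 !ler_norml.
move=> /andP[? ?] /andP[? ?] /andP[? ?].
have := Pr_ge0 P [set w | ell_star (@xs n w) theta0 <= x].
by move=> ?; apply/andP; split; lra.
Qed.

End Wilks.

Section CenteredMoments.
Context {dsp : measure_display} {T : measurableType dsp} {R : realType}
        (P : probability T R) {d : nat}.
Variables (X : T -> 'rV[R]_d) (theta0 : 'rV[R]_d) (Sigma0 : 'M[R]_d).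
Hypothesis L2X : forall k, (fun w => X w ord0 k) \in Lfun P 2%:E.
Hypothesis EX : forall k, ('E_P[fun w => X w ord0 k])%E = (theta0 ord0 k)%:E.
Hypothesis covX : forall k l,
  covariance P (fun w => X w ord0 k) (fun w => X w ord0 l) = (Sigma0 k l)%:E.
Let z (k : 'I_d) (v : 'rV[R]_d) : R := (v - theta0) ord0 k.

Let L2_z k : z k \o X \in Lfun P 2%:E.
Proof.
rewrite (_ : z k \o X = (fun w => X w ord0 k) - cst (theta0 ord0 k)).
  apply: rpredB => [|h|h]; [by rewrite lee_fin ler1n|exact: L2X|exact: Lfun_cst].
by apply/funext => w; rewrite /z /= !mxE.
Qed.

Lemma L1_centered k : L1 P (z k \o X).
Proof. by apply/Lfun1_integrable/Lfun_subset12 => //; exact: fin_num_measure. Qed.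

Lemma L1_centeredM k l : L1 P (fun w => z k (X w) * z l (X w)).
Proof. by apply/Lfun1_integrable; exact: (Lfun2_mul_Lfun1 (L2_z k) (L2_z l)). Qed.

Lemma mean_centered k : mean P (z k \o X) = 0.
Proof.
have LX : L1 P (fun w => X w ord0 k).
  by apply/Lfun1_integrable/Lfun_subset12 => //; exact: fin_num_measure.
rewrite (_ : _ \o _ = fun w => X w ord0 k - theta0 ord0 k); last first.
  by apply/funext => w; rewrite /z /= !mxE.
rewrite meanB//; last exact: L1_cst.
rewrite mean_cst; have := EX k; rewrite unlock => E.
by rewrite /mean /Rintegral E subrr.
Qed.

Lemma mean_centeredM k l : mean P (fun w => z k (X w) * z l (X w)) = Sigma0 k l.
Proof.
have := covX k l; rewrite covariance.unlock !EX unlock => E.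
rewrite /mean /Rintegral -[RHS]/(fine (Sigma0 k l)%:E) -E; congr fine.
by apply: eq_integral => w _; rewrite /z /= !mxE.
Qed.

(** The form is the mean of the square of [dot u (X - theta0)]. *)
Lemma qf_covariance_ge0 u : 0 <= qf Sigma0 u u.
Proof.
have -> : qf Sigma0 u u = mean P (fun w => dot u (X w - theta0) ^+ 2).
  rewrite (_ : (fun w => _) = fun w =>
      \sum_k \sum_l (u ord0 l * u ord0 k) * (z l (X w) * z k (X w))).
    rewrite mean_sum => [|k _]; last by apply: L1_sum => l _; exact/L1Z/L1_centeredM.
    rewrite qfEE; apply: eq_bigr => k _; rewrite mean_sum => [|l _]; last exact/L1Z/L1_centeredM.
    rewrite mulr_suml; apply: eq_bigr => l _; rewrite meanZ; last exact: L1_centeredM.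
    by rewrite mean_centeredM mulrAC.
  apply/funext => w; rewrite expr2 dotE mulr_sumr; apply: eq_bigr => k _.
  by rewrite mulr_suml; apply: eq_bigr => l _; rewrite /z; ring.
by apply: Rintegral_ge0 => // w _; exact: sqr_ge0.
Qed.

End CenteredMoments.

(** The chi-square distribution function is continuous for [d > 0], so convergence in distribution
    is convergence of the distribution functions at every [x]. *)
Theorem theorem2 (dsp : measure_display) (T : measurableType dsp)
  (R : realType) (P : probability T R) (d : nat)
  (X : T -> 'rV[R]_d) (Xs : nat -> T -> 'rV[R]_d)
  (theta0 : 'rV[R]_d) (Sigma0 : 'M[R]_d) :
  (0 < d)%N ->
  (forall k, measurable_fun setT (fun w => X w ord0 k)) ->
  (forall i k, measurable_fun setT (fun w => Xs i w ord0 k)) ->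
  mutually_independent P Xs ->
  (forall i, same_law P (Xs i) X) ->
  (forall k, (fun w => X w ord0 k) \in Lfun P 2%:E) ->
  (forall k, ('E_P[fun w => X w ord0 k])%E = (theta0 ord0 k)%:E) ->
  (forall k l, covariance P (fun w => X w ord0 k) (fun w => X w ord0 l)
               = (Sigma0 k l)%:E) ->
  \rank Sigma0 = d ->
  forall x : R,
    (fun n : nat =>
       P [set w | ell_star (fun i : 'I_n => Xs i w) theta0 <= x])
      @ \oo --> (@chi2_cdf R d x)%:E.
Proof.
move=> d0 mX mXs indXs lawXs L2X EX covX rkS x.
have SU : Sigma0 \in unitmx by rewrite -row_free_unit /row_free rkS.
pose M := invmx Sigma0; have MS : M *m Sigma0 = 1%:M by exact: mulVmx.
have symSigma : Sigma0^T = Sigma0 by exact: symS (mean_centeredM EX covX).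
have symM : M^T = M by rewrite /M trmx_inv symSigma.
(* Positivity passes to the inverse through [M = M Sigma0 M]. *)
have psdM u : 0 <= qf M u u.
  rewrite (_ : qf M u u = qf Sigma0 (u *m M) (u *m M)).
    exact: qf_covariance_ge0 L2X EX covX _.
  by rewrite /qf trmx_mul symM -[u *m M *m Sigma0]mulmxA MS mulmx1 mulmxA.
have [x0|x0] := ltP x 0.
  rewrite chi2_cdf_lt0//; apply: cvg_near_cst; apply: nearW => n.
  rewrite (_ : [set w | _] = set0) ?measure0//.
  apply/seteqP; split => // w /= /(le_trans (ell_ge0 _ _)).
  by rewrite leNgt x0.
apply/fine_cvgP; split.
  (* Finiteness is obtained from measurability of the event, which is available for [n > 0], hence
     eventually. *)
  near=> n; apply: fin_num_measure; apply: measurable_ell_star_le => //.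
  by near: n; exact: nbhs_infty_gt.
apply/cvgrPdist_le => e e0.
have := wilks d0 mX mXs indXs lawXs (L1_centered theta0 L2X) (L1_centeredM theta0 L2X)
  (mean_centered L2X EX) (mean_centeredM EX covX) symM psdM MS x0 e0.
by apply: filterS => n; rewrite distrC.
Unshelve. all: by end_near.
Qed.
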